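(* Let $n\ge1$ and let $f(z)$ be a homogeneous complex polynomial of degree $n$ defined on $\mathbb{C}^{n+1}$. If $\partial f=\sum_j \frac{\partial f}{\partial z_j}dz_j$ vanishes only at $0$ (that is, $\partial f(z)\neq0$ for all $z\ne0$), then the cone $C=f^{-1}(0)$ (with the origin removed), which has real dimension $2n$, has a not identically zero Jacobi field with homogeneity $1-n$. Thus, $C$ is not strictly stable.
   Context: Cones. $\mathbb{C}^{n+1}$ is identified with Euclidean $\mathbb{R}^{2n+2}$. The cone $C=f^{-1}(0)\setminus\{0\}$ is $\{r\sigma:\sigma\in\Sigma,\ r\in(0,\infty)\}$ with link $\Sigma=f^{-1}(0)\cap\mathbb{S}^{2n+1}$, and carries the induced metric; being a complex submanifold it is minimal. Put $C_1=\{r\sigma:\sigma\in\Sigma,\ r\in(0,1]\}$, where $r=|x|$. Stability operator. Let $NC$ be the normal bundle, $A$ the second fundamental form, $\nabla^\perp$ the normal connection, $\nabla$ the Levi-Civita connection. In a local orthonormal frame $E_1,\dots,E_{2n}$ of $TC$, set $\Delta^\perp V=\sum_i(\nabla^\perp_{E_i}\nabla^\perp_{E_i}V-\nabla^\perp_{\nabla_{E_i}E_i}V)$, $\tilde A(V)=\sum_{i,j}\langle A(E_i,E_j),V\rangle A(E_i,E_j)$, and $L=\Delta^\perp+\tilde A$ on smooth sections $\Gamma(NC)$. A Jacobi field is a $V\in\Gamma(NC)$ with $LV=0$. It has homogeneity $a$ if $V(r\sigma)=r^aV(\sigma)$ for all $\sigma\in\Sigma$, $r>0$ (as vectors in the ambient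 Euclidean space; normal spaces are constant along rays). Strict stability. $\Gamma_c(NC_1)$ denotes smooth normal fields on $C_1$ with compact support in $C_1$ (so they vanish near the origin). $C$ is strictly stable if $$\inf\Big\{-\frac{\int_{C_1}\langle V,LV\rangle}{\int_{C_1}|V|^2r^{-2}}: V\in\Gamma_c(NC_1),\ V\not\equiv0,\ V=0\text{ on }\Sigma\Big\}>0 .$$ *)

(* Defs.v *)
From HB Require Import structures.
From mathcomp Require Import all_boot all_order all_algebra.
From mathcomp Require Import all_classical all_reals all_analysis.
From mathcomp Require Import complex.
From mathcomp Require mpoly.

Set Implicit Arguments.
Unset Strict Implicit.
Unset Printing Implicit Defensive.
Import Order.TTheory GRing.Theory Num.Theory.
Import numFieldNormedType.Exports.

Local Open Scope classical_set_scope.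
Local Open Scope ring_scope.

(* The library norm `|x| on 'rV[R]_N is the sup norm; it is used for the       *)
(* topology only, and the Euclidean structure is given by dot and enorm.       *)
Definition dot (R : realType) (N : nat) (x y : 'rV[R]_N) : R :=
  \sum_(i < N) x 0 i * y 0 i.

Definition enorm (R : realType) (N : nat) (x : 'rV[R]_N) : R :=
  Num.sqrt (dot x x).

Section Smoothness.
Variables (R : realType) (p q : nat).
Implicit Types (W S : set 'rV[R]_p) (g : 'rV[R]_p -> 'rV[R]_q).

Fixpoint Ck (k : nat) W g : Prop :=
  match k with
  | 0 => forall x, W x -> {for x, continuous g}
  | k'.+1 => (forall x, W x -> differentiable g x) /\
             (forall v : 'rV[R]_p, Ck k' W (fun x => 'D_v g x))
  end.

(* meant for open W *)
Definition smooth W g : Prop := forall k, Ck k W g.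

(* smoothness on an arbitrary subset: local smooth extendability *)
Definition smooth_on S g : Prop :=
  forall x, S x -> exists (W : set 'rV[R]_p) (G : 'rV[R]_p -> 'rV[R]_q),
    [/\ open W, W x, smooth W G & forall y, S y -> W y -> g y = G y].

Lemma smooth_set0 g : smooth set0 g.
Proof. by move=> k; elim: k g => [g x []|k IH g]; split=> [x []|v]. Qed.

End Smoothness.

Section Submanifold.
Variables (R : realType) (N : nat).
Local Notation E := 'rV[R]_N.
Implicit Types (M : set E) (V : E -> E) (x v w : E).

(* psi is a diffeomorphism from the open set U of R^m onto an open part of M *)
Definition local_param M (m : nat) (U : set 'rV[R]_m) (psi : 'rV[R]_m -> E) :=
  [/\ open U, smooth U psi, {in U &, injective psi},
      forall u, U u -> forall v : 'rV[R]_m, 'D_v psi u = 0 -> v = 0 &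
      forall U', open U' -> U' `<=` U ->
        exists2 W : set E, open W & psi @` U' = M `&` W].

Definition submanifold M (m : nat) : Prop :=
  forall x, M x -> exists U psi, local_param M (m := m) U psi /\ (psi @` U) x.

Definition curve_from M x v : set (R -> E) :=
  [set c | [/\ c 0 = x, (\forall t \near (0 : R), M (c t)) &
               is_derive (0 : R) (1 : R) c v]].

Definition tangent M x v : Prop := exists c, curve_from M x v c.

Definition normal M x w : Prop := forall v, tangent M x v -> dot w v = 0.

Definition nproj M x w : E :=
  xget 0 [set u | normal M x u /\ tangent M x (w - u)].

Definition tproj M x w : E := w - nproj M x w.

(* derivative at x, in the tangent direction v, of a field defined along M; it *)
(* does not depend on the curve when V is smooth on M near x                   *)
Definition along M V x v : E :=
  'D_1 (fun t : R => V (xget (fun=> x) (curve_from M x v) t)) 0.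

Definition nablaT M (v : E) V x : E := tproj M x (along M V x v).

Definition nablaN M (v : E) V x : E := nproj M x (along M V x v).

Definition second_form M (X Y : E -> E) x : E := nproj M x (along M Y x (X x)).

Definition local_frame M (m : nat) x (e : 'I_m -> E -> E) : Prop :=
  exists W : set E, [/\ open W, W x,
    forall i, smooth_on (M `&` W) (e i),
    forall i y, M y -> W y -> tangent M y (e i y) &
    forall i j y, M y -> W y -> dot (e i y) (e j y) = (i == j)%:R].

Definition normal_laplacian M (m : nat) (e : 'I_m -> E -> E) V x : E :=
  \sum_(i < m) (nablaN M (e i x) (fun y => nablaN M (e i y) V y) x
                - nablaN M (nablaT M (e i x) (e i) x) V x).

Definition simons M (m : nat) (e : 'I_m -> E -> E) V x : E :=
  \sum_(i < m) \sum_(j < m)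
    dot (second_form M (e i) (e j) x) (V x) *: second_form M (e i) (e j) x.

(* The value does not depend on the local orthonormal frame.                   *)
Definition stability_op M (m : nat) V x : E :=
  xget 0 [set w | exists2 e : 'I_m -> E -> E, local_frame M x e &
                    w = normal_laplacian M e V x + simons M e V x].

Definition normal_field M (S : set E) V : Prop :=
  smooth_on S V /\ forall x, S x -> normal M x (V x).

Definition jacobi_field M (m : nat) V : Prop :=
  normal_field M M V /\ forall x, M x -> stability_op M m V x = 0.

End Submanifold.

Section RiemannianVolume.
Variable R : realType.
Local Open Scope ereal_scope.

(* Lebesgue integral over R^m of a nonnegative Borel function, as an iterated  *)
(* integral (Tonelli)                                                          *)
Fixpoint lebint (m : nat) : ('rV[R]_m -> \bar R) -> \bar R :=
  match m with
  | 0 => fun h => h 0%R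
  | k.+1 => fun h => \int[@lebesgue_measure R]_(t in setT)
              lebint (fun u : 'rV[R]_k => h (row_mx (const_mx t : 'rV_1) u))
  end.

Lemma lebint_ge0 m (h : 'rV[R]_m -> \bar R) :
  (forall u, 0 <= h u) -> 0 <= lebint h.
Proof.
elim: m h => [|m IH] h h0 /=; first exact: h0.
by apply: integral_ge0 => t _; apply: IH => u; exact: h0.
Qed.

Lemma lebint0 m : lebint (fun _ : 'rV[R]_m => 0) = 0.
Proof.
elim: m => [//|m IH] /=.
by under eq_integral do rewrite IH; rewrite integral0.
Qed.

Variables (N m : nat).
Local Notation E := 'rV[R]_N.
Local Notation chart := (set 'rV[R]_m * ('rV[R]_m -> E))%type.
Implicit Types (M A : set E) (c : chart).

Definition gram (psi : 'rV[R]_m -> E) (u : 'rV[R]_m) : 'M[R]_m :=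
  (\matrix_(i, j) dot ('D_(delta_mx 0 i) psi u) ('D_(delta_mx 0 j) psi u))%R.

(* a Borel subset of the domain of a local parametrization of M *)
Definition piece M c : Prop :=
  <<s [set U : set 'rV[R]_m | open U] >> c.1 /\
  exists2 U, local_param M U c.2 & c.1 `<=` U.

(* volume of psi(B) in the metric induced on M *)
Definition piece_volume c : \bar R :=
  lebint (fun u => (Num.sqrt (\det (gram c.2 u)) * \1_(c.1) u)%:E).

Definition piece_cover M A : set (nat -> chart) :=
  [set c | (forall k, piece M (c k)) /\
           A `&` M `<=` \bigcup_k ((c k).2 @` (c k).1)].

(* The Riemannian volume of M, extended to an outer measure; on Borel subsets  *)
(* of M it is the usual volume, with vol(psi(B)) = int_B sqrt(det g).          *)
Definition volume M A : \bar R :=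
  ereal_inf [set \sum_(k <oo) piece_volume (c k) | c in piece_cover M A].

Lemma piece_volume_ge0 c : 0 <= piece_volume c.
Proof.
apply: lebint_ge0 => u; rewrite lee_fin mulr_ge0 ?sqrtr_ge0//.
Qed.

Lemma volume_ge0 M A : 0 <= volume M A.
Proof.
apply: le_ereal_inf_tmp => x [c _ <-].
by apply: nneseries_ge0 => k _ _; exact: piece_volume_ge0.
Qed.

Lemma le_volume M : {homo volume M : A B / A `<=` B >-> A <= B}.
Proof.
move=> A B AB; apply/ereal_inf_le_tmp => x [c [pc Bc] <-].
exists c => //; split => // y [Ay My]; apply: Bc; split => //; exact: AB.
Qed.

Lemma volume0 M : volume M set0 = 0.
Proof.
apply/eqP; rewrite eq_le volume_ge0 andbT; apply: ereal_inf_lbound.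
exists (fun=> (set0, fun=> 0%R)).
  split=> [k|x []//]; split=> /=; first exact: sigma_algebra0.
  exists set0 => //; split=> //=.
  - exact: smooth_set0.
  - by move=> x y; rewrite inE.
  - move=> U' _; rewrite subset0 => ->; exists set0; first exact: open0.
    by rewrite image_set0 setI0.
rewrite (_ : piece_volume _ = 0) ?eseries0//.
rewrite /piece_volume /= -[RHS](lebint0 m); congr lebint.
by apply/funext => u; rewrite indic0 mulr0.
Qed.

Lemma volume_sigma_subadditive M : sigma_subadditive (volume M).
Proof.
move=> A; have [[i ioo]|] := pselect (exists i, volume M (A i) = +oo).
  rewrite (eseries_pinfty _ _ ioo) ?leey// => k _.
  by rewrite -ltNye (lt_le_trans _ (volume_ge0 _ _)).
rewrite -forallNE => Aoo.
suff add2e (e : {posnum R}) :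
    volume M (\bigcup_n A n) <= \sum_(i <oo) volume M (A i) + e%:num%:E.
  by apply/lee_addgt0Pr => _/posnumP[].
rewrite (le_trans _ (epsilon_trick _ _ _))//; last first.
  by move=> k; exact: volume_ge0.
pose P k (c : nat -> chart) := piece_cover M (A k) c /\
  \sum_(j <oo) piece_volume (c j) <=
    volume M (A k) + (e%:num / (2 ^ k.+1)%:R)%:E.
have [G PG] : {G : nat -> nat -> chart & forall k, P k (G k)}.
  apply: (@choice _ _ P) => k; rewrite /P.
  have fk : volume M (A k) \is a fin_num.
    by rewrite ge0_fin_numE ?volume_ge0// ltey; apply/eqP; exact: Aoo.
  have ek : (0 < e%:num / (2 ^ k.+1)%:R)%R by [].
  have [_ [c cA <-] /ltW cle] := lb_ereal_inf_adherent ek fk.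
  by exists c.
have vol_ge0 x : 0 <= (piece_volume \o uncurry G) x by exact: piece_volume_ge0.
apply: (@le_trans _ _ (\esum_(i in setT) (piece_volume \o uncurry G) i)).
  apply: ereal_inf_lbound => /=.
  have /card_esym/ppcard_eqP[f] := card_nat2.
  exists (uncurry G \o f).
    split => [i|y [[i _ Aiy] My]].
      by rewrite /= /uncurry; case: (f i) => a b; exact: (PG a).1.1.
    have [j _ Gij] := (PG i).1.2 y (conj Aiy My).
    by exists (f^-1%FUN (i, j)) => //=; rewrite invK ?inE.
  rewrite -(esum_pred_image (piece_volume \o uncurry G) _ xpredT)
    ?[fun=> _]set_true//.
  by rewrite image_eq.
rewrite (_ : esum _ _ =
    \sum_(i <oo) \sum_(j <oo) piece_volume (G i j)); last first.
  pose J : nat -> set (nat * nat) := fun i => [set (i, j) | j in setT].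
  rewrite (_ : setT = \bigcup_k J k); last first.
    by rewrite predeqE => -[a b]; split => // _; exists a => //; exists b.
  rewrite esum_bigcupT /=; last 2 first.
    - apply/trivIsetP => i j _ _ ij.
      rewrite predeqE => -[a b]; split => //= -[] [_] _ [<-{a} _].
      by move=> [b' _] [] /esym/eqP; rewrite (negbTE ij).
    - by move=> /= [a b]; exact: piece_volume_ge0.
  rewrite -(image_id [set: nat]) -fun_true esum_pred_image//; last first.
    by move=> k _; apply: esum_ge0 => ? _; exact: piece_volume_ge0.
  apply: eq_eseriesr => /= j _.
  rewrite -(esum_pred_image (piece_volume \o uncurry G) (pair j) predT)//=;
    last by move=> ? ? _ _; exact: (@can_inj _ _ _ snd).
  by congr esum; rewrite predeqE => -[a b]; split; move=> [i _ <-]; exists i.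
  by move=> k _; exact: piece_volume_ge0.
apply: lee_lim.
- apply: is_cvg_nneseries => k *.
  by apply: nneseries_ge0 => j *; exact: (vol_ge0 (k, j)).
- by apply: is_cvg_nneseries => k *; apply: adde_ge0 => //; exact: volume_ge0.
- by near=> k; apply: lee_sum => i _; exact: (PG i).2.
Unshelve. all: by end_near. Qed.

HB.instance Definition _ M := isOuterMeasure.Build R E (volume M)
  (volume0 M) (volume_ge0 M) (@le_volume M) (@volume_sigma_subadditive M).

End RiemannianVolume.

(* integral over S `<=` M with respect to the volume measure of M *)
Definition vol_integral (R : realType) (N m : nat) (M S : set 'rV[R]_N)
    (h : 'rV[R]_N -> R) : R :=
  let mu : {outer_measure set 'rV[R]_N -> \bar R} := volume m M in
  \int[(mu : set (caratheodory_type mu) -> \bar R)]_(x in S) h x.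

Section Cone.
Variables (R : realType) (n : nat).
Local Notation E := 'rV[R]_(n.+1 + n.+1).
Implicit Types (f : mpoly.mpoly n.+1 R[i]) (x : E) (V : E -> E).

(* R^(2n+2) is identified with C^(n+1) by z_j = x_j + i x_(n+1+j) *)
Definition cpoint x : 'I_n.+1 -> R[i] :=
  fun j => Complex (x 0 (lshift n.+1 j)) (x 0 (rshift n.+1 j)).

Definition homogeneous_poly (d : nat) f : bool :=
  f \is mpoly.ishomog1 d (mpoly.mpoly_mdeg__canonical__mpoly_Measure n.+1).

Definition cone f : set E :=
  [set x | x != 0 /\ mpoly.meval (cpoint x) f = 0].

Definition link f : set E :=
  [set x | mpoly.meval (cpoint x) f = 0 /\ enorm x = 1].

Definition cone1 f : set E :=
  [set x | exists s r, [/\ link f s, 0 < r <= 1 & x = r *: s]].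

Definition homogeneity f (a : R) V : Prop :=
  forall s r, link f s -> 0 < r -> V (r *: s) = r `^ a *: V s.

(* nonzero elements of Gamma_c(N C_1) vanishing on the link *)
Definition admissible f : set (E -> E) :=
  [set V | [/\ normal_field (cone f) (cone1 f) V,
      exists2 K : set E, compact K /\ K `<=` cone1 f &
        forall x, cone1 f x -> ~ K x -> V x = 0,
      exists2 x, cone1 f x & V x <> 0 &
      forall x, link f x -> V x = 0]].

(* On the boundary link V vanishes, hence so does <V, LV>.                     *)
Definition stability_quotient f V : R :=
  - (vol_integral n.*2 (cone f) (cone1 f)
       (fun x => dot (V x) (stability_op (cone f) n.*2 V x)) /
     vol_integral n.*2 (cone f) (cone1 f)
       (fun x => enorm (V x) ^+ 2 * enorm x ^- 2)).

Definition strictly_stable f : Prop :=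
  (0 < ereal_inf [set (stability_quotient f V)%:E | V in admissible f])%E.

End Cone.

(* Main.v *)
(* Away from the zeros of df the normal bundle of the cone is trivialized by df: the
   normal vector N_c with df(N_c) = c is c conj(df) / |df|^2. Read through this
   trivialization, the normal connection is d - theta with theta = <d(df), df> / |df|^2,
   and the normal Laplacian and the Simons term are traces of the complex Hessian of f
   over a complex tangent space. Since a trace of a complex bilinear form over a complex
   space vanishes, the curvature contributions cancel and L N_1 = 0. As df is
   homogeneous of degree n - 1, the field N_1 is homogeneous of degree 1 - n.

   The Hardy-type exponent 1 - n is the critical one in real dimension 2n: for a radial
   function p(rho), rho = |x|^2, one finds L(p N_1) = 4 (p'' rho + p') N_1, that is,
   the second derivative of p in the variable t = ln rho, up to the factor 4 / rho.
   Bumps in t at scale 1 / d have compact support, and by the choice of the bump their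
   second derivative is at least - 16 d^2 times themselves, pointwise. So the stability
   quotient of p N_1 is at most 64 d^2, and d is arbitrary. *)

Require Import Defs.
From mathcomp Require Import all_boot all_order all_algebra.
From mathcomp Require Import all_classical all_reals all_analysis.
From mathcomp Require Import complex.
From mathcomp Require mpoly.
From mathcomp Require Import ring lra.
Set Implicit Arguments.
Unset Strict Implicit.
Unset Printing Implicit Defensive.
Import Order.TTheory GRing.Theory Num.Theory.
Import numFieldNormedType.Exports.
Import (canonicals, coercions) mpoly.
Local Open Scope classical_set_scope.
Local Open Scope ring_scope.

Local Notation "p .@[ v ]" := (mpoly.meval v p) (at level 1, format "p .@[ v ]").
Local Notation "p ^`M ( i )" := (mpoly.mderiv i p) (at level 1, format "p ^`M ( i )").
Local Notation "z ^*" := (conjc z) : ring_scope.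
Local Notation "x %:C" := (real_complex _ x).
Local Notation Re := complex.Re.
Local Notation Im := complex.Im.

(** * Complex-valued differentials and smooth functions *)

(** The definitions rest on choice: [along] picks a curve, [nproj] a vector, [stability_op] a frame.
    Their values become computable once the tangent space at a point of the cone is known to be the
    whole kernel of [df], and this calls for charts, that is, for an implicit function theorem. Here
    it is drawn from algebra: a nearby root exists, with a quantitative bound, because the complex
    field is algebraically closed; it is unique and differentiable because a divided difference of
    [f] does not vanish.

    No orthonormal frame is ever constructed. Where there is none, [stability_op] is [0], and this
    value also satisfies the Jacobi equation and the pointwise inequality behind the quotient.

    The inequality for the bump is pointwise, so the quotient is estimated without integrating by
    parts. A sine arch satisfies such an inequality but loses smoothness when cut off at its zeros;
    [exp(-1/u)] stays smooth and is convex in [t] near the ends of its support, where a lower bound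
    relative to the function itself is delicate. *)

Section ComplexDifferential.
Variables (R : realType) (V : normedModType R).
Implicit Types (F G dF dG : V -> R[i]) (x v : V).

(* [R[i]] carries no [normedModType R] structure in the library, hence the
   componentwise definition. *)
Definition is_cdiff x G dG : Prop :=
  is_diff x (fun y => Re (G y)) (fun v => Re (dG v)) /\
  is_diff x (fun y => Im (G y)) (fun v => Im (dG v)).

Lemma is_diff_funext x (f df df' : V -> R) :
  is_diff x f df -> df =1 df' -> is_diff x f df'.
Proof. by move=> h /funext <-. Qed.

Lemma is_cdiff_eq x G dG dG' : is_cdiff x G dG -> dG =1 dG' -> is_cdiff x G dG'.
Proof. by move=> h /funext <-. Qed.

Lemma is_cdiff_val x G dG v : is_cdiff x G dG ->
  dG v = Complex ('D_v (fun y => Re (G y)) x) ('D_v (fun y => Im (G y)) x).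
Proof.
move=> [[d1 e1] [d2 e2]].
by rewrite !deriveE // e1 e2; case: (dG v).
Qed.

Lemma is_cdiff_unique x G dG dG' v :
  is_cdiff x G dG -> is_cdiff x G dG' -> dG v = dG' v.
Proof. by move=> h h'; rewrite (is_cdiff_val _ h) (is_cdiff_val _ h'). Qed.

Lemma is_cdiff_cst x (c : R[i]) : is_cdiff x (fun=> c) (fun=> 0).
Proof. by split; exact: is_diff_cst. Qed.

Lemma ReD (a b : R[i]) : Re (a + b) = Re a + Re b. Proof. by case: a b => [? ?] []. Qed.
Lemma ImD (a b : R[i]) : Im (a + b) = Im a + Im b. Proof. by case: a b => [? ?] []. Qed.
Lemma ReN (a : R[i]) : Re (- a) = - Re a. Proof. by case: a. Qed.
Lemma ImN (a : R[i]) : Im (- a) = - Im a. Proof. by case: a. Qed.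
Lemma ReM (a b : R[i]) : Re (a * b) = Re a * Re b - Im a * Im b.
Proof. by case: a b => [? ?] []. Qed.
Lemma ImM (a b : R[i]) : Im (a * b) = Re a * Im b + Im a * Re b.
Proof. by case: a b => [? ?] []. Qed.
Lemma ReJ (a : R[i]) : Re a^* = Re a. Proof. by case: a. Qed.
Lemma ImJ (a : R[i]) : Im a^* = - Im a. Proof. by case: a. Qed.

Lemma complex_eqP (a b : R[i]) : Re a = Re b -> Im a = Im b -> a = b.
Proof. by case: a b => [? ?] [? ?] /= -> ->. Qed.

Lemma is_cdiffD x F G dF dG : is_cdiff x F dF -> is_cdiff x G dG ->
  is_cdiff x (fun y => F y + G y) (fun v => dF v + dG v).
Proof.
move=> [f1 f2] [g1 g2]; split.
  have := is_diffD f1 g1; congr is_diff_def; apply/funext => v /=; by rewrite ReD.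
have := is_diffD f2 g2; congr is_diff_def; apply/funext => v /=; by rewrite ImD.
Qed.

Lemma is_cdiffN x G dG : is_cdiff x G dG ->
  is_cdiff x (fun y => - G y) (fun v => - dG v).
Proof.
move=> [f1 f2]; split.
  have := is_diffN f1; congr is_diff_def; apply/funext => v /=; by rewrite ReN.
have := is_diffN f2; congr is_diff_def; apply/funext => v /=; by rewrite ImN.
Qed.

Lemma is_cdiffJ x G dG : is_cdiff x G dG ->
  is_cdiff x (fun y => (G y)^*) (fun v => (dG v)^*).
Proof.
move=> [f1 f2]; split.
  have := f1; congr is_diff_def; apply/funext => v /=; by rewrite ReJ.
have := is_diffN f2; congr is_diff_def; apply/funext => v /=; by rewrite ImJ.
Qed.

Lemma is_cdiffM x F G dF dG : is_cdiff x F dF -> is_cdiff x G dG ->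
  is_cdiff x (fun y => F y * G y) (fun v => dF v * G x + F x * dG v).
Proof.
move=> [f1 f2] [g1 g2]; split.
  have := is_diffB (is_diffM f1 g1) (is_diffM f2 g2); congr is_diff_def;
   apply/funext => v; first by rewrite ReM.
  rewrite ReD !ReM /=.
  transitivity (Re (F x) * Re (dG v) + Re (G x) * Re (dF v) -
    (Im (F x) * Im (dG v) + Im (G x) * Im (dF v))) => //; ring.
have := is_diffD (is_diffM f1 g2) (is_diffM f2 g1); congr is_diff_def;
   apply/funext => v; first by rewrite ImM.
rewrite ImD !ImM /=.
transitivity (Re (F x) * Im (dG v) + Im (G x) * Re (dF v) +
    (Im (F x) * Re (dG v) + Re (G x) * Im (dF v))) => //; ring.
Qed.

Lemma is_cdiff_real x (g dg : V -> R) : is_diff x g dg ->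
  is_cdiff x (fun y => (g y)%:C) (fun v => (dg v)%:C).
Proof. by move=> h; split => //=; exact: is_diff_cst. Qed.

Lemma is_diffV_real x (g dg : V -> R) : is_diff x g dg -> g x != 0 ->
  is_diff x (fun y => (g y)^-1) (fun v => - (g x) ^- 2 * dg v).
Proof.
move=> [d1 e1] g0; apply: DiffDef; first exact: differentiableV.
by rewrite diffV // e1.
Qed.

Lemma cplx_sqr_neq0 (a : R[i]) : a != 0 -> Re a ^+ 2 + Im a ^+ 2 != 0.
Proof.
apply: contra; rewrite paddr_eq0 ?sqr_ge0 // !sqrf_eq0 => /andP[/eqP r /eqP i].
by case: a r i => ? ? /= -> ->.
Qed.

Lemma invcE (a : R[i]) : a^-1 = a^* * ((Re a ^+ 2 + Im a ^+ 2)^-1)%:C.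
Proof.
apply: complex_eqP; case: a => a b /=; ring.
Qed.

Lemma is_cdiffV x G dG : is_cdiff x G dG -> G x != 0 ->
  is_cdiff x (fun y => (G y)^-1) (fun v => - dG v / G x ^+ 2).
Proof.
move=> h G0; have [f1 f2] := h.
have hh : is_diff x (fun y => Re (G y) ^+ 2 + Im (G y) ^+ 2)
   (fun v => 2 * Re (G x) * Re (dG v) + 2 * Im (G x) * Im (dG v)).
  have := is_diffD (is_diffX 1 f1) (is_diffX 1 f2); congr is_diff_def.
have n0 := cplx_sqr_neq0 G0.
have /is_cdiff_real hi := is_diffV_real hh n0.
have key := is_cdiffM (is_cdiffJ h) hi.
have E : (fun y => (G y)^-1) = (fun y => (G y)^* * ((Re (G y) ^+ 2 + Im (G y) ^+ 2)^-1)%:C).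
  by apply/funext => y; rewrite -invcE.
rewrite E; apply: is_cdiff_eq key _ => v.
rewrite -[in RHS]exprVn [in RHS]invcE; apply: complex_eqP;
  move: n0; case: (G x) (dG v) => a b [c d] /= n0; field; exact: n0.
Qed.
End ComplexDifferential.

(** * Differentials from epsilon estimates and from germs *)

Section DifferentialEps.
Variables (R : realType) (V W : normedModType R).

Lemma is_diff_eps (f : V -> W) (df : {linear V -> W}) (x : V) :
  continuous df ->
  (forall e : R, 0 < e -> \forall h \near (0 : V),
     `|f (h + x) - f x - df h| <= e * `|h|) -> is_diff x f df.
Proof.
move=> cdf H.
have E : f \o shift x = cst (f x) + df +o_ (0 : V) id.
  apply/eqaddoP => e e0; have := H e e0; apply: filterS => h /=.
  by rewrite !fctE /= opprD addrA.
have D := diff_unique cdf E.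
apply: DiffDef => //; apply/diff_locallyP; split; rewrite D //.
Qed.

Lemma diff_eps (f : V -> W) (x : V) : differentiable f x ->
  forall e : R, 0 < e -> \forall h \near (0 : V),
     `|f (h + x) - f x - 'd f x h| <= e * `|h|.
Proof.
move=> /diff_locallyP [_ /eqaddoP H] e e0; have := H e e0; apply: filterS => h /=.
by rewrite !fctE /= opprD addrA.
Qed.

Lemma near_eq_is_diff (f g df : V -> W) (x : V) :
  (\near x, f x = g x) -> is_diff x f df -> is_diff x g df.
Proof.
move=> fg [d e].
have gx : f x = g x by exact: nbhs_singleton fg.
rewrite -e; apply: is_diff_eps; first exact: diff_continuous.
move=> eps e0; have := diff_eps d e0.
move: fg; rewrite (near_shift 0) /= subr0 => fg; apply: filterS2 fg => h.
by rewrite /= gx => ->.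
Qed.

End DifferentialEps.

(** * Complex differentials of compositions, sums and polynomials *)

Section ComplexDifferentialRules.
Variable R : realType.

Lemma is_cdiff_comp (U V : normedModType R) (x : U) (g dg : U -> V)
    (G dG : V -> R[i]) :
  is_diff x g dg -> is_cdiff (g x) G dG ->
  is_cdiff x (fun y => G (g y)) (fun v => dG (dg v)).
Proof. by move=> h [h1 h2]; split; [exact: is_diff_comp h h1|exact: is_diff_comp h h2]. Qed.

Lemma near_eq_is_cdiff (V : normedModType R) (x : V) (F G dF : V -> R[i]) :
  (\near x, F x = G x) -> is_cdiff x F dF -> is_cdiff x G dF.
Proof.
move=> FG [h1 h2]; split.
  by apply: near_eq_is_diff h1; apply: filterS FG => y ->.
by apply: near_eq_is_diff h2; apply: filterS FG => y ->.
Qed.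

Lemma is_cdiff_sum (V : normedModType R) (x : V) (I : Type) (r : seq I)
    (F dF : I -> V -> R[i]) :
  (forall i, is_cdiff x (F i) (dF i)) ->
  is_cdiff x (fun y => \sum_(i <- r) F i y) (fun v => \sum_(i <- r) dF i v).
Proof.
move=> h; elim: r => [|i r IH].
  have E (f : I -> V -> R[i]) : (fun y => \sum_(i <- [::]) f i y) = fun=> 0.
    by apply/funext => y; rewrite big_nil.
  by rewrite !E; exact: is_cdiff_cst.
have E (f : I -> V -> R[i]) :
    (fun y => \sum_(i <- i :: r) f i y) = fun y => f i y + \sum_(i <- r) f i y.
  by apply/funext => y; rewrite big_cons.
by rewrite !E; apply: is_cdiffD.
Qed.

(** Induction along the ring operations. The facts on evaluation that are proved with it obey a sum
    rule and a product rule, so that only constants and variables remain. *)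
Lemma mpoly_alg_ind (n : nat) (S : comNzRingType) (P : mpoly.mpoly n S -> Prop) :
  (forall c, P (mpoly.mpolyC n c)) -> (forall i, P (mpoly.mpolyX S (mpoly.mnm1 i))) ->
  (forall p q, P p -> P q -> P (p + q)) -> (forall p q, P p -> P q -> P (p * q)) ->
  forall p, P p.
Proof.
move=> PC PX PD PM; elim/mpoly.mpolyind => [|c m p _ _ Pp].
  by rewrite -mpoly.mpolyC0.
rewrite -mpoly.mul_mpolyC; apply: (PD _ _ _ Pp); apply: (PM _ _ (PC _)).
rewrite mpoly.mpolyXE_id; apply: big_ind => //.
  by rewrite -mpoly.mpolyC1.
move=> i _; elim: (m i) => [|k IH]; first by rewrite expr0 -mpoly.mpolyC1.
by rewrite exprS; apply: PM.
Qed.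

Lemma sum_mderivXU (n : nat) (i : 'I_n) (z w : 'I_n -> R[i]) :
  \sum_j (mpoly.mpolyX R[i] (mpoly.mnm1 i))^`M(j).@[z] * w j = w i.
Proof.
rewrite (bigD1 i) //= big1 => [|j ji].
  rewrite mpoly.mderivX mpoly.mnm1E eqxx scale1r.
  rewrite -{1}(mpoly.add0m (mpoly.mnm1 i)) mpoly.addmK mpoly.mpolyX0.
  by rewrite mpoly.meval1 mul1r addr0.
by rewrite mpoly.mderivX mpoly.mnm1E [i == j]eq_sym (negbTE ji) scale0r mpoly.meval0 mul0r.
Qed.

Lemma is_cdiff_meval (V : normedModType R) (x : V) (n : nat)
    (p : mpoly.mpoly n R[i]) (F dF : 'I_n -> V -> R[i]) :
  (forall i, is_cdiff x (F i) (dF i)) ->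
  is_cdiff x (fun y => p.@[F ^~ y]) (fun v => \sum_j p^`M(j).@[F ^~ x] * dF j v).
Proof.
move=> hF; elim/mpoly_alg_ind: p => [c|i|p q hp hq|p q hp hq].
- have -> : (fun y => (mpoly.mpolyC n c).@[F ^~ y]) = fun=> c.
    by apply/funext => y; rewrite mpoly.mevalC.
  apply: is_cdiff_eq (is_cdiff_cst x c) _ => v.
  by rewrite big1 // => j _; rewrite mpoly.mderivC mpoly.meval0 mul0r.
- have -> : (fun y => (mpoly.mpolyX R[i] (mpoly.mnm1 i)).@[F ^~ y]) = F i.
    by apply/funext => y; rewrite mpoly.mevalXU.
  apply: is_cdiff_eq (hF i) _ => v.
  by rewrite sum_mderivXU.
- have -> : (fun y => (p + q).@[F ^~ y]) = fun y => p.@[F ^~ y] + q.@[F ^~ y].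
    by apply/funext => y; rewrite mpoly.mevalD.
  apply: is_cdiff_eq (is_cdiffD hp hq) _ => v.
  rewrite -big_split; apply: eq_bigr => j _ /=.
  by rewrite mpoly.mderivD mpoly.mevalD mulrDl.
- have -> : (fun y => (p * q).@[F ^~ y]) = fun y => p.@[F ^~ y] * q.@[F ^~ y].
    by apply/funext => y; rewrite mpoly.mevalM.
  apply: is_cdiff_eq (is_cdiffM hp hq) _ => v.
  rewrite mulr_suml mulr_sumr -big_split; apply: eq_bigr => j _ /=.
  by rewrite mpoly.mderivM mpoly.mevalD !mpoly.mevalM mulrDl mulrAC mulrA.
Qed.

Lemma is_diff_coord (m n : nat) (i : 'I_m) (j : 'I_n) (x : 'M[R]_(m, n)) :
  is_diff x (fun M : 'M[R]_(m, n) => M i j) (fun M : 'M[R]_(m, n) => M i j).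
Proof.
apply: DiffDef; first exact: differentiable_coord.
apply/funext => v; rewrite -deriveE; last exact: differentiable_coord.
have d : derivable (id : 'M[R]_(m, n) -> 'M[R]_(m, n)) x v by exact: derivable_id.
by have := derive_mx d; rewrite derive_id => /matrixP /(_ i j); rewrite mxE => ->.
Qed.

Lemma is_cdiff_cpoint (n : nat) (x : 'rV[R]_(n.+1 + n.+1)) j :
  is_cdiff x (fun y => Defs.cpoint y j) (fun v => Defs.cpoint v j).
Proof. by split; exact: is_diff_coord. Qed.

End ComplexDifferentialRules.

(** * Function classes closed under rational operations *)

Section FunctionAlgebra.
Variables (R : realType) (T : Type) (S : set T).

(** Continuity at [x] (with [S] the singleton of [x]) and the class [C^k] on an open set [S] are
    both of this kind, so the regularity of rational expressions is treated once for the two. *)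
Record fun_alg (P : (T -> R) -> Prop) : Prop := FunAlg {
  fun_alg_cst : forall c, P (fun=> c);
  fun_algD : forall f g, P f -> P g -> P (fun x => f x + g x);
  fun_algM : forall f g, P f -> P g -> P (fun x => f x * g x);
  fun_algV : forall f, P f -> (forall x, S x -> f x != 0) -> P (fun x => (f x)^-1) }.

Variables (P : (T -> R) -> Prop) (hP : fun_alg P).

Definition cplx_class (G : T -> R[i]) : Prop :=
  P (fun x => Re (G x)) /\ P (fun x => Im (G x)).

Lemma fun_algN f : P f -> P (fun x => - f x).
Proof.
move=> Pf; have := fun_algM hP (fun_alg_cst hP (-1)) Pf.
by congr P; apply/funext => x; rewrite mulN1r.
Qed.

Lemma cplx_class_cst c : cplx_class (fun=> c).
Proof. by split; exact: fun_alg_cst. Qed.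

Lemma cplx_classD F G : cplx_class F -> cplx_class G -> cplx_class (fun x => F x + G x).
Proof.
move=> [f1 f2] [g1 g2]; split.
  by have := fun_algD hP f1 g1; congr P; apply/funext => x; rewrite ReD.
by have := fun_algD hP f2 g2; congr P; apply/funext => x; rewrite ImD.
Qed.

Lemma cplx_classN F : cplx_class F -> cplx_class (fun x => - F x).
Proof.
move=> [f1 f2]; split.
  by have := fun_algN f1; congr P; apply/funext => x; rewrite ReN.
by have := fun_algN f2; congr P; apply/funext => x; rewrite ImN.
Qed.

Lemma cplx_classJ F : cplx_class F -> cplx_class (fun x => (F x)^*).
Proof.
move=> [f1 f2]; split.
  by have := f1; congr P; apply/funext => x; rewrite ReJ.
by have := fun_algN f2; congr P; apply/funext => x; rewrite ImJ.
Qed.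

Lemma cplx_classM F G : cplx_class F -> cplx_class G -> cplx_class (fun x => F x * G x).
Proof.
move=> [f1 f2] [g1 g2]; split.
  have := fun_algD hP (fun_algM hP f1 g1) (fun_algN (fun_algM hP f2 g2)).
  by congr P; apply/funext => x; rewrite ReM.
have := fun_algD hP (fun_algM hP f1 g2) (fun_algM hP f2 g1).
by congr P; apply/funext => x; rewrite ImM.
Qed.

Lemma cplx_classR f : P f -> cplx_class (fun x => (f x)%:C).
Proof. by move=> Pf; split => //; exact: fun_alg_cst. Qed.

Lemma cplx_classV F : cplx_class F -> (forall x, S x -> F x != 0) ->
  cplx_class (fun x => (F x)^-1).
Proof.
move=> hF F0; have [f1 f2] := hF.
have hn : P (fun x => (Re (F x) ^+ 2 + Im (F x) ^+ 2)^-1).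
  apply: (fun_algV hP) => [|x /F0]; last exact: cplx_sqr_neq0.
  by apply: (fun_algD hP); [exact: (fun_algM hP f1 f1)|exact: (fun_algM hP f2 f2)].
have := cplx_classM (cplx_classJ hF) (cplx_classR hn).
by congr cplx_class; apply/funext => x; rewrite -invcE.
Qed.

Lemma cplx_class_sum (I : Type) (r : seq I) (F : I -> T -> R[i]) :
  (forall i, cplx_class (F i)) -> cplx_class (fun x => \sum_(i <- r) F i x).
Proof.
move=> hF; elim: r => [|i r IH].
  have -> : (fun x => \sum_(i <- [::]) F i x) = fun=> 0.
    by apply/funext => x; rewrite big_nil.
  exact: cplx_class_cst.
have -> : (fun x => \sum_(j <- i :: r) F j x) = fun x => F i x + \sum_(j <- r) F j x.
  by apply/funext => x; rewrite big_cons.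
exact: cplx_classD.
Qed.

Lemma cplx_class_meval (n : nat) (p : mpoly.mpoly n R[i]) (F : 'I_n -> T -> R[i]) :
  (forall i, cplx_class (F i)) -> cplx_class (fun x => p.@[F ^~ x]).
Proof.
move=> hF; elim/mpoly_alg_ind: p => [c|i|p q hp hq|p q hp hq].
- by have := cplx_class_cst c; congr cplx_class; apply/funext => y; rewrite mpoly.mevalC.
- by have := hF i; congr cplx_class; apply/funext => y; rewrite mpoly.mevalXU.
- by have := cplx_classD hp hq; congr cplx_class; apply/funext => y; rewrite mpoly.mevalD.
- by have := cplx_classM hp hq; congr cplx_class; apply/funext => y; rewrite mpoly.mevalM.
Qed.

End FunctionAlgebra.

(** * Real functions of class [C^k] *)

Section ScalarSmoothness.
Variable R : realType.

Lemma continuous_fun_alg (V : topologicalType) (x : V) :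
  fun_alg [set x] (fun g : V -> R => {for x, continuous g}).
Proof.
split=> [c|f g|f g|f hf f0].
- exact: cst_continuous.
- exact: continuousD.
- exact: continuousM.
- by apply: continuousV => //; exact: f0.
Qed.

Variable V : normedModType R.
Implicit Types (W : set V) (g : V -> R).

(** Scalar counterpart of [Ck]: products and inverses make sense here, and [Ck_coord] goes back to
    vectors. *)
Fixpoint Ckr (k : nat) W g : Prop :=
  match k with
  | 0 => forall x, W x -> {for x, continuous g}
  | k'.+1 => (forall x, W x -> differentiable g x) /\
             (forall v : V, Ckr k' W (fun x => 'D_v g x))
  end.

Lemma CkrW k W g : Ckr k.+1 W g -> Ckr k W g.
Proof.
elim: k g => [g [d _] x /d|k IH g [d D]]; first exact: differentiable_continuous.
by split => // v; apply/IH/D.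
Qed.

Lemma open_near_eq W f g x : open W -> W x -> (forall y, W y -> f y = g y :> R) ->
  \near x, f x = g x.
Proof. by move=> oW Wx fg; apply: filterS fg _; exact: open_nbhs_nbhs. Qed.

Lemma Ckr_ext k W f g : open W -> (forall x, W x -> f x = g x) -> Ckr k W f -> Ckr k W g.
Proof.
move=> oW; elim: k f g => [|k IH] f g fg.
  move=> cf x Wx; have nfg := open_near_eq oW Wx fg.
  rewrite /prop_for /continuous_at -(fg _ Wx); apply: cvg_trans (cf x Wx).
  by apply: near_eq_cvg; apply: filterS nfg.
move=> [d D]; split=> [x Wx|v].
  by have [] := near_eq_is_diff (open_near_eq oW Wx fg) (differentiableP (d x Wx)).
apply: IH (D v) => x Wx; apply: near_eq_derive; exact: open_near_eq Wx fg.
Qed.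

Lemma CkrD k W f g : open W -> Ckr k W f -> Ckr k W g -> Ckr k W (fun x => f x + g x).
Proof.
move=> oW; elim: k f g => [|k IH] f g.
  by move=> cf cg x Wx; apply: continuousD; [exact: cf|exact: cg].
move=> [df Df] [dg Dg]; split=> [x Wx|v].
  by apply: differentiableD; [exact: df|exact: dg].
apply: Ckr_ext (IH _ _ (Df v) (Dg v)) => // x Wx.
by rewrite -deriveD //; apply: diff_derivable; [exact: df|exact: dg].
Qed.

Lemma Ckr_cst k W c : Ckr k W (fun=> c).
Proof.
elim: k c => [c x _|k IH c]; first exact: cst_continuous.
split=> [x _|v]; first exact: differentiable_cst.
have -> : (fun x => 'D_v (fun=> c) x) = fun=> 0 :> R.
  by apply/funext => x; rewrite derive_cst.
exact: IH.
Qed.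

Lemma CkrM k W f g : open W -> Ckr k W f -> Ckr k W g -> Ckr k W (fun x => f x * g x).
Proof.
move=> oW; elim: k f g => [|k IH] f g.
  by move=> cf cg x Wx; apply: continuousM; [exact: cf|exact: cg].
move=> hf hg; have [[df Df] [dg Dg]] := (hf, hg); split=> [x Wx|v].
  by apply: differentiableM; [exact: df|exact: dg].
apply: (@Ckr_ext _ _ (fun x => f x * 'D_v g x + g x * 'D_v f x)) => // [x Wx|].
  by rewrite deriveM //; apply: diff_derivable; [exact: df|exact: dg].
apply: CkrD => //; apply: IH; [exact: CkrW|exact: Dg|exact: CkrW|exact: Df].
Qed.

(** The outer function comes with the whole sequence of its derivatives, so that the induction on
    [k] can pass from [b j] to [b j.+1]. It is meant for the functions [flat]. *)
Lemma Ckr_comp (D : set R) (b : nat -> R -> R) k W g : open W ->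
  (forall j y, D y -> is_derive y 1 (b j) (b j.+1 y)) ->
  (forall x, W x -> D (g x)) -> Ckr k W g -> forall j, Ckr k W (fun x => b j (g x)).
Proof.
move=> oW hb WD; elim: k g WD => [|k IH] g WD.
  move=> cg j x Wx; apply: continuous_comp; first exact: cg.
  by apply/differentiable_continuous/derivable1_diffP; have [] := hb j _ (WD _ Wx).
move=> hg j; have [dg Dg] := hg.
have db x : W x -> differentiable (b j) (g x).
  by move=> Wx; apply/derivable1_diffP; have [] := hb j _ (WD _ Wx).
split=> [x Wx|v].
  by apply: differentiable_comp; [exact: dg|exact: db].
apply: (@Ckr_ext _ _ (fun x => b j.+1 (g x) * 'D_v g x)) => // [x Wx|].
  have d1 := dg x Wx; have d2 := db x Wx.
  rewrite [RHS]deriveE; last exact: (differentiable_comp d1 d2).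
  rewrite (diff_comp d1 d2) /= deriveE // diff1E // derive1E.
  by have [_ ->] := hb j _ (WD _ Wx); rewrite mulrC.
by apply: CkrM => //; [apply: IH => //; exact: CkrW|exact: Dg].
Qed.

Lemma CkrV k W g : open W -> Ckr k W g -> (forall x, W x -> g x != 0) ->
  Ckr k W (fun x => (g x)^-1).
Proof.
move=> oW; elim: k g => [|k IH] g.
  by move=> cg g0 x Wx; apply: continuousV; [exact: g0|exact: cg].
move=> hg g0; have [dg Dg] := hg; split=> [x Wx|v].
  by apply: differentiableV; [exact: dg|exact: g0].
have hV : Ckr k W (fun x => (g x)^-1) by apply: IH => //; exact: CkrW.
apply: (@Ckr_ext _ _ (fun x => -1 * ((g x)^-1 * (g x)^-1) * 'D_v g x)) => // [x Wx|].
  rewrite [RHS]deriveE; last by apply: differentiableV; [exact: dg|exact: g0].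
  rewrite diffV; [|exact: dg|exact: g0].
  rewrite /= mulN1r -expr2 exprVn deriveE //; exact: dg.
apply: CkrM => //; last exact: Dg.
by apply: CkrM => //; [exact: Ckr_cst|exact: CkrM].
Qed.

Lemma Ckr_fun_alg k W : open W -> fun_alg W (Ckr k W).
Proof.
move=> oW; split; first exact: Ckr_cst.
- by move=> f g; exact: CkrD.
- by move=> f g; exact: CkrM.
- by move=> f; exact: CkrV.
Qed.

End ScalarSmoothness.

(** * Vector-valued maps, coordinate by coordinate *)

Section VectorSmoothness.
Variables (R : realType) (p q : nat).
Implicit Types (W : set 'rV[R]_p) (g : 'rV[R]_p -> 'rV[R]_q).

Lemma continuous_rV (T : topologicalType) (g : T -> 'rV[R]_q) x :
  (forall i, {for x, continuous (fun y => g y 0 i)}) -> {for x, continuous g}.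
Proof.
move=> h; rewrite /prop_for /continuous_at.
have -> : g = fun y => \sum_(i < q) g y 0 i *: delta_mx 0 i.
  by apply/funext => y; rewrite -row_sum_delta.
apply: cvg_big => [|i _]; first exact: add_continuous.
by apply: cvgZr_tmp; exact: h.
Qed.

Lemma is_diff_rV (V : normedModType R) (x : V) (g dg : V -> 'rV[R]_q) :
  (forall i, is_diff x (fun y => g y 0 i) (fun v => dg v 0 i)) -> is_diff x g dg.
Proof.
move=> h.
have E (f : V -> 'rV[R]_q) : f = \sum_(i < q) (fun y => f y 0 i *: delta_mx 0 i).
  by apply/funext => y; rewrite fct_sumE -row_sum_delta.
have hd i : differentiable (fun y => g y 0 i *: (delta_mx 0 i : 'rV[R]_q)) x.
  by apply: differentiableZl; have [] := h i.
have dg' : differentiable g x by rewrite (E g); exact: differentiable_sum.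
apply: DiffDef => //; apply/funext => v; rewrite -deriveE //.
rewrite derive_mx; last exact: diff_derivable.
apply/rowP => i; rewrite mxE deriveE; last by have [] := h i.
by have [_ ->] := h i.
Qed.

Lemma Ck_coord k W g : open W -> (forall i, Ckr k W (fun x => g x 0 i)) -> Ck k W g.
Proof.
move=> oW; elim: k g => [|k IH] g h.
  by move=> x Wx; apply: continuous_rV => i; exact: h.
have d x : W x -> differentiable g x.
  move=> Wx; suff: is_diff x g (fun v => \row_i 'd (fun x => g x 0 i) x v) by case.
  apply: is_diff_rV => i; have [/(_ x Wx) /differentiableP di _] := h i.
  by apply: is_diff_funext di _ => v; rewrite mxE.
split=> // v; apply: IH => i; have [_ Di] := h i.
apply: Ckr_ext (Di v) => // x Wx.
by rewrite derive_mx ?mxE //; apply: diff_derivable; exact: d.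
Qed.

End VectorSmoothness.

(** * The normal bundle of a complex hypersurface *)

Section HypersurfaceAlgebra.
Variables (R : realType) (n : nat).
Local Notation E := 'rV[R]_(n.+1 + n.+1).
Local Notation cp := Defs.cpoint.
Implicit Types (x u v w : E) (c : R[i]).

Definition cvec (w : 'I_n.+1 -> R[i]) : E :=
  row_mx (\row_j Re (w j)) (\row_j Im (w j)).

Lemma cvecK (z : 'I_n.+1 -> R[i]) j : cp (cvec z) j = z j.
Proof.
by rewrite /Defs.cpoint /cvec row_mxEl row_mxEr !mxE; case: (z j).
Qed.

Lemma cpoint_inj u v : cp u =1 cp v -> u = v.
Proof.
move=> h; apply/rowP => i; rewrite -(splitK i); case: (fintype.split i) => j /=.
  by have := h j => -[].
by have := h j => -[].
Qed.

Lemma cpointD u v j : cp (u + v) j = cp u j + cp v j.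
Proof. by rewrite /Defs.cpoint !mxE. Qed.

Lemma cpointN u j : cp (- u) j = - cp u j.
Proof. by rewrite /Defs.cpoint !mxE. Qed.

Lemma cpoint0 j : cp (0 : E) j = 0.
Proof. by rewrite /Defs.cpoint !mxE. Qed.

Lemma cpointZ (a : R) u j : cp (a *: u) j = a%:C * cp u j.
Proof. by apply: complex_eqP; rewrite ?ReM ?ImM /= !mxE mul0r ?subr0 ?addr0. Qed.

Lemma Re_sum (I : Type) (r : seq I) (P : pred I) (F : I -> R[i]) :
  Re (\sum_(i <- r | P i) F i) = \sum_(i <- r | P i) Re (F i).
Proof. exact: (big_morph (@Re R) (@ReD R) erefl). Qed.

Lemma dotE u v : dot u v = Re (\sum_j cp u j * (cp v j)^*).
Proof.
rewrite Re_sum /dot big_split_ord /= -big_split /=; apply: eq_bigr => j _.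
by rewrite /= mulrN opprK.
Qed.

Lemma dotC u v : dot u v = dot v u.
Proof. by apply: eq_bigr => i _; rewrite mulrC. Qed.

Lemma dotDl u v w : dot (u + v) w = dot u w + dot v w.
Proof. by rewrite /dot -big_split; apply: eq_bigr => i _; rewrite mxE mulrDl. Qed.

Lemma dotZl (a : R) u v : dot (a *: u) v = a * dot u v.
Proof. by rewrite /dot mulr_sumr; apply: eq_bigr => i _; rewrite mxE mulrA. Qed.

Lemma dot_ge0 u : 0 <= dot u u.
Proof. by apply: sumr_ge0 => i _; rewrite -expr2 sqr_ge0. Qed.

Lemma dot_eq0 u : dot u u = 0 -> u = 0.
Proof.
move=> h; apply/rowP => i; rewrite mxE; apply/eqP; rewrite -sqrf_eq0 expr2.
move/eqP: h; rewrite psumr_eq0 => [/allP /(_ i)|j _]; last by rewrite -expr2 sqr_ge0.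
by rewrite mem_index_enum => /(_ isT).
Qed.

Lemma dot_gt0 u : u != 0 -> 0 < dot u u.
Proof.
by move=> u0; rewrite lt_def dot_ge0 andbT; apply: contra_neq u0; exact: dot_eq0.
Qed.

Variable f : mpoly.mpoly n.+1 R[i].

Definition gradc j x : R[i] := f^`M(j).@[cp x].
Definition dgrad j x v : R[i] := \sum_k f^`M(j)^`M(k).@[cp x] * cp v k.
Definition dfc x v : R[i] := \sum_j gradc j x * cp v j.
Definition gradsq x : R[i] := \sum_j gradc j x * (gradc j x)^*.
Definition hessc x u v : R[i] := \sum_j dgrad j x u * cp v j.
(* connection form of the normal bundle in the trivialization given by [df] *)
Definition theta x v : R[i] := (\sum_j dgrad j x v * (gradc j x)^*) / gradsq x.
(* the normal vector with [dfc x (dfdual x c) = c] *)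
Definition dfdual x c : E := cvec (fun j => c * (gradc j x)^* / gradsq x).

Lemma dfcD x u v : dfc x (u + v) = dfc x u + dfc x v.
Proof. by rewrite /dfc -big_split; apply: eq_bigr => j _; rewrite cpointD mulrDr. Qed.

Lemma dfcN x u : dfc x (- u) = - dfc x u.
Proof. by rewrite /dfc -sumrN; apply: eq_bigr => j _; rewrite cpointN mulrN. Qed.

Lemma dfcZ x (a : R) u : dfc x (a *: u) = a%:C * dfc x u.
Proof. by rewrite /dfc mulr_sumr; apply: eq_bigr => j _; rewrite cpointZ mulrCA. Qed.

Lemma dfdualD x c c' : dfdual x (c + c') = dfdual x c + dfdual x c'.
Proof. by apply: cpoint_inj => j; rewrite cpointD !cvecK !mulrDl. Qed.

Lemma dfdualN x c : dfdual x (- c) = - dfdual x c.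
Proof. by apply: cpoint_inj => j; rewrite cpointN !cvecK !mulNr. Qed.

Lemma dfdualZ x (a : R) c : dfdual x (a%:C * c) = a *: dfdual x c.
Proof. by apply: cpoint_inj => j; rewrite cpointZ !cvecK !mulrA. Qed.

Lemma dfdual_sum x (I : Type) (r : seq I) (F : I -> R[i]) :
  dfdual x (\sum_(i <- r) F i) = \sum_(i <- r) dfdual x (F i).
Proof.
elim: r => [|i r IH]; last by rewrite !big_cons dfdualD IH.
by rewrite !big_nil; apply: cpoint_inj => j; rewrite cvecK !mul0r cpoint0.
Qed.

Lemma gradsqJ x : (gradsq x)^* = gradsq x.
Proof.
rewrite /gradsq rmorph_sum; apply: eq_bigr => j _ /=.
by rewrite rmorphM /= conjcK mulrC.
Qed.

Lemma gradsq_neq0 x : (exists j, gradc j x != 0) -> gradsq x != 0.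
Proof.
move=> [j hj]; rewrite /gradsq psumr_eq0 => [|i _]; last exact: mulcJ_ge0.
apply/allPn; exists j; first exact: mem_index_enum.
by rewrite mulf_neq0 // conjc_eq0.
Qed.

Lemma gradsqE x : gradsq x = (Re (gradsq x))%:C.
Proof.
apply: complex_eqP => //=.
have /(congr1 (@complex.Im R)) := gradsqJ x; rewrite ImJ => h; lra.
Qed.

Lemma Re_gradsq_ge0 x : 0 <= Re (gradsq x).
Proof.
rewrite Re_sum; apply: sumr_ge0 => j _.
by rewrite ReM ReJ ImJ mulrN opprK addr_ge0 // -expr2 sqr_ge0.
Qed.

Lemma Re_gradsq_gt0 x : gradsq x != 0 -> 0 < Re (gradsq x).
Proof.
move=> g0; rewrite lt_def Re_gradsq_ge0 andbT; apply: contra g0 => /eqP h.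
by rewrite gradsqE h.
Qed.

Lemma dfc_dfdual x c : gradsq x != 0 -> dfc x (dfdual x c) = c.
Proof.
move=> g0; rewrite /dfc.
under eq_bigr => j _ do rewrite cvecK mulrA mulrCA.
by rewrite -mulr_suml -mulr_sumr mulfK.
Qed.

(** This is what makes [theta] a connection form: it is the term produced by the variation of [df]
    when [dfc f y (dfdual f y c)] is differentiated. *)
Lemma hessc_dfdual x v c : hessc x v (dfdual x c) = c * theta x v.
Proof.
rewrite /hessc /theta.
under eq_bigr => j _ do rewrite cvecK mulrA mulrCA.
by rewrite -mulr_suml -mulr_sumr mulrA.
Qed.

Lemma dot_dfdual x c v : dot (dfdual x c) v = Re (c * (dfc x v)^*) / Re (gradsq x).
Proof.
rewrite dotE; have -> : \sum_j cp (dfdual x c) j * (cp v j)^* =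
    c * (dfc x v)^* / gradsq x.
  rewrite /dfc rmorph_sum mulr_sumr mulr_suml; apply: eq_bigr => j _.
  by rewrite cvecK rmorphM /= -!mulrA; congr (_ * _); rewrite mulrCA [LHS]mulrC mulrA
    mulrAC; ring.
(* At a zero of the gradient both sides are [0], since [0^-1 = 0]. *)
have [->|g0] := eqVneq (gradsq x) 0; first by rewrite /= !invr0 !mulr0.
rewrite {1}gradsqE.
have -> : ((Re (gradsq x))%:C)^-1 = ((Re (gradsq x))^-1)%:C by rewrite -fmorphV.
by rewrite ReM /= mulr0 subr0.
Qed.

Lemma thetaD x u v : theta x (u + v) = theta x u + theta x v.
Proof.
rewrite /theta -mulrDl -big_split; congr (_ / _); apply: eq_bigr => j _ /=.
rewrite -mulrDl -big_split; congr (_ * _); apply: eq_bigr => k _ /=.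
by rewrite cpointD mulrDr.
Qed.

Lemma thetaZ x (a : R) v : theta x (a *: v) = a%:C * theta x v.
Proof.
rewrite /theta mulrA mulr_sumr; congr (_ / _); apply: eq_bigr => j _ /=.
rewrite mulrA mulr_sumr; congr (_ * _); apply: eq_bigr => k _ /=.
by rewrite cpointZ mulrCA.
Qed.

Lemma theta_dfdual x c : theta x (dfdual x c) = c * theta x (dfdual x 1).
Proof.
rewrite /theta mulrA mulr_sumr; congr (_ / _); apply: eq_bigr => j _ /=.
rewrite mulrA mulr_sumr; congr (_ * _); apply: eq_bigr => k _ /=.
by rewrite !cvecK mul1r -!mulrA [RHS]mulrCA.
Qed.

End HypersurfaceAlgebra.

(** * Traces over an orthonormal frame of the complex hyperplane [ker df] *)

Section FrameTraces.
Variable R : realType.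

Lemma conjcM (a b : R[i]) : (a * b)^* = a^* * b^*.
Proof. exact: rmorphM. Qed.

Lemma conjcV (a : R[i]) : (a^-1)^* = (a^*)^-1.
Proof. exact: conjc_inv. Qed.

Lemma conjc_sum (I : Type) (r : seq I) (P : pred I) (F : I -> R[i]) :
  (\sum_(i <- r | P i) F i)^* = \sum_(i <- r | P i) (F i)^*.
Proof. exact: rmorph_sum. Qed.

(** Orthonormal rows of a square matrix give orthonormal columns. Two dimensions appear because
    [n.*2 + 2] and [n.+1 + n.+1] are equal but not convertible. *)
Lemma orthonormal_complete (m m' : nat) (g : 'I_m -> 'rV[R]_m') : m = m' ->
  (forall i j, dot (g i) (g j) = (i == j)%:R) ->
  forall a b, \sum_i g i 0 a * g i 0 b = (a == b)%:R.
Proof.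
move=> E; case: m' / E g => g og a b.
pose Q := \matrix_(i, j) g i 0 j.
have QQ : Q *m Q^T = 1%:M.
  by apply/matrixP => i j; rewrite !mxE -og; apply: eq_bigr => k _; rewrite !mxE.
have /matrixP /(_ a b) := mulmx1C QQ; rewrite !mxE => <-.
by apply: eq_bigr => k _; rewrite !mxE.
Qed.

Variables (n : nat) (f : mpoly.mpoly n.+1 R[i]).
Local Notation E := 'rV[R]_(n.+1 + n.+1).
Local Notation cp := Defs.cpoint.
Variables (x : E) (e : 'I_n.*2 -> E).
Hypothesis g0 : gradsq f x != 0.
Hypothesis oe : forall i j, dot (e i) (e j) = (i == j)%:R.
Hypothesis te : forall i, dfc f x (e i) = 0.

(** The dual vector of [1] has length [1 / |df|]; scaling by [s = |df|] makes [u1] and [u2 = i u1]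
    an orthonormal basis of the normal plane. *)
Let s : R := Num.sqrt (Re (gradsq f x)).
Let u1 : E := dfdual f x s%:C.
Let u2 : E := dfdual f x (s%:C * 'i%C).

Let s2 : s * s = Re (gradsq f x).
Proof. by rewrite -expr2 sqr_sqrtr // Re_gradsq_ge0. Qed.

Let gne0 : Re (gradsq f x) != 0.
Proof. by rewrite gt_eqF // Re_gradsq_gt0. Qed.

Let frame (i : 'I_(n.*2 + 2)) : E :=
  match fintype.split i with inl j => e j | inr j => if val j == 0%N then u1 else u2 end.

Let dot_normal_frame c i : dot (dfdual f x c) (e i) = 0.
Proof. by rewrite dot_dfdual te rmorph0 mulr0 mul0r. Qed.

Let dot_normals c c' : dot (dfdual f x c) (dfdual f x c') = Re (c * c'^*) / Re (gradsq f x).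
Proof. by rewrite dot_dfdual dfc_dfdual. Qed.

Let frame_complete a b : \sum_i frame i 0 a * frame i 0 b = (a == b)%:R.
Proof.
apply: orthonormal_complete => [|i j]; first by rewrite addnn doubleS addn2.
have d11 : dot u1 u1 = 1 by rewrite dot_normals /= oppr0 mulr0 subr0 s2 divff.
have d22 : dot u2 u2 = 1.
  rewrite dot_normals; have -> : s%:C * 'i%C * (s%:C * 'i%C)^* = (s * s)%:C.
    by apply: complex_eqP => /=; ring.
  by rewrite /= s2 divff.
have d12 : dot u1 u2 = 0.
  rewrite dot_normals; have -> : Re (s%:C * (s%:C * 'i%C)^*) = 0 by rewrite /=; ring.
  by rewrite mul0r.
rewrite -(inj_eq (can_inj splitK)) /frame.
case: (fintype.split i) => [i'|[[|[|//]] ?]]; case: (fintype.split j) => [j'|[[|[|//]] ?]] //=;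
  by rewrite ?oe ?d11 ?d22 ?d12 ?dot_normal_frame // dotC ?d12 // dot_normal_frame.
Qed.

(** Together with [u1] and [u2] the frame is an orthonormal basis of the ambient space, so the
    projector onto its span is the identity minus the normal part. *)
Lemma frame_entries a b : \sum_i e i 0 a * e i 0 b =
  (a == b)%:R - u1 0 a * u1 0 b - u2 0 a * u2 0 b.
Proof.
rewrite -frame_complete big_split_ord /= !big_ord_recl big_ord0 addr0 /frame.
rewrite !(unsplitK (inr _)) /=.
under [X in _ = X + _ - _ - _]eq_bigr => i _ do rewrite (unsplitK (inl _)).
ring.
Qed.

Let u2_cp j : cp u2 j = 'i%C * cp u1 j.
Proof. by rewrite !cvecK; ring. Qed.

Let u2l j : u2 0 (lshift n.+1 j) = - u1 0 (rshift n.+1 j).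
Proof. by have /(congr1 (@complex.Re R)) := u2_cp j; rewrite ReM /= => ->; ring. Qed.

Let u2r j : u2 0 (rshift n.+1 j) = u1 0 (lshift n.+1 j).
Proof. by have /(congr1 (@complex.Im R)) := u2_cp j; rewrite ImM /= => ->; ring. Qed.

Let u1J j k : cp u1 j * (cp u1 k)^* = (gradc f j x)^* * gradc f k x / gradsq f x.
Proof.
have cpJ : (cp u1 k)^* = s%:C * gradc f k x / gradsq f x.
  by rewrite cvecK !conjcM conjcV gradsqJ conjc_real conjcK.
rewrite cpJ cvecK.
have -> : s%:C * (gradc f j x)^* / gradsq f x * (s%:C * gradc f k x * (gradsq f x)^-1) =
   (s * s)%:C * ((gradc f j x)^* * gradc f k x) / gradsq f x / gradsq f x.
  by rewrite rmorphM /=; ring.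
by rewrite s2 -gradsqE; field.
Qed.

Let Im_sum (I : Type) (r : seq I) (P : pred I) (F : I -> R[i]) :
  Im (\sum_(i <- r | P i) F i) = \sum_(i <- r | P i) Im (F i).
Proof. exact: (big_morph (@complex.Im R) (@ImD R) erefl). Qed.

(* Both identities say that [\sum_i e i (x) e i] is the orthogonal projector onto
   the complex hyperplane [ker (dfc f x)]. *)
Lemma frame_trace j k : \sum_i cp (e i) j * cp (e i) k = 0.
Proof.
apply: complex_eqP; rewrite ?Re_sum ?Im_sum.
  under eq_bigr => i _ do rewrite ReM /=.
  rewrite sumrB !frame_entries !(u2l, u2r) (inj_eq (@lshift_inj _ _)).
  by rewrite (inj_eq (@rshift_inj _ _)) /=; ring.
under eq_bigr => i _ do rewrite ImM /=.
rewrite big_split /= !frame_entries !(u2l, u2r) eq_lrshift eq_rlshift /=; ring.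
Qed.

Lemma frame_traceJ j k : \sum_i cp (e i) j * (cp (e i) k)^* =
  2 * ((j == k)%:R - (gradc f j x)^* * gradc f k x / gradsq f x).
Proof.
rewrite -u1J.
have -> : (j == k)%:R = ((j == k)%:R)%:C :> R[i] by case: (j == k).
apply: complex_eqP; rewrite ?Re_sum ?Im_sum.
  under eq_bigr => i _ do rewrite ReM ReJ ImJ /= mulrN opprK.
  rewrite big_split /= !frame_entries !(u2l, u2r) (inj_eq (@lshift_inj _ _)).
  by rewrite (inj_eq (@rshift_inj _ _)) /=; ring.
under eq_bigr => i _ do rewrite ImM ReJ ImJ /= mulrN addrC.
rewrite sumrB /= !frame_entries !(u2l, u2r) eq_lrshift eq_rlshift /=; ring.
Qed.

Lemma frame_expansion v : dfc f x v = 0 -> \sum_i dot v (e i) *: e i = v.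
Proof.
move=> dv; apply/rowP => b; rewrite summxE.
under eq_bigr => i _ do rewrite mxE mulr_suml.
rewrite exchange_big /=.
under eq_bigr => a _ do (under eq_bigr => i _ do rewrite -mulrA;
  rewrite -mulr_sumr frame_entries !mulrBr !mulrA).
rewrite !sumrB -!mulr_suml -/(dot v u1) -/(dot v u2).
rewrite [dot v u1]dotC [dot v u2]dotC !dot_dfdual dv rmorph0 !mulr0 !mul0r !subr0.
by rewrite (bigD1 b) //= eqxx mulr1 big1 ?addr0 // => a /negbTE ->; rewrite mulr0.
Qed.

End FrameTraces.

(** * Differentiating [df] and the trivialization of the normal bundle *)

Section HypersurfaceCalculus.
Variables (R : realType) (n : nat) (f : mpoly.mpoly n.+1 R[i]).
Local Notation E := 'rV[R]_(n.+1 + n.+1).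
Local Notation cp := Defs.cpoint.
Implicit Types (x y u v w : E) (c : R[i]).

Lemma is_diff_cvec (V : normedModType R) (x : V) (Z dZ : 'I_n.+1 -> V -> R[i]) :
  (forall j, is_cdiff x (Z j) (dZ j)) ->
  is_diff x (fun t : V => cvec (Z ^~ t)) (fun t : V => cvec (dZ ^~ t)).
Proof.
move=> hZ; apply: is_diff_rV => i.
rewrite -(splitK i); case: (fintype.split i) => j /=.
  have [h _] := hZ j; move: h; congr is_diff_def; apply/funext => y;
  by rewrite row_mxEl mxE.
have [_ h] := hZ j; move: h; congr is_diff_def; apply/funext => y;
by rewrite row_mxEr mxE.
Qed.

Lemma is_cdiff_gradc x j : is_cdiff x (gradc f j) (dgrad f j x).
Proof. by apply: is_cdiff_meval => k; exact: is_cdiff_cpoint. Qed.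

Lemma is_cdiff_cpoint_comp (V : normedModType R) (x : V) (G dG : V -> E) j :
  is_diff x G dG -> is_cdiff x (fun t : V => cp (G t) j) (fun t : V => cp (dG t) j).
Proof. by move=> h; exact: (is_cdiff_comp h (is_cdiff_cpoint (G x) j)). Qed.

Lemma is_cdiff_dfc x (G dG : E -> E) : is_diff x G dG ->
  is_cdiff x (fun y => dfc f y (G y)) (fun v => hessc f x v (G x) + dfc f x (dG v)).
Proof.
move=> hG; apply: is_cdiff_eq.
  apply: is_cdiff_sum => j; apply: is_cdiffM (is_cdiff_gradc x j) _.
  exact: is_cdiff_cpoint_comp hG.
by move=> v; rewrite big_split.
Qed.

Lemma is_cdiff_gradsq x : gradsq f x != 0 ->
  is_cdiff x (gradsq f) (fun v => gradsq f x * (theta f x v + (theta f x v)^*)).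
Proof.
move=> g0; apply: is_cdiff_eq.
  apply: is_cdiff_sum => j; apply: is_cdiffM (is_cdiff_gradc x j) _.
  exact: is_cdiffJ (is_cdiff_gradc x j).
move=> v; rewrite big_split /= /theta conjcM conjcV gradsqJ conjc_sum mulrDr.
rewrite ![gradsq f x * _]mulrC !mulfVK //; congr (_ + _); apply: eq_bigr => j _.
by rewrite conjcM conjcK mulrC.
Qed.

Lemma is_diff_dfdual x (G dG : E -> R[i]) : gradsq f x != 0 -> is_cdiff x G dG ->
  exists dK, is_diff x (fun y => dfdual f y (G y)) dK.
Proof.
move=> g0 hG; eexists; apply: is_diff_cvec => j.
apply: is_cdiffM; last exact: is_cdiffV (is_cdiff_gradsq g0) g0.
by apply: is_cdiffM hG _; exact: is_cdiffJ (is_cdiff_gradc x j).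
Qed.

Lemma cplx_continuous x (G dG : E -> R[i]) : is_cdiff x G dG -> G x != 0 ->
  \near x, G x != 0.
Proof.
move=> [[d1 _] [d2 _]] G0.
have n0 := cplx_sqr_neq0 G0.
have ct : {for x, continuous (fun y => Re (G y) ^+ 2 + Im (G y) ^+ 2)}.
  apply: continuousD; apply: (@continuous_comp _ _ _ _ (fun t : R => t ^+ 2));
    by [exact: differentiable_continuous|exact: exprn_continuous].
have : \near x, Re (G x) ^+ 2 + Im (G x) ^+ 2 != 0.
  by apply: (ct [set t : R | t != 0]); apply: open_nbhs_nbhs; split => //; exact: open_neq.
by apply: filterS => y; apply: contra => /eqP ->; rewrite /= expr0n addr0.
Qed.

(* differentiate [dfc f y (dfdual f y (G y)) = G y] *)
Lemma dfc_diff_dfdual x (G dG : E -> R[i]) (dK : E -> E) v : gradsq f x != 0 ->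
  is_cdiff x G dG -> is_diff x (fun y => dfdual f y (G y)) dK ->
  dfc f x (dK v) = dG v - theta f x v * G x.
Proof.
move=> g0 hG hK.
have h1 := is_cdiff_dfc hK.
have h2 : is_cdiff x (fun y => dfc f y (dfdual f y (G y))) dG.
  apply: near_eq_is_cdiff hG.
  by apply: filterS (cplx_continuous (is_cdiff_gradsq g0) g0) => y /dfc_dfdual ->.
by rewrite -(is_cdiff_unique v h1 h2) hessc_dfdual [G x * _]mulrC addrC addKr.
Qed.

End HypersurfaceCalculus.

(** * Tangent vectors, normal projection and normal connection of the cone *)

Section TangentNormal.
Variables (R : realType) (n : nat) (f : mpoly.mpoly n.+1 R[i]).
Local Notation E := 'rV[R]_(n.+1 + n.+1).
Local Notation cp := Defs.cpoint.
Local Notation M := (cone f).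
Implicit Types (x y u v w : E) (c : R[i]).

Lemma curve_is_diff v (g : R -> E) : is_derive (0 : R) (1 : R) g v ->
  is_diff (0 : R) g (fun t => t *: v).
Proof.
move=> [d e]; have d' : differentiable g 0 by apply/derivable1_diffP.
by apply: DiffDef => //; rewrite diff1E // derive1E e.
Qed.

(** The easy inclusion: [f] vanishes along a curve in the cone. The converse is the hypothesis [tan]
    below, supplied later by the charts. *)
Lemma tangent_dfc x v : tangent M x v -> dfc f x v = 0.
Proof.
move=> [g [g0 nM /curve_is_diff hg]].
have h1 : is_cdiff (0 : R) (fun t => f.@[cp (g t)])
    (fun t => \sum_j gradc f j x * cp (t *: v) j).
  rewrite -g0; apply: (is_cdiff_meval f (F := fun j t => cp (g t) j)) => j.
  exact: is_cdiff_cpoint_comp.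
have h2 : is_cdiff (0 : R) (fun t => f.@[cp (g t)]) (fun=> 0).
  apply: near_eq_is_cdiff (is_cdiff_cst _ 0).
  by apply: filterS nM => t -[_ ->].
by have := is_cdiff_unique (1 : R) h1 h2; rewrite scale1r.
Qed.

(** Whatever curve [along] has picked, the chain rule for an ambient extension [G] of the field
    gives the same value. *)
Lemma along_diff x v (V G dG : E -> E) : tangent M x v ->
  (exists W : set E, [/\ open W, W x & forall y, M y -> W y -> V y = G y]) ->
  is_diff x G dG -> along M V x v = dG v.
Proof.
move=> tv [W [oW Wx VG]] hG; rewrite /along.
have [g0 nM hg'] : curve_from M x v (xget (fun=> x) (curve_from M x v)) by apply: xgetPex; exact: tv.
set g := xget _ _ in g0 nM hg' *.
have hg := curve_is_diff hg'.
have nW : \forall t \near (0 : R), W (g t).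
  have : {for 0, continuous g} by apply: differentiable_continuous; case: hg.
  by apply; rewrite g0; exact: open_nbhs_nbhs.
have -> : 'D_1 (fun t => V (g t)) 0 = 'D_1 (fun t => G (g t)) 0.
  by apply: near_eq_derive; apply: filterS2 nM nW => t; exact: VG.
rewrite -g0 in hG; have [d e] := is_diff_comp hg hG.
by rewrite deriveE // e /= scale1r.
Qed.

Hypothesis reg : forall x, x != 0 -> gradsq f x != 0.
Hypothesis tan : forall x v, M x -> dfc f x v = 0 -> tangent M x v.

Let regM x : M x -> gradsq f x != 0.
Proof. by move=> [/reg]. Qed.

Lemma normal_dfdual x c : normal M x (dfdual f x c).
Proof. by move=> v /tangent_dfc h; rewrite dot_dfdual h conjc0 mulr0 mul0r. Qed.

(** The difference of [w] and the dual vector lies in [ker df], hence is tangent by [tan]; being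
    normal as well, it is orthogonal to itself. *)
Lemma normalE x w : M x -> normal M x w -> w = dfdual f x (dfc f x w).
Proof.
move=> Mx nw; set c := dfc f x w.
have tw : dfc f x (w - dfdual f x c) = 0.
  by rewrite dfcD dfcN dfc_dfdual ?subrr // regM.
have tt := tan Mx tw.
apply/eqP; rewrite -subr_eq0; apply/eqP/dot_eq0.
rewrite -scaleN1r {1}dotDl dotZl (nw _ _) ?add0r //; last by rewrite scaleN1r.
by rewrite normal_dfdual ?mulr0 // scaleN1r.
Qed.

Lemma nprojE x w : M x -> nproj M x w = dfdual f x (dfc f x w).
Proof.
move=> Mx; rewrite /nproj.
have h : [set u | normal M x u /\ tangent M x (w - u)] (dfdual f x (dfc f x w)).
  split; first exact: normal_dfdual.
  by apply: tan => //; rewrite dfcD dfcN dfc_dfdual ?subrr // regM.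
have [nu tu] := xgetI 0 h.
rewrite (normalE Mx nu); congr dfdual.
by have /eqP := tangent_dfc tu; rewrite dfcD dfcN subr_eq0 => /eqP.
Qed.

Lemma nablaN_dfdual x v (V : E -> E) (G dG : E -> R[i]) : M x -> tangent M x v ->
  (exists W : set E, [/\ open W, W x & forall y, M y -> W y -> V y = dfdual f y (G y)]) ->
  is_cdiff x G dG ->
  nablaN M v V x = dfdual f x (dG v - theta f x v * G x).
Proof.
move=> Mx tv hV hG; have [dK hK] := is_diff_dfdual (regM Mx) hG.
by rewrite /nablaN nprojE // (along_diff tv hV hK) (dfc_diff_dfdual _ (regM Mx) hG hK).
Qed.

End TangentNormal.

(** * Cancellation of the curvature terms *)

Section TraceIdentity.
Variables (R : realType) (n : nat) (f : mpoly.mpoly n.+1 R[i]).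
Local Notation E := 'rV[R]_(n.+1 + n.+1).
Local Notation cp := Defs.cpoint.

(** The derivative of [theta] in the direction [v] with its argument [w] held fixed; the last term
    is the quotient rule for [gradsq]. *)
Definition dtheta (x v w : E) : R[i] :=
  (\sum_j ((\sum_k (\sum_l f^`M(j)^`M(k)^`M(l).@[cp x] * cp v l) * cp w k)
             * (gradc f j x)^* + dgrad f j x w * (dgrad f j x v)^*)) / gradsq f x
  - theta f x w * (theta f x v + (theta f x v)^*).

Lemma is_cdiff_theta (x : E) (G dG : E -> E) : gradsq f x != 0 -> is_diff x G dG ->
  is_cdiff x (fun y => theta f y (G y))
    (fun v => dtheta x v (G x) + theta f x (dG v)).
Proof.
move=> g0 hG; apply: is_cdiff_eq.
  apply: is_cdiffM; last exact: is_cdiffV (is_cdiff_gradsq g0) g0.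
  apply: is_cdiff_sum => j; apply: is_cdiffM; last exact: is_cdiffJ (is_cdiff_gradc f x j).
  apply: is_cdiff_sum => k; apply: is_cdiffM; last exact: is_cdiff_cpoint_comp hG.
  by apply: is_cdiff_meval => l; exact: is_cdiff_cpoint.
move=> v /=; rewrite /dtheta.
set S := \sum_j dgrad f j x (G x) * (gradc f j x)^*.
have -> : theta f x (G x) = S / gradsq f x by [].
set D1 := \sum_(i <- _) _.
have -> : D1 = (\sum_j ((\sum_k (\sum_l f^`M(j)^`M(k)^`M(l).@[cp x] * cp v l) * cp (G x) k)
             * (gradc f j x)^* + dgrad f j x (G x) * (dgrad f j x v)^*)) +
   \sum_j dgrad f j x (dG v) * (gradc f j x)^*.
  rewrite -big_split; apply: eq_bigr => j _ /=.
  by rewrite big_split /= mulrDl addrAC.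
rewrite [theta f x (dG v)]/theta.
set T := theta f x v + _; set A := \sum_j _; set B := \sum_j _.
by field.
Qed.

Variables (x : E) (e : 'I_n.*2 -> E).
Hypothesis g0 : gradsq f x != 0.
Hypothesis oe : forall i j, dot (e i) (e j) = (i == j)%:R.
Hypothesis te : forall i, dfc f x (e i) = 0.

Lemma frame_trace_bilinear (a b : 'I_n.+1 -> R[i]) :
  \sum_i (\sum_k a k * cp (e i) k) * (\sum_l b l * cp (e i) l) = 0.
Proof.
under eq_bigr => i _ do (rewrite mulr_suml; under eq_bigr => k _ do rewrite mulr_sumr).
rewrite exchange_big big1 // => k _; rewrite exchange_big big1 // => l _ /=.
under eq_bigr => i _ do rewrite mulrACA.
by rewrite -mulr_sumr (frame_trace g0 oe te) mulr0.
Qed.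

Lemma frame_trace_quadratic (t : 'I_n.+1 -> 'I_n.+1 -> R[i]) :
  \sum_i \sum_j (\sum_k t j k * cp (e i) k) * cp (e i) j = 0.
Proof.
rewrite exchange_big big1 // => j _ /=.
under eq_bigr => i _ do rewrite mulr_suml.
rewrite exchange_big big1 // => k _ /=.
under eq_bigr => i _ do rewrite -mulrA.
by rewrite -mulr_sumr (frame_trace g0 oe te) mulr0.
Qed.

(** With a conjugation the trace survives: it is twice the Hermitian product of the restrictions of
    [a] and [b] to [ker df], as each complex direction accounts for two real frame vectors. *)
Lemma frame_trace_sesquilinear (a b : 'I_n.+1 -> R[i]) :
  \sum_i (\sum_k a k * cp (e i) k) * (\sum_l b l * cp (e i) l)^* =
  2 * (\sum_k a k * (b k)^* - (\sum_k a k * (gradc f k x)^*) *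
    (\sum_k b k * (gradc f k x)^*)^* / gradsq f x).
Proof.
under eq_bigr => i _ do (rewrite conjc_sum mulr_suml;
  under eq_bigr => k _ do (rewrite mulr_sumr;
    under eq_bigr => l _ do rewrite conjcM mulrACA)).
rewrite exchange_big /=.
under eq_bigr => k _ do (rewrite exchange_big /=;
  under eq_bigr => l _ do rewrite -mulr_sumr (frame_traceJ g0 oe te) mulrCA mulrBr).
under eq_bigr => k _ do rewrite -mulr_sumr.
rewrite -mulr_sumr; congr (2 * _).
transitivity (\sum_k (\sum_l a k * (b l)^* * (k == l)%:R -
    \sum_l a k * (b l)^* * ((gradc f k x)^* * gradc f l x / gradsq f x))).
  by apply: eq_bigr => k _; rewrite -sumrB.
rewrite sumrB; congr (_ - _).
  apply: eq_bigr => k _; rewrite (bigD1 k) //= eqxx mulr1 big1 ?addr0 // => l.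
  by rewrite eq_sym => /negbTE ->; rewrite mulr0.
rewrite conjc_sum mulr_suml mulr_suml; apply: eq_bigr => k _.
rewrite mulr_sumr mulr_suml; apply: eq_bigr => l _.
by rewrite conjcM conjcK; ring.
Qed.

Lemma theta_linear v : theta f x v =
  \sum_k ((\sum_j f^`M(j)^`M(k).@[cp x] * (gradc f j x)^*) / gradsq f x) * cp v k.
Proof.
rewrite /theta.
under [RHS]eq_bigr => k _ do rewrite mulrAC mulr_suml.
rewrite -mulr_suml exchange_big; congr (_ / _); apply: eq_bigr => j _ /=.
by rewrite mulr_suml; apply: eq_bigr => k _; rewrite mulrAC.
Qed.

(** Minimality of the cone: its second fundamental form is the dual vector of [- hessc]. *)
Lemma sum_hessc_diag : \sum_i hessc f x (e i) (e i) = 0.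
Proof. exact: frame_trace_quadratic. Qed.

Lemma sum_theta_sqr : \sum_i theta f x (e i) * theta f x (e i) = 0.
Proof.
by under eq_bigr => i _ do rewrite theta_linear; exact: frame_trace_bilinear.
Qed.

(** The third derivatives of [f] and the product of [theta] with itself enter as complex quadratic
    forms, whose traces vanish; only the Hermitian terms are left. *)
Lemma sum_dtheta : \sum_i dtheta x (e i) (e i) =
  \sum_i ((\sum_j dgrad f j x (e i) * (dgrad f j x (e i))^*) / gradsq f x
          - theta f x (e i) * (theta f x (e i))^*).
Proof.
rewrite /dtheta !sumrB -!mulr_suml; congr (_ / _ - _).
  under eq_bigr => i _ do rewrite big_split /=.
  rewrite big_split /= exchange_big big1 ?add0r // => j _ /=.
  by rewrite -mulr_suml frame_trace_quadratic mul0r.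
under eq_bigr => i _ do rewrite mulrDr.
by rewrite big_split /= sum_theta_sqr add0r.
Qed.

(** Write [2 Re(h) h = h^2 + |h|^2]. The sum of the squares is a complex bilinear trace, hence [0],
    and the factor [2] cancels the one in the sesquilinear trace. *)
Lemma sum_hessc_row v :
  \sum_j (Re (hessc f x v (e j)) / Re (gradsq f x))%:C * hessc f x v (e j) =
  (\sum_j dgrad f j x v * (dgrad f j x v)^*) / gradsq f x - theta f x v * (theta f x v)^*.
Proof.
pose h j := hessc f x v (e j).
have h0 : \sum_j h j * h j = 0 by exact: frame_trace_bilinear.
have hJ := frame_trace_sesquilinear ((dgrad f)^~ x ^~ v) ((dgrad f)^~ x ^~ v).
have th : \sum_k dgrad f k x v * (gradc f k x)^* = theta f x v * gradsq f x.
  by rewrite /theta mulfVK.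
rewrite th conjcM gradsqJ in hJ.
have -> : \sum_j (Re (h j) / Re (gradsq f x))%:C * h j =
    ((2 * gradsq f x)^-1) * (\sum_j h j * h j + \sum_j h j * (h j)^*).
  rewrite -big_split mulr_sumr; apply: eq_bigr => j _ /=.
  rewrite rmorphM /= fmorphV /= -gradsqE -mulrDr.
  have -> : h j + (h j)^* = 2 * (Re (h j))%:C by rewrite addcJ.
  by field.
rewrite h0 add0r {}hJ.
by field.
Qed.

(** The trace of [dtheta] and the Simons term are the same Hermitian expression with opposite signs;
    the remaining terms vanish by minimality and by the trace of the square of [theta]. *)
Lemma stability_trace :
  \sum_i (- dtheta x (e i) (e i) + theta f x (e i) * theta f x (e i)
          + hessc f x (e i) (e i) * theta f x (dfdual f x 1))
  + \sum_i \sum_j (Re (hessc f x (e i) (e j)) / Re (gradsq f x))%:C * hessc f x (e i) (e j)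
  = 0.
Proof.
rewrite !big_split /= sumrN sum_dtheta sum_theta_sqr -mulr_suml sum_hessc_diag.
under [X in _ + X]eq_bigr => i _ do rewrite sum_hessc_row.
by rewrite mul0r !addr0 addNr.
Qed.

End TraceIdentity.

(** * The stability operator on radial normal fields *)

Section RadialNormalField.
Variables (R : realType) (n : nat) (f : mpoly.mpoly n.+1 R[i]).
Local Notation E := 'rV[R]_(n.+1 + n.+1).
Local Notation cp := Defs.cpoint.
Local Notation M := (cone f).
Implicit Types (x y u v w : E) (c : R[i]).

Lemma is_diff_dot x (F G dF dG : E -> E) : is_diff x F dF -> is_diff x G dG ->
  is_diff x (fun y => dot (F y) (G y)) (fun v => dot (dF v) (G x) + dot (F x) (dG v)).
Proof.
move=> hF hG.
have [h _] : is_cdiff x (fun y => \sum_j cp (F y) j * (cp (G y) j)^*)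
  (fun v => \sum_j (cp (dF v) j * (cp (G x) j)^* + cp (F x) j * (cp (dG v) j)^*)).
  apply: is_cdiff_sum => j; apply: is_cdiffM; first exact: is_cdiff_cpoint_comp hF.
  by apply: is_cdiffJ; exact: is_cdiff_cpoint_comp hG.
move: h; congr is_diff_def; apply/funext => y; first by rewrite dotE.
by rewrite !dotE -ReD big_split.
Qed.

Lemma is_diff_radial x (p p' : R -> R) : is_derive (dot x x) 1 p (p' (dot x x)) ->
  is_diff x (fun y => p (dot y y)) (fun v => 2 * p' (dot x x) * dot x v).
Proof.
move=> [d e]; have d' : differentiable p (dot x x) by apply/derivable1_diffP.
have hp : is_diff (dot x x) p (fun t => t * p' (dot x x)).
  by apply: DiffDef => //; rewrite diff1E // derive1E e.
have hd := is_diff_dot (is_diff_id x) (is_diff_id x).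
apply: is_diff_funext (is_diff_comp hd hp) _ => v /=.
by rewrite [dot v x]dotC; ring.
Qed.

Definition radial_field (p : R -> R) y : E := dfdual f y (p (dot y y))%:C.

Hypothesis reg : forall x, x != 0 -> gradsq f x != 0.
Hypothesis tan : forall x v, M x -> dfc f x v = 0 -> tangent M x v.

Variables p0 p1 p2 : R -> R.
Hypothesis dp0 : forall t : R, 0 < t -> is_derive t 1 p0 (p1 t).
Hypothesis dp1 : forall t : R, 0 < t -> is_derive t 1 p1 (p2 t).
Local Notation V := (radial_field p0).

Let regM x : M x -> gradsq f x != 0.
Proof. by move=> [/reg]. Qed.

Let dotM x : M x -> 0 < dot x x.
Proof. by move=> [/dot_gt0]. Qed.

Let g1 y v : R[i] := (2 * p1 (dot y y) * dot y v)%:C - theta f y v * (p0 (dot y y))%:C.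

Lemma nablaN_radial y v : M y -> tangent M y v ->
  nablaN M v V y = dfdual f y (g1 y v).
Proof.
move=> My tv; rewrite (nablaN_dfdual reg tan My tv (V := V)
  (G := fun z => (p0 (dot z z))%:C)
  (dG := fun v => (2 * p1 (dot y y) * dot y v)%:C)) //.
  by exists setT; split => //; exact: openT.
apply: is_cdiff_real; apply: is_diff_radial; exact/dp0/dotM.
Qed.

Section Frame.
Variables (x : E) (e : 'I_n.*2 -> E -> E).
Hypothesis Mx : M x.
Hypothesis fe : local_frame M x e.

Let te i : tangent M x (e i x).
Proof. by case: fe => W [_ Wx _ h _]; exact: h. Qed.

Let oe i j : dot (e i x) (e j x) = (i == j)%:R.
Proof. by case: fe => W [_ Wx _ _ h]; exact: h. Qed.

Let te0 i : dfc f x (e i x) = 0.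
Proof. exact/tangent_dfc/te. Qed.

Let frame_ext i : exists G dG : E -> E, is_diff x G dG /\
  exists W : set E, [/\ open W, W x & forall y, M y -> W y ->
    e i y = G y /\ tangent M y (e i y)].
Proof.
case: fe => W [oW Wx sm tg _].
have [W' [G [oW' W'x sG eG]]] := sm i x (conj Mx Wx).
exists G, ('d G x); split.
  by apply: differentiableP; have [h _] := sG 1%N; exact: h.
exists (W `&` W'); split => [||y My [Wy W'y]]; [exact: openI|by []|].
by split; [exact: eG|exact: tg].
Qed.

(** The three facts must speak of the same derivative [dG] of the frame field. Its normal component
    is forced: differentiating [df(e i) = 0] along the cone gives [- hessc]. Its tangential
    component stays unknown and cancels later. *)
Let along_frame i : exists dG : E -> E,
  [/\ forall v, tangent M x v -> along M (e i) x v = dG v,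
      forall v, tangent M x v -> dfc f x (dG v) = - hessc f x v (e i x) &
      forall v, tangent M x v -> nablaN M v (fun y => nablaN M (e i y) V y) x =
        dfdual f x ((2 * (2 * p2 (dot x x) * dot x v) * dot x (e i x) +
            2 * p1 (dot x x) * (dot v (e i x) + dot x (dG v)))%:C
          - ((dtheta f x v (e i x) + theta f x (dG v)) * (p0 (dot x x))%:C
             + theta f x (e i x) * (2 * p1 (dot x x) * dot x v)%:C)
          - theta f x v * g1 x (e i x))].
Proof.
have [G [dG [hG [W [oW Wx eG]]]]] := frame_ext i.
have Gx : G x = e i x by have [] := eG x Mx Wx.
exists dG; split=> v tv.
- apply: along_diff tv _ hG.
  by exists W; split => // y My Wy; have [] := eG y My Wy.
- have hd := is_cdiff_dfc f hG.
  have [dK hK] := is_diff_dfdual (regM Mx) hd.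
  (* The field [dfdual f y (dfc f y (G y))] vanishes on [M] near [x]. It and the constant [0] are
     thus two extensions of one field along [M], and have equal derivatives in tangent
     directions. *)
  have h1 : along M (fun=> 0) x v = dK v.
    apply: along_diff tv _ hK; exists W; split => // y My Wy.
    have [<- /tangent_dfc ->] := eG y My Wy.
    by apply: cpoint_inj => j; rewrite cvecK !mul0r cpoint0.
  have h0 : along M (fun=> 0) x v = 0.
    have hc : is_diff x (fun=> 0 : E) (fun=> 0 : E) := is_diff_cst (0 : E) x.
    by apply: (along_diff tv _ hc); exists setT; split => //; exact: openT.
  have := dfc_diff_dfdual v (regM Mx) hd hK.
  rewrite -h1 h0 Gx te0 mulr0 subr0 => /esym /eqP.
  have -> : dfc f x 0 = 0 by rewrite /dfc big1 // => j _; rewrite cpoint0 mulr0.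
  by rewrite addr_eq0 => /eqP ->; rewrite opprK.
- rewrite (nablaN_dfdual reg tan Mx tv (G := fun y => g1 y (G y)) (dG := fun v =>
    (2 * (2 * p2 (dot x x) * dot x v) * dot x (e i x) +
            2 * p1 (dot x x) * (dot v (e i x) + dot x (dG v)))%:C
          - ((dtheta f x v (e i x) + theta f x (dG v)) * (p0 (dot x x))%:C
             + theta f x (e i x) * (2 * p1 (dot x x) * dot x v)%:C))) ?Gx //.
    exists W; split => // y My Wy; have [<- ty] := eG y My Wy.
    exact: nablaN_radial.
  apply: is_cdiffD; last first.
    apply: is_cdiffN; rewrite -Gx; apply: is_cdiff_eq.
      apply: is_cdiffM; first exact: is_cdiff_theta (regM Mx) hG.
      by apply: is_cdiff_real; apply: is_diff_radial; exact/dp0/dotM.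
    by move=> u /=.
  apply: is_cdiff_real; rewrite -Gx.
  have h1 : is_diff x (fun y => p1 (dot y y)) (fun v => 2 * p2 (dot x x) * dot x v).
    by apply: is_diff_radial; exact/dp1/dotM.
  have h2 := is_diff_dot (is_diff_id x) hG.
  apply: is_diff_funext (is_diffM (is_diffZ 2 h1) h2) _ => u.
  transitivity (2 * p1 (dot x x) * (dot u (G x) + dot x (dG u)) +
     dot x (G x) * (2 * (2 * p2 (dot x x) * dot x u))) => //; ring.
Qed.

(** The tangential part of [dG] is [dG] plus the dual vector of [h]. This normal vector is
    orthogonal to [x], which is tangent, so it contributes through [theta] only. *)
Let stab_term i (dG : E -> E) :
  (forall v, tangent M x v -> along M (e i) x v = dG v) ->
  (forall v, tangent M x v -> dfc f x (dG v) = - hessc f x v (e i x)) ->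
  dfc f x x = 0 ->
  nablaN M (nablaT M (e i x) (e i) x) V x =
  dfdual f x (g1 x (dG (e i x)) - hessc f x (e i x) (e i x) * theta f x (dfdual f x 1)
    * (p0 (dot x x))%:C).
Proof.
move=> h1 h2 ex; set h := hessc f x (e i x) (e i x).
have E1 : nablaT M (e i x) (e i) x = dG (e i x) + dfdual f x h.
  by rewrite /nablaT /tproj h1 // nprojE // h2 // dfdualN opprK.
have tt : tangent M x (nablaT M (e i x) (e i) x).
  by apply: tan => //; rewrite E1 dfcD h2 // dfc_dfdual ?addNr // regM.
rewrite nablaN_radial // E1 /g1; congr dfdual.
rewrite thetaD theta_dfdual [dot x (_ + _)]dotC dotDl dot_dfdual ex conjc0 mulr0 mul0r addr0.
by rewrite [dot x (dG _)]dotC; ring.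
Qed.

Let simonsE : simons M e V x =
  dfdual f x ((p0 (dot x x))%:C * \sum_i \sum_j
    (Re (hessc f x (e i x) (e j x)) / Re (gradsq f x))%:C * hessc f x (e i x) (e j x)).
Proof.
rewrite /simons mulr_sumr dfdual_sum; apply: eq_bigr => i _.
rewrite mulr_sumr dfdual_sum; apply: eq_bigr => j _.
set h := hessc _ _ _ _.
have -> : second_form M (e i) (e j) x = dfdual f x (- h).
  have [dG [h1 h2 _]] := along_frame j.
  by rewrite /second_form h1 // nprojE // h2.
rewrite dot_dfdual dfc_dfdual ?regM // -dfdualZ; congr dfdual.
rewrite conjc_real ReM ReN ImN /= mulr0 subr0 mulNr mulNr rmorphN /= mulrNN.
by rewrite mulrAC mulrA -rmorphM /=; congr (_%:C * _); ring.
Qed.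

Lemma radial_stability : dfc f x x = 0 ->
  normal_laplacian M e V x + simons M e V x =
  dfdual f x ((4 * p2 (dot x x) * dot x x + 2 * p1 (dot x x) * n.*2%:R)%:C
     - (4 * p1 (dot x x))%:C * theta f x x).
Proof.
move=> ex; have [dG hdG] := choice along_frame.
set rho := dot x x.
(* [A] gathers the terms in the derivatives of [p0], [B] the coefficient of [p0] itself. The terms
   in [dG] cancel between the second derivative and its correction. *)
pose A i : R[i] := (4 * p2 rho * (dot x (e i x) * dot x (e i x)) + 2 * p1 rho)%:C -
  (4 * p1 rho)%:C * ((dot x (e i x))%:C * theta f x (e i x)).
pose B i : R[i] := - dtheta f x (e i x) (e i x) + theta f x (e i x) * theta f x (e i x)
          + hessc f x (e i x) (e i x) * theta f x (dfdual f x 1).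
have -> : normal_laplacian M e V x =
    dfdual f x (\sum_i A i + (p0 rho)%:C * \sum_i B i).
  rewrite /normal_laplacian mulr_sumr -big_split dfdual_sum; apply: eq_bigr => i _ /=.
  have [h1 h2 h3] := hdG i.
  rewrite h3 // (stab_term h1 h2 ex) -dfdualN -dfdualD; congr dfdual.
  rewrite /A /B /g1 oe eqxx -/rho.
  rewrite !(rmorphD, rmorphM) /=.
  set t1 := theta f x (dG i _); ring.
rewrite simonsE -dfdualD -addrA -mulrDr.
rewrite (stability_trace (regM Mx) oe te0) mulr0 addr0; congr dfdual.
(* As [x] is tangent to the cone, the frame sums of [A] add up to [|x|^2] and to [theta f x x]. *)
have fx := frame_expansion (regM Mx) oe te0 ex.
rewrite /A sumrB -[\sum_i (_ * (_ * theta _ _ _))]mulr_sumr; congr (_ - _ * _); last first.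
  rewrite -[X in theta f x X]fx.
  have th0 : theta f x 0 = 0 by rewrite -(scale0r (0 : E)) thetaZ mul0r.
  rewrite (big_morph _ (thetaD f x) th0); apply: eq_bigr => i _.
  by rewrite thetaZ.
rewrite -rmorph_sum /=; congr (_%:C).
rewrite big_split /= sumr_const card_ord -mulr_sumr; congr (_ * _ + _).
  rewrite -[X in _ = dot X _]fx.
  rewrite (@big_morph _ _ (fun u : E => dot u x) 0 +%R 0 +%R
    (fun u w => dotDl u w x)); last first.
    by rewrite -(scale0r (0 : E)) dotZl mul0r.
  by apply: eq_bigr => i _; rewrite dotZl [dot (e i x) x]dotC.
by rewrite mulr_natr.
Qed.

End Frame.

(* When no frame exists [xget] returns [0]. *)
Lemma stability_op_radial x : M x -> dfc f x x = 0 -> theta f x x = (n%:R - 1)%:C ->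
  stability_op M n.*2 V x = 0 \/
  stability_op M n.*2 V x = (4 * (p2 (dot x x) * dot x x + p1 (dot x x))) *: dfdual f x 1.
Proof.
move=> Mx ex tx; rewrite /stability_op; set S := [set w | _].
case: (pselect (exists w, S w)) => [hS|hS]; last first.
  by left; apply: xgetPN => w Sw; apply: hS; exists w.
right; have [e fe ->] := xgetPex 0 hS.
rewrite radial_stability // tx -dfdualZ; congr dfdual.
(* The dimension drops out: [2 p1 * 2n - 4 p1 (n - 1) = 4 p1]. *)
by rewrite mulr1 -rmorphM -rmorphB; congr (_%:C); rewrite -mul2n natrM; ring.
Qed.

End RadialNormalField.

(** * Charts of a complex hypersurface *)

Section NearestRoot.
Variable C : numClosedFieldType.

(* The logarithmic derivative of [p] at [s] is the sum of the [1 / (s - r)] over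
   the roots [r], so some root lies within [deg p * |p s / p' s|] of [s]. *)
Lemma horner_prod_deriv_le (rs : seq C) (s : C) :
  let p := \prod_(z <- rs) ('X - z%:P) in
  (forall z, z \in rs -> s != z) ->
  `|p^`().[s]| <= `|p.[s]| * \sum_(z <- rs) `|s - z|^-1.
Proof.
elim: rs => [|r rs IH] /= hs.
  by rewrite !big_nil derivC horner0 normr0 mulr0.
rewrite !big_cons derivM derivXsubC mul1r hornerD !hornerM hornerXsubC.
have sr : s != r by apply: hs; rewrite inE eqxx.
have {}IH : `|(\prod_(z <- rs) ('X - z%:P))^`().[s]| <=
  `|(\prod_(z <- rs) ('X - z%:P)).[s]| * \sum_(z <- rs) `|s - z|^-1.
  by apply: IH => z zrs; apply: hs; rewrite inE zrs orbT.
apply: le_trans (ler_normD _ _) _; rewrite !normrM mulrDr; apply: lerD.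
  by rewrite mulrAC mulfV ?mul1r // normr_eq0 subr_eq0.
by rewrite -mulrA ler_wpM2l.
Qed.

(** This is the existence half of the implicit function theorem: where the derivative is not zero,
    an approximate root has a true root at a controlled distance. *)
Lemma nearest_root (p : {poly C}) (s : C) : p^`().[s] != 0 ->
  exists2 r, p.[r] = 0 & `|s - r| * `|p^`().[s]| <= (size p)%:R * `|p.[s]|.
Proof.
move=> dp0; have [ps0|ps0] := eqVneq p.[s] 0.
  by exists s; rewrite ?ps0 // subrr normr0 mul0r mulr0.
have p0 : p != 0 by apply: contraNneq ps0 => ->; rewrite horner0.
have [rs prs] := closed_field_poly_normal p.
have lc0 : lead_coef p != 0 by rewrite lead_coef_eq0.
have sz : size p = (size rs).+1.
  by rewrite prs size_scale // size_prod_XsubC.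
have rroot r : r \in rs -> p.[r] = 0.
  by move=> rin; rewrite prs hornerZ (rootP _) ?mulr0 // root_prod_XsubC.
have srs z : z \in rs -> s != z.
  by move=> /rroot pz; apply: contraNneq ps0 => ->; rewrite pz.
have := horner_prod_deriv_le srs.
set q := \prod_(z <- rs) _ => hq.
have {}hq : `|p^`().[s]| <= `|p.[s]| * \sum_(z <- rs) `|s - z|^-1.
  by rewrite prs derivZ !hornerZ !normrM -mulrA ler_wpM2l.
have [/hasP [r rin hr]|/hasPn hno] :=
  boolP (has (fun r => `|s - r| * `|p^`().[s]| <= (size p)%:R * `|p.[s]|) rs).
  by exists r => //; exact: rroot.
exfalso; move: hq; apply/negP; rewrite -real_ltNge ?realM ?realE ?normr_ge0 //; last first.
  by rewrite sumr_ge0 // => z _; rewrite invr_ge0.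
have sz0 : (0 : C) < (size p)%:R by rewrite ltr0n sz.
have dp : 0 < `|p^`().[s]| by rewrite normr_gt0.
have bd z : z \in rs -> `|p.[s]| * `|s - z|^-1 <= `|p^`().[s]| / (size p)%:R.
  move=> zin; have := hno z zin; rewrite -real_ltNge ?realM ?realE ?normr_ge0 ?ler0n // => h.
  rewrite ler_pdivlMr // mulrAC ler_pdivrMr ?normr_gt0 ?subr_eq0 ?srs //.
  by rewrite mulrC [leRHS]mulrC ltW.
rewrite mulr_sumr big_seq.
apply: (@le_lt_trans _ _ (\sum_(z <- rs | z \in rs) `|p^`().[s]| / (size p)%:R)).
  exact: ler_sum.
(* [size p] exceeds the number of roots by one, which makes the inequality strict. *)
rewrite -big_seq big_const_seq count_predT iter_addr addr0 sz -[X in X < _]mulr_natr.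
by rewrite mulrAC ltr_pdivrMr ?ltr0n // ltr_pM2l // ltr_nat.
Qed.

End NearestRoot.

(** * Polynomials on complex lines *)

Section LineRestriction.
Variables (R : realType) (n : nat).
Implicit Types (p : mpoly.mpoly n R[i]) (a b z w : 'I_n -> R[i]).

Lemma mpoly_line p : exists K : nat, forall a b, exists P : {poly R[i]},
  [/\ (size P <= K)%N, forall s, P.[s] = p.@[fun j => a j + s * b j] &
      forall s, P^`().[s] = \sum_j p^`M(j).@[fun j => a j + s * b j] * b j].
Proof.
elim/mpoly_alg_ind: p => [c|i|p q [K hp] [L hq]|p q [K hp] [L hq]].
- exists 1%N => a b; exists c%:P; split => [|s|s]; first exact: size_polyC_leq1.
    by rewrite hornerC mpoly.mevalC.
  by rewrite derivC horner0 big1 // => j _; rewrite mpoly.mderivC mpoly.meval0 mul0r.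
- exists 2%N => a b; exists (b i *: 'X + (a i)%:P); split => [|s|s].
  + rewrite (leq_trans (size_polyD _ _)) // geq_max (leq_trans (size_scale_leq _ _)) ?size_polyX //.
    by rewrite (leq_trans (size_polyC_leq1 _)).
  + by rewrite hornerD hornerZ hornerX hornerC mpoly.mevalXU addrC mulrC.
  + by rewrite derivD derivZ derivX derivC addr0 hornerZ hornerC mulr1 sum_mderivXU.
- exists (maxn K L) => a b; have [P [P1 P2 P3]] := hp a b; have [Q [Q1 Q2 Q3]] := hq a b.
  exists (P + Q); split => [|s|s].
  + rewrite (leq_trans (size_polyD _ _)) // geq_max !leq_max P1 Q1 orbT //.
  + by rewrite hornerD mpoly.mevalD P2 Q2.
  + rewrite derivD hornerD P3 Q3 -big_split; apply: eq_bigr => j _ /=.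
    by rewrite mpoly.mderivD mpoly.mevalD mulrDl.
- exists (K + L)%N => a b; have [P [P1 P2 P3]] := hp a b; have [Q [Q1 Q2 Q3]] := hq a b.
  exists (P * Q); split => [|s|s].
  + by rewrite (leq_trans (size_polyMleq _ _)) // (leq_trans (leq_pred _)) // leq_add.
  + by rewrite hornerM mpoly.mevalM P2 Q2.
  + rewrite derivM hornerD !hornerM P2 P3 Q2 Q3 mulr_suml mulr_sumr -big_split.
    apply: eq_bigr => j _ /=.
    by rewrite mpoly.mderivM mpoly.mevalD !mpoly.mevalM mulrDl mulrAC mulrA.
Qed.

(** [q] is the difference quotient of [p] in the direction [b], extended to the diagonal by the
    derivative. Where it is not zero, roots on lines along [b] are unique; its continuity yields
    their differentiability. The third clause holds because [q] is assembled from polynomials. *)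
Lemma mpoly_divided_difference p b :
  exists q : ('I_n -> R[i]) -> ('I_n -> R[i]) -> R[i],
  [/\ forall z w s, (forall j, z j - w j = s * b j) -> p.@[z] - p.@[w] = s * q z w,
      forall z, q z z = \sum_j p^`M(j).@[z] * b j &
      forall (T : Type) (S : set T) (P : (T -> R) -> Prop) (Z W : 'I_n -> T -> R[i]),
        fun_alg S P -> (forall j, cplx_class P (Z j)) -> (forall j, cplx_class P (W j)) ->
        cplx_class P (fun t => q (Z ^~ t) (W ^~ t))].
Proof.
elim/mpoly_alg_ind: p => [c|i|p q [qp [p1 p2 p3]] [qq [q1 q2 q3]]|p q [qp [p1 p2 p3]] [qq [q1 q2 q3]]].
- exists (fun _ _ => 0); split => [z w s _|z|T S P Z W hP _ _].
  + by rewrite !mpoly.mevalC subrr mulr0.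
  + by rewrite big1 // => j _; rewrite mpoly.mderivC mpoly.meval0 mul0r.
  + exact: (cplx_class_cst hP).
- exists (fun _ _ => b i); split => [z w s h|z|T S P Z W hP _ _].
  + by rewrite !mpoly.mevalXU h.
  + by rewrite sum_mderivXU.
  + exact: (cplx_class_cst hP).
- exists (fun z w => qp z w + qq z w); split => [z w s h|z|T S P Z W hP hZ hW].
  + by rewrite !mpoly.mevalD mulrDr -p1 // -q1 // addrACA opprD.
  + rewrite p2 q2 -big_split; apply: eq_bigr => j _ /=.
    by rewrite mpoly.mderivD mpoly.mevalD mulrDl.
  + by apply: (cplx_classD hP); [exact: p3 hP hZ hW|exact: q3 hP hZ hW].
- exists (fun z w => qp z w * q.@[z] + p.@[w] * qq z w); split => [z w s h|z|T S P Z W hP hZ hW].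
  + rewrite !mpoly.mevalM mulrDr mulrA -p1 // mulrCA -q1 //; ring.
  + rewrite p2 q2 mulr_suml mulr_sumr -big_split; apply: eq_bigr => j _ /=.
    by rewrite mpoly.mderivM mpoly.mevalD !mpoly.mevalM mulrDl mulrAC mulrA.
  + apply: (cplx_classD hP); apply: (cplx_classM hP).
    * exact: p3 hP hZ hW.
    * exact: (cplx_class_meval hP).
    * exact: (cplx_class_meval hP).
    * exact: q3 hP hZ hW.
Qed.

End LineRestriction.

Section NearestRootLine.
Variables (R : realType) (n : nat).
Implicit Types (p : mpoly.mpoly n R[i]) (a b : 'I_n -> R[i]).
Local Notation normc := Normc.normc.

Lemma normc_ge0 (z : R[i]) : 0 <= normc z.
Proof. by case: z => a b; exact: sqrtr_ge0. Qed.

Lemma normc_gt0 (z : R[i]) : z != 0 -> 0 < normc z.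
Proof.
move=> z0; rewrite lt_def normc_ge0 andbT; apply: contra_neq z0.
exact: Normc.eq0_normc.
Qed.

Lemma nearest_root_line p : exists K : R, forall a b s,
  let D := \sum_j p^`M(j).@[fun j => a j + s * b j] * b j in D != 0 ->
  exists2 r, p.@[fun j => a j + r * b j] = 0 &
    normc (r - s) <= K * normc (p.@[fun j => a j + s * b j]) / normc D.
Proof.
have [K hK] := mpoly_line p; exists K%:R => a b s D D0.
have [P [P1 P2 P3]] := hK a b.
have [|r Pr hr] := @nearest_root _ P s; first by rewrite P3.
exists r; first by rewrite -P2.
have nD : 0 < normc D by exact: normc_gt0.
rewrite ler_pdivlMr // -opprB normcN.
have h : (size P)%:R * `|P.[s]| <= K%:R * `|P.[s]| by rewrite ler_wpM2r // ler_nat.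
have := le_trans hr h; rewrite P2 P3 -/D.
have -> : (K%:R : R[i]) = (K%:R)%:C by rewrite rmorph_nat.
(* The norm of [R[i]] takes values in [R[i]]; it is the embedded real modulus [normc]. *)
rewrite -[`|s - r|]/((normc (s - r))%:C) -[`|D|]/((normc D)%:C).
rewrite -[`|_.@[_]|]/((normc _)%:C) -!rmorphM /=.
by rewrite lecR.
Qed.

End NearestRootLine.

(** * Continuity in complex coordinates, and products at a zero *)

Section ComplexCoordinates.
Variables (R : realType) (n : nat).
Local Notation E := 'rV[R]_(n.+1 + n.+1).
Local Notation cp := Defs.cpoint.
Local Notation normc := Normc.normc.

(** In [g y * h y = g y * h x + g y * (h y - h x)] the last product is a first-order quantity times
    one tending to [0]. Continuity of [h] is all that is known where this is applied. *)
Lemma is_diffM0 (V : normedModType R) (x : V) (g dg h : V -> R) :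
  is_diff x g dg -> g x = 0 -> {for x, continuous h} ->
  is_diff x (fun y => g y * h y) (fun v => dg v * h x).
Proof.
move=> [d e] g0 ch.
have [k k0 hk] := linear_lipschitz (diff_continuous d).
pose L : {linear V -> R} := (h x \*: 'd g x).
suff hL : is_diff x (fun y => g y * h y) L.
  by apply: is_diff_funext hL _ => v; rewrite -e mulrC.
apply: is_diff_eps.
  by move=> u; apply: continuousM; [exact: cst_continuous|exact: diff_continuous].
move=> eps eps0.
(* [|h x| + 1] bounds [h] near [x], and [k] is a Lipschitz constant of the differential of [g]. *)
pose C := `|h x| + k + 2.
have C0 : 0 < C by have := normr_ge0 (h x); move: k0; rewrite /C => ? ?; lra.
pose eta := Num.min 1 (eps / C).
have eta0 : 0 < eta by rewrite lt_min ltr01 divr_gt0.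
have n1 := diff_eps d eta0.
have n2 : \forall z \near (0 : V), `|h (z + x) - h x| <= eta.
  have chx : \forall t \near x, `|h x - h t| <= eta.
    by have /cvgrPdist_le /(_ _ eta0) := ch.
  rewrite (near_shift 0) /= subr0 in chx; apply: filterS chx => z /=.
  by rewrite distrC.
apply: filterS2 n1 n2 => z; rewrite g0 subr0 mul0r subr0 => h1 h2.
have -> : L z = 'd g x z * h x by rewrite mulrC.
have -> : g (z + x) * h (z + x) - 'd g x z * h x =
  (g (z + x) - 'd g x z) * h (z + x) + 'd g x z * (h (z + x) - h x) by ring.
apply: le_trans (ler_normD _ _) _; rewrite !normrM.
have h3 : `|h (z + x)| <= `|h x| + 1.
  rewrite -[h (z + x)](subrK (h x)) addrC; apply: le_trans (ler_normD _ _) _.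
  by rewrite lerD2l (le_trans h2) // ge_min lexx.
have h4 := hk z.
apply: (@le_trans _ _ (eta * `|z| * (`|h x| + 1) + k * `|z| * eta)).
  by apply: lerD; apply: ler_pM.
have -> : eta * `|z| * (`|h x| + 1) + k * `|z| * eta = eta * (`|h x| + 1 + k) * `|z| by ring.
rewrite ler_wpM2r //.
apply: (@le_trans _ _ (eta * C)).
  by rewrite ler_wpM2l ?ltW // /C; lra.
by rewrite -ler_pdivlMr // ge_min lexx orbT.
Qed.

Definition ccontinuous_at (T : topologicalType) (x : T) (G : T -> R[i]) :=
  cplx_class (fun g : T -> R => {for x, continuous g}) G.

Lemma is_cdiffM0 (V : normedModType R) (x : V) (F dF G : V -> R[i]) :
  is_cdiff x F dF -> F x = 0 -> ccontinuous_at x G ->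
  is_cdiff x (fun y => F y * G y) (fun v => dF v * G x).
Proof.
move=> [f1 f2] F0 [c1 c2].
have [r0 i0] : Re (F x) = 0 /\ Im (F x) = 0 by rewrite F0.
split.
  have := is_diffB (is_diffM0 f1 r0 c1) (is_diffM0 f2 i0 c2).
  by congr is_diff_def; apply/funext => y; rewrite ReM.
have := is_diffD (is_diffM0 f1 r0 c2) (is_diffM0 f2 i0 c1).
by congr is_diff_def; apply/funext => y; rewrite ImM.
Qed.

Lemma ccontinuous_normc (T : topologicalType) (x : T) (G : T -> R[i]) :
  ccontinuous_at x G -> {for x, continuous (fun y => normc (G y))}.
Proof.
move=> [c1 c2].
have -> : (fun y => normc (G y)) = fun y => Num.sqrt (Re (G y) ^+ 2 + Im (G y) ^+ 2).
  by apply/funext => y; case: (G y).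
apply: (@continuous_comp _ _ _ _ (@Num.sqrt R)); last exact: sqrt_continuous.
by apply: continuousD; apply: (@continuous_comp _ _ _ _ (fun t : R => t ^+ 2)) => //;
  exact: exprn_continuous.
Qed.

Lemma continuous_coord (T : topologicalType) (x : T) (m : nat) (g : T -> 'rV[R]_m) i :
  {for x, continuous g} -> {for x, continuous (fun y => g y 0 i)}.
Proof.
move=> h; apply: (@continuous_comp _ _ _ g (fun A : 'rV[R]_m => A 0 i)) => //.
exact: coord_continuous.
Qed.

Lemma ccontinuous_cpoint (T : topologicalType) (x : T) (g : T -> E) j :
  {for x, continuous g} -> ccontinuous_at x (fun y => cp (g y) j).
Proof. by move=> h; split; exact: continuous_coord. Qed.

Lemma cvec_cpoint (u : E) : cvec (cp u) = u.
Proof. by apply: cpoint_inj => j; rewrite cvecK. Qed.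

Lemma cvec_class (T : Type) (P : (T -> R) -> Prop) (Z : 'I_n.+1 -> T -> R[i]) i :
  (forall j, cplx_class P (Z j)) -> P (fun t => cvec (Z ^~ t) 0 i).
Proof.
move=> h; rewrite -(splitK i); case: (fintype.split i) => j /=; have [h1 h2] := h j.
  by move: h1; congr P; apply/funext => t; rewrite row_mxEl mxE.
by move: h2; congr P; apply/funext => t; rewrite row_mxEr mxE.
Qed.

Lemma is_diff_mulmxr (p q : nat) (B : 'M[R]_(p, q)) (u : 'rV[R]_p) :
  is_diff u (mulmx^~ B) (mulmx^~ B).
Proof.
apply: is_diff_rV => i.
have [h _] : is_cdiff u (fun v => \sum_k (v 0 k)%:C * (B k i)%:C)
   (fun v => \sum_k (v 0 k)%:C * (B k i)%:C).
  apply: is_cdiff_sum => k; apply: is_cdiff_eq.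
    by apply: is_cdiffM; [apply: is_cdiff_real; exact: is_diff_coord|exact: is_cdiff_cst].
  by move=> v /=; rewrite mulr0 addr0.
by move: h; congr is_diff_def; apply/funext => v; rewrite mxE Re_sum;
  apply: eq_bigr => k _; rewrite ReM /= mulr0 subr0.
Qed.

End ComplexCoordinates.

Section Continuity.
Variable R : realType.

Lemma continuous_fst (S T : topologicalType) (p : S * T) : {for p, continuous fst}.
Proof. exact: cvg_fst. Qed.

Lemma continuous_snd (S T : topologicalType) (p : S * T) : {for p, continuous snd}.
Proof. exact: cvg_snd. Qed.

Lemma continuous_pair (T A B : topologicalType) (f : T -> A) (g : T -> B) x :
  {for x, continuous f} -> {for x, continuous g} ->
  {for x, continuous (fun y => (f y, g y))}.
Proof. by move=> cf cg; exact: cvg_pair. Qed.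

Lemma continuous_dist (T : topologicalType) (f : T -> R) x :
  (forall eps : R, 0 < eps -> \forall y \near x, `|f x - f y| < eps) ->
  {for x, continuous f}.
Proof. by move=> h; apply/cvgrPdist_lt. Qed.

End Continuity.

(** * The implicit function theorem for the cone at a regular point *)

Section ImplicitChart.
Variables (R : realType) (n : nat) (f : mpoly.mpoly n.+1 R[i]).
Local Notation E := 'rV[R]_(n.+1 + n.+1).
Local Notation cp := Defs.cpoint.
Local Notation M := (cone f).
Local Notation normc := Normc.normc.

Lemma Re_le_normc (z : R[i]) : `|Re z| <= normc z.
Proof. by case: z => a b /=; rewrite -sqrtr_sqr ler_wsqrtr // lerDl sqr_ge0. Qed.

Lemma Im_le_normc (z : R[i]) : `|Im z| <= normc z.
Proof. by case: z => a b /=; rewrite -sqrtr_sqr ler_wsqrtr // lerDr sqr_ge0. Qed.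

Lemma ccontinuous_neq0 (T : topologicalType) (x : T) (G : T -> R[i]) :
  ccontinuous_at x G -> G x != 0 -> \forall y \near x, G y != 0.
Proof.
move=> /ccontinuous_normc c G0.
have : \forall y \near x, normc (G y) != 0.
  apply: (c [set t : R | t != 0]); apply: open_nbhs_nbhs; split; first exact: open_neq.
  by rewrite /= gt_eqF // normc_gt0.
by apply: filterS => y; apply: contra => /eqP ->; rewrite Normc.normc0.
Qed.

Lemma ccontinuous_gradc (T : topologicalType) (t : T) (g : T -> E) j :
  {for t, continuous g} -> ccontinuous_at t (fun y => gradc f j (g y)).
Proof.
move=> cg.
apply: (cplx_class_meval (continuous_fun_alg R t) _ (F := fun j y => cp (g y) j)) => k.
exact: ccontinuous_cpoint.
Qed.

Variables (x0 : E) (m : nat) (B : 'M[R]_(m, n.+1 + n.+1)).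
Hypothesis Mx0 : M x0.
Hypothesis g0 : gradsq f x0 != 0.
Hypothesis fB : row_free B.
Hypothesis tB : forall u : 'rV_m, dfc f x0 (u *m B) = 0.
Hypothesis kB : forall v, dfc f x0 v = 0 -> v *m pinvmx B *m B = v.

(** Coordinates at [x0]: [u] runs along the tangent rows of [B], and [s] along the complex normal
    line, whose direction is [b]. The equation [F u s = 0] is to be solved for [s], and [D] is the
    complex derivative of [F] in [s]. *)
Let b j : R[i] := (gradc f j x0)^* / gradsq f x0.
Let Y (u : 'rV[R]_m) (s : R[i]) : E := x0 + u *m B + dfdual f x0 s.
Let F u s := f.@[cp (Y u s)].
Let D y := dfc f y (dfdual f x0 1).

Let cpY u s j : cp (Y u s) j = cp (x0 + u *m B) j + s * b j.
Proof. by rewrite /Y cpointD cvecK mulrA. Qed.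

Let FE u s : F u s = f.@[fun j => cp (x0 + u *m B) j + s * b j].
Proof. by apply: mpoly.meval_eq => j; exact: cpY. Qed.

Let DE y : D y = \sum_j gradc f j y * b j.
Proof. by rewrite /D /dfc; apply: eq_bigr => j _; rewrite cvecK mul1r. Qed.

Let Y_continuous (t : 'rV[R]_m * (R * R)) :
  {for t, continuous (fun t : 'rV[R]_m * (R * R) => Y t.1 (Complex t.2.1 t.2.2))}.
Proof.
apply: continuous_rV => i.
have -> : (fun t : 'rV[R]_m * (R * R) => Y t.1 (Complex t.2.1 t.2.2) 0 i) =
  (fun t => cvec (fun j => (cp x0 j + cp (t.1 *m B) j) + Complex t.2.1 t.2.2 * b j) 0 i).
  apply/funext => s; rewrite -[Y _ _]cvec_cpoint; congr (cvec _ 0 i).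
  by apply/funext => j; rewrite cpY cpointD.
have hP := continuous_fun_alg R t.
apply: (cvec_class (P := fun g => {for t, continuous g}) (Z := fun j t =>
   cp x0 j + cp (t.1 *m B) j + Complex t.2.1 t.2.2 * b j)) => j.
apply: (cplx_classD hP).
  apply: (cplx_classD hP); first exact: (cplx_class_cst hP).
  apply: ccontinuous_cpoint.
  apply: (@continuous_comp _ _ _ fst (fun u : 'rV[R]_m => u *m B)).
    exact: continuous_fst.
  by apply: differentiable_continuous; have [] := is_diff_mulmxr B t.1.
apply: (cplx_classM hP); last exact: (cplx_class_cst hP).
split => /=.
  apply: (@continuous_comp _ _ _ snd fst); [exact: continuous_snd|exact: continuous_fst].
apply: (@continuous_comp _ _ _ snd snd); exact: continuous_snd.
Qed.

Let Ys_diff u s : is_diff u (Y ^~ s) (fun v => v *m B).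
Proof.
have h1 := is_diff_cst x0 u; have h2 := is_diff_mulmxr B u.
have h3 := is_diff_cst (dfdual f x0 s) u.
have := is_diffD (is_diffD h1 h2) h3.
by congr is_diff_def; apply/funext => v; rewrite !fctE ?add0r ?addr0.
Qed.

Let Ys_continuous u s : {for u, continuous (Y ^~ s)}.
Proof. by apply: differentiable_continuous; have [] := Ys_diff u s. Qed.

Variable q : ('I_n.+1 -> R[i]) -> ('I_n.+1 -> R[i]) -> R[i].
Hypothesis q1 : forall z w s, (forall j, z j - w j = s * b j) -> f.@[z] - f.@[w] = s * q z w.
Hypothesis q2 : forall z, q z z = \sum_j f^`M(j).@[z] * b j.
Hypothesis q3 : forall (T : Type) (S : set T) (P : (T -> R) -> Prop) (Z W : 'I_n.+1 -> T -> R[i]),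
        fun_alg S P -> (forall j, cplx_class P (Z j)) -> (forall j, cplx_class P (W j)) ->
        cplx_class P (fun t => q (Z ^~ t) (W ^~ t)).

Let DYE u s :
  \sum_j f^`M(j).@[fun k => cp (x0 + u *m B) k + s * b k] * b j = D (Y u s).
Proof.
rewrite DE; apply: eq_bigr => j _; congr (_ * _).
by apply: mpoly.meval_eq => k; rewrite cpY.
Qed.

Let qD y : q (cp y) (cp y) = D y.
Proof. by rewrite q2 DE. Qed.

Let Fdiff u s1 s2 : F u s1 - F u s2 = (s1 - s2) * q (cp (Y u s1)) (cp (Y u s2)).
Proof. by apply: q1 => j; rewrite !cpY opprD addrACA subrr add0r mulrBl. Qed.

(** At [(x0, x0)] the divided difference is [df] on the dual vector of [1], that is, [1]; by
    continuity it is not zero for pairs near [x0]. *)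
Let good_nbhs : exists O : set E, [/\ open O, O x0, forall y, O y -> y != 0 &
  forall y1 y2, O y1 -> O y2 -> q (cp y1) (cp y2) != 0].
Proof.
have cq : ccontinuous_at (x0, x0) (fun t : E * E => q (cp t.1) (cp t.2)).
  apply: (q3 (Z := fun j t => cp t.1 j) (W := fun j t => cp t.2 j)
    (continuous_fun_alg R ((x0, x0) : E * E))) => j; apply: ccontinuous_cpoint.
    exact: continuous_fst.
  exact: continuous_snd.
have := ccontinuous_neq0 cq.
rewrite /= qD /D dfc_dfdual // oner_neq0 => /(_ isT) [[P1 P2] /= [n1 n2] hP].
exists ((P1 `&` P2)° `&` [set y | y != 0]); split.
- apply: openI; first exact: open_interior.
  rewrite (_ : [set y | y != 0] = ~` [set 0]); last first.
    by apply/seteqP; split => y /= /eqP.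
  apply: closed_openC; apply: accessible_closed_set1.
  by apply: hausdorff_accessible; exact: norm_hausdorff.
- by split; [exact: filterI|case: Mx0].
- by move=> y [].
- move=> y1 y2 [/interior_subset [p1 _] _] [/interior_subset [_ p2] _].
  exact: (hP (y1, y2)).
Qed.

Section OnNeighbourhood.
Variable O : set E.
Hypothesis oO : open O.
Hypothesis Ox0 : O x0.
Hypothesis O0 : forall y, O y -> y != 0.
Hypothesis Oq : forall y1 y2, O y1 -> O y2 -> q (cp y1) (cp y2) != 0.

(** [U] is the set of parameters over which the cone meets [O]. Since [q] has no zero on pairs from
    [O], the root chosen by [h] is the only one in [O]. *)
Let U : set 'rV[R]_m := [set u | exists s, F u s = 0 /\ O (Y u s)].
Let h u : R[i] := xget 0 [set s | F u s = 0 /\ O (Y u s)].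
Let psi u : E := Y u (h u).

Let hP u : U u -> F u (h u) = 0 /\ O (psi u).
Proof. by move=> Uu; exact: (@xgetPex _ 0 [set s | F u s = 0 /\ O (Y u s)] Uu). Qed.

Let uniq_root u s1 s2 : F u s1 = 0 -> F u s2 = 0 -> O (Y u s1) -> O (Y u s2) -> s1 = s2.
Proof.
move=> F1 F2 O1 O2; have /eqP := Fdiff u s1 s2.
rewrite F1 F2 subrr eq_sym mulf_eq0 (negbTE (Oq O1 O2)) orbF subr_eq0.
by move/eqP.
Qed.

Let hE u s : F u s = 0 -> O (Y u s) -> h u = s.
Proof.
move=> Fs Os; have [Fh Oh] : F u (h u) = 0 /\ O (psi u) by apply: hP; exists s.
exact: uniq_root Fh Fs Oh Os.
Qed.

(** When [u] tends to [u1], [F u s1] tends to [0] and its derivative in [s] stays away from [0], so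
    the nearest root tends to [s1]. Both the openness of [U] and the continuity of [h] follow. *)
Let persist u1 s1 (eps : R) : 0 < eps -> F u1 s1 = 0 -> O (Y u1 s1) ->
  \forall u \near u1, exists s, [/\ F u s = 0, O (Y u s) & normc (s - s1) < eps].
Proof.
move=> eps0 F1 O1.
have nY : nbhs (u1, (Re s1, Im s1)) [set t | O (Y t.1 (Complex t.2.1 t.2.2))].
  apply: (Y_continuous (t := (u1, (Re s1, Im s1)))); apply: open_nbhs_nbhs.
  by split => //=; move: O1; case: (s1).
case: nY => [[P1 P2] /= [n1 [[Q1 Q2] /= [m1 m2] hQ]] hP'].
have /nbhs_ballP [d1 /= d10 hd1] := m1; have /nbhs_ballP [d2 /= d20 hd2] := m2.
(* The radii [d1] and [d2] keep the real and imaginary parts of the new root in a box over which [Y]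
   stays in [O]. *)
pose d := Num.min eps (Num.min d1 d2).
have d0 : 0 < d by rewrite !lt_min eps0 d10.
have [K hK] := nearest_root_line f.
have cD : ccontinuous_at u1 (fun u => D (Y u s1)).
  rewrite (_ : (fun u => _) = fun u => \sum_j gradc f j (Y u s1) * b j); last first.
    by apply/funext => u; rewrite DE.
  apply: (cplx_class_sum (continuous_fun_alg R u1)) => j.
  apply: (cplx_classM (continuous_fun_alg R u1)); last exact: (cplx_class_cst (continuous_fun_alg R u1)).
  exact: ccontinuous_gradc (Ys_continuous (u := u1) (s := s1)).
have D1 : D (Y u1 s1) != 0 by rewrite -qD Oq.
have cF : ccontinuous_at u1 (fun u => F u s1).
  apply: (cplx_class_meval (continuous_fun_alg R u1) f (F := fun j u => cp (Y u s1) j)) => j.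
  exact: ccontinuous_cpoint (Ys_continuous (u := u1) (s := s1)).
have small : \forall u \near u1, K * normc (F u s1) / normc (D (Y u s1)) < d.
  have cont : {for u1, continuous (fun u => K * normc (F u s1) / normc (D (Y u s1)))}.
    apply: continuousM.
      by apply: continuousM; [exact: cst_continuous|exact: ccontinuous_normc].
    by apply: continuousV; [rewrite gt_eqF // normc_gt0|exact: ccontinuous_normc].
  apply: (cont [set t | t < d]); rewrite /= F1 Normc.normc0 mulr0 mul0r.
  exact: lt_nbhsl.
have nD := ccontinuous_neq0 cD D1.
apply: filterS3 n1 nD small => u P1u Du sm.
have := hK (fun j => cp (x0 + u *m B) j) b s1.
rewrite /= DYE -FE => /(_ Du) [r Fr hr].
have rd : normc (r - s1) < d by exact: le_lt_trans hr sm.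
exists r; split; first by rewrite FE.
  have -> : r = Complex (Re r) (Im r) by case: (r).
  apply: (hP' (u, (Re r, Im r))); split => //=; apply: hQ; split => /=.
    apply: hd1; rewrite -ball_normE /= distrC -ReN -ReD; apply: le_lt_trans (Re_le_normc _) _.
    by apply: lt_le_trans rd _; rewrite !ge_min lexx orbT.
  apply: hd2; rewrite -ball_normE /= distrC -ImN -ImD; apply: le_lt_trans (Im_le_normc _) _.
  by apply: lt_le_trans rd _; rewrite !ge_min lexx !orbT.
by apply: lt_le_trans rd _; rewrite ge_min lexx.
Qed.

Let open_U : open U.
Proof.
rewrite openE => u [s [Fs Os]]; rewrite /interior.
by apply: filterS (persist ltr01 Fs Os) => v [r [Fr Or _]]; exists r.
Qed.

Let h_continuous u : U u -> ccontinuous_at u h.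
Proof.
move=> Uu; have [Fu Ou] := hP Uu.
have H (eps : R) : 0 < eps -> \forall v \near u, normc (h v - h u) < eps.
  move=> e0; apply: filterS (persist e0 Fu Ou) => v [r [Fr Or hr]].
  by rewrite (hE Fr Or).
split; apply: continuous_dist => eps e0; apply: filterS (H eps e0) => v hv /=.
  by rewrite distrC -ReN -ReD (le_lt_trans (Re_le_normc _)).
by rewrite distrC -ImN -ImD (le_lt_trans (Im_le_normc _)).
Qed.

Let psi_continuous u : U u -> {for u, continuous psi}.
Proof.
move=> Uu; have [c1 c2] := h_continuous Uu.
have -> : psi = (fun t : 'rV[R]_m * (R * R) => Y t.1 (Complex t.2.1 t.2.2)) \o
   (fun u => (u, (Re (h u), Im (h u)))).
  by apply/funext => v; rewrite /psi /=; case: (h v).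
apply: continuous_comp; last exact: Y_continuous.
apply: continuous_pair; first exact: cvg_id.
exact: continuous_pair c1 c2.
Qed.

(* [0 = F v (h v) = F v (h u) + (h v - h u) * q], so [h v - h u] is the product of
   a differentiable function vanishing at [u] and of a continuous one. *)
Let h_diff u : U u ->
  is_cdiff u h (fun v => - dfc f (psi u) (v *m B) / D (psi u)).
Proof.
move=> Uu; have [Fu Ou] := hP Uu.
have cq : ccontinuous_at u (fun v => (q (cp (psi v)) (cp (Y v (h u))))^-1).
  apply: (cplx_classV (continuous_fun_alg R u)).
    apply: (q3 (Z := fun j v => cp (psi v) j) (W := fun j v => cp (Y v (h u)) j)
      (continuous_fun_alg R u)) => j; apply: ccontinuous_cpoint.
      exact: psi_continuous.
    exact: Ys_continuous.
  by move=> v ->; apply: Oq.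
have dF : is_cdiff u (fun v => - F v (h u)) (fun v => - dfc f (psi u) (v *m B)).
  apply: is_cdiffN.
  apply: (is_cdiff_meval f (F := fun j v => cp (Y v (h u)) j)) => j.
  exact: (is_cdiff_comp (Ys_diff u (h u)) (is_cdiff_cpoint _ j)).
have F0 : - F u (h u) = 0 by rewrite Fu oppr0.
have hd := is_cdiffM0 dF F0 cq.
have := is_cdiffD (is_cdiff_cst u (h u)) hd.
move/(near_eq_is_cdiff (G := h)); rewrite -/(psi u) qD => H.
apply: is_cdiff_eq (H _) _ => [|v]; last by rewrite add0r.
have nO : \forall v \near u, O (Y v (h u)).
  by apply: (Ys_continuous (u := u) (s := h u)); apply: open_nbhs_nbhs; split.
have nU : \forall v \near u, U v by apply: open_nbhs_nbhs; split.
apply: filterS2 nO nU => v Ov Uv; have [Fv Opv] := hP Uv.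
have E := Fdiff v (h v) (h u); rewrite Fv sub0r in E.
by rewrite E mulfK ?subrKC // Oq.
Qed.

Let psi_diff u : U u ->
  is_diff u psi (fun v => v *m B + dfdual f x0 (- dfc f (psi u) (v *m B) / D (psi u))).
Proof.
move=> Uu.
have h1 := is_diffD (is_diff_cst x0 u) (is_diff_mulmxr B u).
have h2 : is_diff u (fun v => dfdual f x0 (h v)) (fun v =>
   dfdual f x0 (- dfc f (psi u) (v *m B) / D (psi u))).
  apply: (is_diff_cvec (Z := fun j v => h v * (gradc f j x0)^* / gradsq f x0)
    (dZ := fun j v => (- dfc f (psi u) (v *m B) / D (psi u)) * (gradc f j x0)^* / gradsq f x0)) => j.
  apply: is_cdiff_eq.
    apply: is_cdiffM (is_cdiff_cst _ _); apply: is_cdiffM (is_cdiff_cst _ _).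
    exact: h_diff.
  by move=> v /=; rewrite !mulr0 !addr0.
have := is_diffD h1 h2.
by congr is_diff_def; apply/funext => v; rewrite !fctE ?add0r.
Qed.

Let mulmx_class k j : cplx_class (Ckr k U) (fun u => cp (u *m B) j).
Proof.
suff coo i : Ckr k U (fun u => (u *m B) 0 i) by split; exact: coo.
elim: k => [|k IH].
  move=> u _; apply: continuous_coord; apply: differentiable_continuous.
  by have [] := is_diff_mulmxr B u.
have dc u := is_diff_comp (is_diff_mulmxr B u) (is_diff_coord 0 i (u *m B)).
split=> [u _|v]; first by have [] := dc u.
have -> : (fun u => 'D_v (fun u : 'rV[R]_m => (u *m B) 0 i) u) = fun=> (v *m B) 0 i.
  by apply/funext => u; have [d e] := dc u; rewrite deriveE // e.
exact: Ckr_cst.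
Qed.

Let psi_class k j : cplx_class (Ckr k U) h -> cplx_class (Ckr k U) (fun u => cp (psi u) j).
Proof.
move=> hh; have hP' := Ckr_fun_alg k open_U.
rewrite (_ : (fun u => _) = fun u => cp x0 j + cp (u *m B) j + h u * b j); last first.
  by apply/funext => u; rewrite /psi cpY cpointD.
apply: (cplx_classD hP'); last by apply: (cplx_classM hP') => //; exact: (cplx_class_cst hP').
by apply: (cplx_classD hP') => //; exact: (cplx_class_cst hP').
Qed.

(** Bootstrap: if [h] is [C^k] then so is [psi], and the derivative of [h] is a rational expression
    in [psi], hence [C^k] too. *)
Let h_smooth k : cplx_class (Ckr k U) h.
Proof.
elim: k => [|k IH].
  by split=> u Uu; have [c1 c2] := h_continuous Uu.
have hP' := Ckr_fun_alg k open_U.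
have dfc_class v : cplx_class (Ckr k U) (fun u => dfc f (psi u) v).
  apply: (cplx_class_sum hP') => j; apply: (cplx_classM hP'); last exact: (cplx_class_cst hP').
  by apply: (cplx_class_meval hP' _ (F := fun j u => cp (psi u) j)) => l; exact: psi_class.
have dh v : cplx_class (Ckr k U) (fun u => - dfc f (psi u) (v *m B) / D (psi u)).
  apply: (cplx_classM hP'); first by apply: (cplx_classN hP').
  by apply: (cplx_classV hP') => [|u /hP [_ Ou]]; [exact: dfc_class|rewrite -qD Oq].
split; split=> [u Uu|v].
- by have [[]] := h_diff Uu.
- have [hr _] := dh v; apply: Ckr_ext hr => // u Uu.
  by have := is_cdiff_val v (h_diff Uu); move=> ->.
- by have [_ []] := h_diff Uu.
- have [_ hr] := dh v; apply: Ckr_ext hr => // u Uu.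
  by have := is_cdiff_val v (h_diff Uu); move=> ->.
Qed.

Let psi_smooth : smooth U psi.
Proof.
move=> k; apply: Ck_coord => // i.
have := cvec_class (P := Ckr k U) (Z := fun j u => cp (psi u) j) i
  (fun j => psi_class j (h_smooth k)).
by congr Ckr; apply/funext => u; rewrite cvec_cpoint.
Qed.

Let dfc_Y u s : dfc f x0 (Y u s - x0) = s.
Proof. by rewrite /Y addrAC [x0 + _]addrC addrK dfcD tB add0r dfc_dfdual. Qed.

(** A left inverse of [psi], affine and defined on the whole space: it gives injectivity and shows
    that images of open sets are open in the cone. *)
Let chart_coord y : 'rV[R]_m :=
  (y - x0 - dfdual f x0 (dfc f x0 (y - x0))) *m pinvmx B.

Let chart_coordK u s : chart_coord (Y u s) = u.
Proof.
rewrite /chart_coord dfc_Y {1}/Y addrAC addrK [_ - x0]addrC addKr.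
exact: mulmxKp.
Qed.

Let Y_chart_coord y : Y (chart_coord y) (dfc f x0 (y - x0)) = y.
Proof.
rewrite /Y /chart_coord kB; last by rewrite dfcD dfcN dfc_dfdual // subrr.
by rewrite addrA subrK subrKC.
Qed.

Let chart_coord_continuous y : {for y, continuous chart_coord}.
Proof.
apply: differentiable_continuous.
have h1 := is_diffB (is_diff_id y) (is_diff_cst x0 y).
have h2 : is_cdiff y (fun z => dfc f x0 (z - x0)) (fun z => dfc f x0 (z - 0)).
  apply: is_cdiff_eq.
    apply: is_cdiff_sum => j; apply: is_cdiffM; first exact: is_cdiff_cst.
    exact: is_cdiff_cpoint_comp h1.
  by move=> v; apply: eq_bigr => j _; rewrite mul0r add0r !fctE.
have h3 : exists dK, is_diff y (fun z => dfdual f x0 (dfc f x0 (z - x0))) dK.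
  eexists; apply: is_diff_cvec => j.
  by apply: is_cdiffM (is_cdiff_cst _ _); apply: is_cdiffM (is_cdiff_cst _ _); exact: h2.
have [dK hK] := h3.
by have [] := is_diff_comp (is_diffB h1 hK) (is_diff_mulmxr (pinvmx B) _).
Qed.

Lemma chart_on_neighbourhood : exists (U : set 'rV_m) (psi : 'rV_m -> E),
  [/\ local_param M U psi, (psi @` U) x0 & forall v, dfc f x0 v = 0 -> tangent M x0 v].
Proof.
have Y0 : Y 0 0 = x0.
  rewrite /Y mul0mx addr0; have -> : dfdual f x0 0 = 0.
    by apply: cpoint_inj => j; rewrite cvecK !mul0r cpoint0.
  by rewrite addr0.
have F00 : F 0 0 = 0 by rewrite /F Y0; case: Mx0.
have O00 : O (Y 0 0) by rewrite Y0.
have U0 : U 0 by exists 0.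
have h0 : h 0 = 0 := hE F00 O00.
have psi0 : psi 0 = x0 by rewrite /psi h0.
have psiM u : U u -> M (psi u).
  by move=> /hP [Fu Ou]; split => //; exact: O0.
exists U, psi; split; first split => //.
- move=> u v; rewrite !inE => Uu Uv /(congr1 chart_coord).
  by rewrite !chart_coordK.
(* Applying [dfc f x0] kills the tangent part and shows that the normal component is [0]; then
   [v *m B = 0], and [B] is row free. *)
- move=> u Uu v; have [d e] := psi_diff Uu; rewrite deriveE // e /= => E0.
  have := congr1 (fun w => w *m pinvmx B) E0; have := congr1 (dfc f x0) E0.
  rewrite dfcD tB add0r dfc_dfdual // => ->.
  have -> : dfdual f x0 (dfc f x0 0) = 0.
    by apply: cpoint_inj => j; rewrite cvecK /dfc big1 ?mul0r ?cpoint0 // => k _; rewrite cpoint0 mulr0.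
  by rewrite addr0 mul0mx mulmxKp.
(* By uniqueness of the root in [O], a point of [M] in [O] is the image under [psi] of its own
   [chart_coord]. *)
- move=> U' oU' sU; exists (O `&` chart_coord @^-1` U').
    apply: openI => //; apply: open_comp => // y _; exact: chart_coord_continuous.
  apply/seteqP; split => [y [u U'u <-]|y [My [Oy U'y]]].
    have Uu := sU _ U'u; split; first exact: psiM.
    by split; [have [] := hP Uu|rewrite /= chart_coordK].
  exists (chart_coord y) => //.
  rewrite /psi (@hE _ (dfc f x0 (y - x0))) ?/F Y_chart_coord //.
  by case: My.
- by exists 0.
(* The curve is [psi (t a)], with [a] the coordinates of [v]. The correction by [h] has zero
   derivative at [x0], since [df] vanishes on the rows of [B] there. *)
- move=> v dv; pose a := v *m pinvmx B.
  have hl : is_diff (0 : R) (fun t : R => t *: a) (fun t : R => t *: a).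
    exact: is_diff_scalel.
  have Us0 : U ((0 : R) *: a) by rewrite scale0r.
  have := is_diff_comp hl (psi_diff Us0); rewrite scale0r psi0 => -[d e].
  exists (fun t : R => psi (t *: a)); split.
  + by rewrite scale0r.
  + have c : {for (0 : R), continuous (fun t : R => t *: a)}.
      by apply: differentiable_continuous; have [] := hl.
    have : \forall t \near (0 : R), U (t *: a).
      by apply: c; apply: open_nbhs_nbhs; rewrite scale0r.
    by apply: filterS => t; exact: psiM.
  + apply: DeriveDef; first exact/derivable1_diffP.
    rewrite deriveE // e /= scale1r tB oppr0 mul0r.
    have -> : dfdual f x0 0 = 0 by apply: cpoint_inj => j; rewrite cvecK !mul0r cpoint0.
    by rewrite addr0 /a kB.
Qed.

End OnNeighbourhood.

Lemma chart_in_coordinates : exists (U : set 'rV_m) (psi : 'rV_m -> E),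
  [/\ local_param M U psi, (psi @` U) x0 & forall v, dfc f x0 v = 0 -> tangent M x0 v].
Proof. by have [N [h1 h2 h3 h4]] := good_nbhs; exact: chart_on_neighbourhood h1 h2 h3 h4. Qed.

End ImplicitChart.

(** * Real bases of the complex tangent hyperplane, and charts *)

Section HypersurfaceChart.
Variables (R : realType) (n : nat) (f : mpoly.mpoly n.+1 R[i]).
Local Notation E := 'rV[R]_(n.+1 + n.+1).

(** [df] takes the values [1] and [i], so its real and imaginary parts are independent real
    functionals and cut the dimension [2n + 2] down to [2n]. *)
Lemma tangent_basis (x : E) : gradsq f x != 0 ->
  exists B : 'M[R]_(n.*2, n.+1 + n.+1), [/\ row_free B,
    forall u : 'rV_n.*2, dfc f x (u *m B) = 0 &
    forall v, dfc f x v = 0 -> v *m pinvmx B *m B = v].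
Proof.
(* Multiplying by [gradsq] clears the denominator of the dual vector: the products of [n1] and [n2]
   with [v] are the real and imaginary parts of [df v]. *)
move=> g0; pose n1 := dfdual f x (gradsq f x); pose n2 := dfdual f x (gradsq f x * 'i%C).
pose A := (col_mx n1 n2)^T.
have g1 : Re (gradsq f x) != 0 by rewrite gt_eqF // Re_gradsq_gt0.
have dfcA v : dfc f x v = Complex ((v *m A) 0 (lshift 1 0)) ((v *m A) 0 (rshift 1 0)).
  have d1 : (v *m A) 0 (lshift 1 0) = dot n1 v.
    by rewrite mxE /dot; apply: eq_bigr => i _; rewrite mxE col_mxEu mulrC.
  have d2 : (v *m A) 0 (rshift 1 0) = dot n2 v.
    by rewrite mxE /dot; apply: eq_bigr => i _; rewrite mxE col_mxEd mulrC.
  rewrite d1 d2 !dot_dfdual.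
  have e1 : Re (gradsq f x * (dfc f x v)^*) = Re (gradsq f x) * Re (dfc f x v).
    by rewrite {1}gradsqE ReM ReJ /= mul0r subr0.
  have e2 : Re (gradsq f x * 'i%C * (dfc f x v)^*) = Re (gradsq f x) * Im (dfc f x v).
    rewrite {1}gradsqE -mulrA ReM /= mul0r subr0; congr (_ * _).
    by rewrite ReM ImJ /= mul0r mul1r sub0r opprK.
  by rewrite e1 e2 ![Re (gradsq f x) * _]mulrC !mulfK //; case: (dfc f x v).
have kerE v : dfc f x v = 0 <-> (v <= kermx A)%MS.
  split => [h|/sub_kermxP h].
    apply/sub_kermxP/rowP => i; move: h; rewrite dfcA => -[h1 h2].
    by rewrite [RHS]mxE -(splitK i); case: (fintype.split i) => j; rewrite (ord1 j).
  by rewrite dfcA h !mxE.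
have rA : \rank A = 2%N.
  apply/eqP; change (row_full A); apply/row_fullP.
  exists (col_mx (dfdual f x 1) (dfdual f x 'i%C)).
  have H c : dfdual f x c *m A = row_mx (Re c)%:M (Im c)%:M.
    have hc := dfcA (dfdual f x c); rewrite dfc_dfdual // in hc.
    have hr := congr1 (@complex.Re R) hc; have hi := congr1 (@complex.Im R) hc.
    apply/rowP => i; rewrite -(splitK i); case: (fintype.split i) => j; rewrite (ord1 j) /=.
      by rewrite -[LHS]hr [RHS]row_mxEl [RHS]mxE.
    by rewrite -[LHS]hi [RHS]row_mxEr [RHS]mxE.
  by rewrite mul_col_mx !H /= raddf0 scalar_mx_block.
have rk : \rank (kermx A) = n.*2 by rewrite mxrank_ker rA addnn doubleS subn2.
have h1 := row_base_free (kermx A); have h2 := eq_row_base (kermx A).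
move: (row_base (kermx A)) h1 h2; rewrite rk => B fB eB; exists B; split => // [u|v].
  by apply/kerE; rewrite -eB submxMl.
by move/kerE; rewrite -eB => h; rewrite mulmxKpV.
Qed.

Lemma hypersurface_chart (x : E) : cone f x -> gradsq f x != 0 ->
  exists (U : set 'rV_n.*2) (psi : 'rV_n.*2 -> E),
  [/\ local_param (cone f) U psi, (psi @` U) x &
      forall v, dfc f x v = 0 -> tangent (cone f) x v].
Proof.
move=> Mx g0; have [B [B1 B2 B3]] := tangent_basis g0.
have [q [q1 q2 q3]] := mpoly_divided_difference f (fun j => (gradc f j x)^* / gradsq f x).
exact: (chart_in_coordinates Mx g0 B1 B2 B3 q1 q2 q3).
Qed.

End HypersurfaceChart.

(** * Homogeneous polynomials and their cones *)

Section HomogeneousPolynomials.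
Variables (R : realType) (n : nat).
Implicit Types (p : mpoly.mpoly n R[i]) (z : 'I_n -> R[i]).
Local Notation dhomog d p := (p \is mpoly.ishomog1 d (mpoly.mpoly_mdeg__canonical__mpoly_Measure n)).

Lemma dhomog_mderiv d p j : dhomog d p -> dhomog d.-1 p^`M(j).
Proof.
move=> /mpoly.dhomogP hp; apply/mpoly.dhomogP => m.
rewrite mpoly.mcoeff_msupp mpoly.mcoeff_mderiv => hm.
have : mpoly.mnm_add m (mpoly.mnm1 j) \in mpoly.msupp p.
  by rewrite mpoly.mcoeff_msupp; apply: contra hm => /eqP ->; rewrite mul0rn.
by move=> /hp /= <-; rewrite mpoly.mdegD mpoly.mdeg1 addn1.
Qed.

Lemma dhomog_meval d p z (t : R[i]) : dhomog d p ->
  p.@[fun j => t * z j] = t ^+ d * p.@[z].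
Proof.
move=> /mpoly.dhomogP hp; rewrite !mpoly.mevalE mulr_sumr.
rewrite big_seq [RHS]big_seq; apply: eq_bigr => m /hp /= md.
rewrite mulrCA; congr (_ * _).
under eq_bigr => i _ do rewrite exprMn.
by rewrite big_split /= -expr_sum -md mpoly.mdegE.
Qed.

Lemma euler_identity d p z : dhomog d p ->
  \sum_j p^`M(j).@[z] * z j = d%:R * p.@[z].
Proof.
move=> /mpoly.dhomogP hp.
have Em (m : mpoly.multinom n) :
    \sum_j (mpoly.mpolyX R[i] m)^`M(j).@[z] * z j = (mpoly.mdeg m)%:R * (mpoly.mpolyX R[i] m).@[z].
  rewrite mpoly.mdegE natr_sum mulr_suml; apply: eq_bigr => j _.
  rewrite mpoly.mderivX mpoly.mevalZ -mulrA; have [->|mj] := posnP (m j).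
    by rewrite !mul0r.
  congr (_ * _); rewrite -[z j](mpoly.mevalXU z j) -mpoly.mevalM -mpoly.mpolyXD.
  by rewrite mpoly.submK // mpoly.lep1mP -lt0n.
rewrite {2}(mpoly.mpolyE p) (raddf_sum (mpoly.meval z)) /= mulr_sumr.
transitivity (\sum_j \sum_(m <- mpoly.msupp p)
    mpoly.mcoeff m p * ((mpoly.mpolyX R[i] m)^`M(j).@[z] * z j)).
  apply: eq_bigr => j _; rewrite {1}(mpoly.mpolyE p).
  rewrite (raddf_sum (mpoly.mderiv j)) (raddf_sum (mpoly.meval z)) /= mulr_suml.
  by apply: eq_bigr => m _; rewrite mpoly.mderivZ mpoly.mevalZ mulrA.
rewrite exchange_big big_seq [RHS]big_seq; apply: eq_bigr => m /hp /= md.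
by rewrite -mulr_sumr Em md mpoly.mevalZ mulrCA.
Qed.

End HomogeneousPolynomials.

(** * Radial behaviour of [df], and existence of points on the cone *)

Section HomogeneousCone.
Variables (R : realType) (n : nat) (f : mpoly.mpoly n.+1 R[i]).
Local Notation E := 'rV[R]_(n.+1 + n.+1).
Local Notation cp := Defs.cpoint.
Hypothesis n_gt0 : (0 < n)%N.
Hypothesis hf : homogeneous_poly n f.

(** Without such a zero, [f] would be constant on the lines [e1 + s e0] and [e0 + s e1], by
    algebraic closedness. The constants agree at [s = 1], yet homogeneity compares [s = 2] on one
    line with [s = 1/2] on the other by the factor [2^n]. *)
Lemma homogeneous_zero_exists : exists2 z : 'I_n.+1 -> R[i], (exists j, z j != 0) & f.@[z] = 0.
Proof.
pose e0 : 'I_n.+1 -> R[i] := fun j => (j == ord0)%:R.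
pose e1 : 'I_n.+1 -> R[i] := fun j => (j == ord_max)%:R.
have [K hK] := mpoly_line f.
have ne : (ord_max : 'I_n.+1) == ord0 = false by apply/eqP => /(congr1 val) /= E; move: n_gt0; rewrite E.
have [P [_ P2 _]] := hK e1 e0; have [Q [_ Q2 _]] := hK e0 e1.
have [/closed_rootP [s /rootP Ps]|/negPn/eqP sP] := boolP (size P != 1%N).
  exists (fun j => e1 j + s * e0 j); last by rewrite -P2.
  by exists ord_max; rewrite /e1 /e0 eqxx ne mulr0 addr0 oner_neq0.
have [/closed_rootP [s /rootP Qs]|/negPn/eqP sQ] := boolP (size Q != 1%N).
  exists (fun j => e0 j + s * e1 j); last by rewrite -Q2.
  by exists ord0; rewrite /e1 /e0 eqxx [ord0 == _]eq_sym ne mulr0 addr0 oner_neq0.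
exfalso; have /eqP/size_poly1P [c c0 Pc] := sP; have /eqP/size_poly1P [c' c'0 Qc] := sQ.
have Pe s : f.@[fun j => e1 j + s * e0 j] = c by rewrite -P2 Pc hornerC.
have Qe s : f.@[fun j => e0 j + s * e1 j] = c' by rewrite -Q2 Qc hornerC.
have cc : c = c'.
  rewrite -(Pe 1) -(Qe 1); apply: mpoly.meval_eq => j; by rewrite !mul1r addrC.
have c2 : c = 2 ^+ n * c'.
  rewrite -(Pe 2) -(Qe 2^-1) -(dhomog_meval _ _ hf); apply: mpoly.meval_eq => j.
  by rewrite mulrDr mulrA mulfV ?pnatr_eq0 // mul1r addrC.
move: c2; rewrite cc -[LHS]mul1r => /(mulIf c'0) /esym /eqP.
rewrite -natrX -[1]/(1%:R : R[i]) eqr_nat => /eqP E; have := ltn_expl n (ltnSn 1).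
by rewrite E ltnS leqNgt n_gt0.
Qed.

Lemma cone_nonempty : exists x, cone f x.
Proof.
have [z [j zj] fz] := homogeneous_zero_exists.
exists (cvec z); split.
  by apply: contra_neq zj => h; rewrite -(cvecK z j) h cpoint0.
by rewrite -fz; apply: mpoly.meval_eq => k; rewrite cvecK.
Qed.

Lemma cone_dfc x : cone f x -> dfc f x x = 0.
Proof. by move=> [_ fx]; rewrite /dfc (euler_identity _ hf) fx mulr0. Qed.

Lemma dgrad_radial j x : dgrad f j x x = (n%:R - 1) * gradc f j x.
Proof.
rewrite /dgrad (euler_identity _ (dhomog_mderiv j hf)) -subn1 natrB //.
Qed.

(** Euler's identity for the partial derivatives, of degree [n - 1]. The equality of the degree with
    the complex dimension of the cone is what makes the exponent critical. *)
Lemma theta_radial x : gradsq f x != 0 -> theta f x x = (n%:R - 1)%:C.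
Proof.
move=> g0; rewrite /theta.
under eq_bigr => j _ do rewrite dgrad_radial -mulrA.
by rewrite -mulr_sumr mulfK // rmorphB rmorph1 rmorph_nat.
Qed.

Lemma cpoint_scale (t : R) (x : E) : cp (t *: x) =1 (fun j => t%:C * cp x j).
Proof. by move=> j; rewrite cpointZ. Qed.

Lemma cone_scale (t : R) x : t != 0 -> cone f x -> cone f (t *: x).
Proof.
move=> t0 [x0 fx]; split; first by rewrite scaler_eq0 negb_or t0.
by rewrite (mpoly.meval_eq _ (cpoint_scale t x)) (dhomog_meval _ _ hf) fx mulr0.
Qed.

Lemma gradc_scale (t : R) (x : E) j : gradc f j (t *: x) = (t ^+ n.-1)%:C * gradc f j x.
Proof.
rewrite /gradc (mpoly.meval_eq _ (cpoint_scale t x)).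
by rewrite (dhomog_meval _ _ (dhomog_mderiv j hf)) rmorphXn.
Qed.

Lemma dfdual_scale (t : R) (x : E) c : t != 0 ->
  dfdual f (t *: x) c = (t ^+ n.-1)^-1 *: dfdual f x c.
Proof.
move=> t0; have gs j := gradc_scale t x j.
move: (t ^+ n.-1) (expf_neq0 n.-1 t0) gs => s s0' gs.
have s0 : s%:C != 0 :> R[i] by rewrite (inj_eq (@complexI R) s 0).
have gg : gradsq f (t *: x) = s%:C * s%:C * gradsq f x.
  rewrite /gradsq mulr_sumr; apply: eq_bigr => k _.
  by rewrite gs conjcM conjc_real mulrACA.
rewrite -[RHS]cvec_cpoint /dfdual; congr cvec; apply/funext => j.
rewrite (cpointZ s^-1) cvecK gs gg.
rewrite conjcM conjc_real fmorphV /=.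
have [->|g0] := eqVneq (gradsq f x) 0; first by rewrite mulr0 invr0 !mulr0.
by field; rewrite g0.
Qed.

Lemma homogeneity_dfdual : homogeneity f (1 - n%:R) (fun x => dfdual f x 1).
Proof.
move=> s r _ r0; rewrite dfdual_scale ?gt_eqF //; congr (_ *: _).
have -> : 1 - n%:R = - (n.-1)%:R :> R by rewrite -subn1 natrB // opprB.
by rewrite powRN powR_mulrn // ltW.
Qed.

End HomogeneousCone.

(** * Cutoff functions *)

Section Bump.
Variable R : realType.
Implicit Types (p : {poly R}) (x y t : R).

(* [x |-> p(1/x) exp(-1/x)], extended by [0] to the left of [0]: a family stable
   under differentiation. *)
Definition flat p x : R := if 0 < x then p.[x^-1] * expR (- x^-1) else 0.
Definition flat_deriv p : {poly R} := 'X^2 * (p - p^`()).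

(** From [exp(1 / (m x)) >= 1 / (m x)] one gets [exp(-1/x) <= (m x)^m]. Of the [m = k + 2] powers of
    [x], [k] absorb the polynomial, and two are left to force a zero derivative at [0]. *)
Lemma flat_bound p : exists2 C : R, 0 < C &
  forall x, 0 < x <= 1 -> `|p.[x^-1] * expR (- x^-1)| <= C * x ^+ 2.
Proof.
pose k := size p; pose m := k.+2; pose A : R := 1 + \sum_(i < k) `|p`_i|.
have A0 : 0 < A by rewrite ltr_pwDl // sumr_ge0.
exists (A * m%:R ^+ m) => [|x /andP[x0 x1]].
  by rewrite mulr_gt0 // exprn_gt0 // ltr0n.
have y1 : 1 <= x^-1 by rewrite invf_ge1.
have y0 : 0 < x^-1 by rewrite invr_gt0.
have hp : `|p.[x^-1]| <= A * x^-1 ^+ k.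
  rewrite horner_coef; apply: le_trans (ler_norm_sum _ _ _) _.
  apply: (@le_trans _ _ (\sum_(i < k) `|p`_i| * x^-1 ^+ k)).
    apply: ler_sum => i _; rewrite normrM ler_wpM2l // normrX (gtr0_norm y0).
    by rewrite ler_weXn2l // ltnW.
  by rewrite -mulr_suml ler_wpM2r //; [exact/exprn_ge0/ltW|rewrite lerDr].
have he : expR (- x^-1) <= (m%:R * x) ^+ m.
  have -> : (m%:R * x) ^+ m = ((m%:R^-1 * x^-1) ^+ m)^-1 by rewrite -exprVn invfM !invrK.
  rewrite expRN lef_pV2 ?posrE ?expR_gt0 //; last first.
    by rewrite exprn_gt0 // mulr_gt0 // invr_gt0 ltr0n.
  have -> : expR x^-1 = expR (m%:R^-1 * x^-1) ^+ m.
    by rewrite -expRM_natl mulrA mulfV ?mul1r // pnatr_eq0.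
  rewrite lerXn2r ?nnegrE ?expR_ge0 //; first by rewrite mulr_ge0 ?invr_ge0 ?ler0n // ltW.
  by apply: le_trans (expR_ge1Dx _); rewrite lerDr.
rewrite normrM [`|expR _|]ger0_norm ?expR_ge0 //.
apply: le_trans (ler_pM (normr_ge0 _) (expR_ge0 _) hp he) _.
rewrite exprVn exprMn /m !exprS.
have -> : A * (x ^+ k)^-1 * (k.+2%:R * (k.+2%:R * k.+2%:R ^+ k) * (x * (x * x ^+ k))) =
   A * (k.+2%:R * (k.+2%:R * k.+2%:R ^+ k)) * x ^+ 2 * ((x ^+ k)^-1 * x ^+ k) by ring.
by rewrite mulVf ?mulr1 // expf_neq0 // gt_eqF.
Qed.

Lemma is_derive_flat p x : is_derive x 1 (flat p) (flat (flat_deriv p) x).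
Proof.
have [x0|x0|<-] := ltgtP 0 x.
- have -> : flat (flat_deriv p) x = (flat_deriv p).[x^-1] * expR (- x^-1) by rewrite /flat x0.
  apply: (@near_eq_is_derive _ _ _ (fun t => p.[t^-1] * expR (- t^-1))).
    have : \forall t \near x, 0 < t by exact: lt_nbhsr.
    by apply: filterS => t t0; rewrite /flat t0.
  have dV : is_derive x 1 (fun t : R => t^-1) (- x ^- 2).
    have h : is_derive x 1 (fun t : R => t^-1) (- x ^- 2 *: 1).
      by apply: (@is_deriveV _ id); rewrite ?gt_eqF.
    by move: h; rewrite [_ *: _]mulr1.
  have dp : is_derive x 1 (fun t : R => p.[t^-1]) (p^`().[x^-1] * - x ^- 2).
    exact: (@is_derive1_comp _ (horner p) (fun t => t^-1)).
  have de : is_derive x 1 (fun t : R => expR (- t^-1)) (expR (- x^-1) * x ^- 2).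
    have dN : is_derive x 1 (fun t : R => - t^-1) (x ^- 2).
      by have := is_deriveN dV; rewrite opprK.
    exact: (@is_derive1_comp _ expR (fun t => - t^-1)).
  apply: is_derive_eq; rewrite /flat_deriv !hornerE -!exprVn.
  transitivity (p.[x^-1] * (expR (- x^-1) * x^-1 ^+ 2) +
    expR (- x^-1) * (p^`().[x^-1] * - x^-1 ^+ 2)) => //; ring.
- rewrite {2}/flat ltNge ltW //=.
  apply: near_eq_is_derive (is_derive_cst (0 : R) x (1 : R)).
  have : \forall t \near x, t < 0 by exact: lt_nbhsl.
  by apply: filterS => t t0; rewrite /flat ltNge ltW.
(* At [0] the quadratic bound on the right, with the zero values on the left, gives a zero
   differential. *)
have [C C0 hC] := flat_bound p.
rewrite {2}/flat ltxx.
have hd : is_diff (0 : R) (flat p) (\0 : {linear R -> R}).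
  apply: is_diff_eps; first exact: cst_continuous.
  move=> e e0; pose d := Num.min 1 (e / C).
  have d0 : 0 < d by rewrite lt_min ltr01 divr_gt0.
  have : \forall h \near (0 : R), `|h| < d.
    by apply/nbhs_normP; exists d => //= h; rewrite /= sub0r normrN.
  apply: filterS => h hd; rewrite addr0 {2}/flat ltxx !subr0 /flat.
  case: ifP => [h0|_]; last by rewrite normr0 mulr_ge0 // ltW.
  rewrite gtr0_norm // in hd; move: hd; rewrite lt_min => /andP[h1 h2].
  rewrite (gtr0_norm h0); apply: le_trans (hC _ _) _; first by rewrite h0 ltW.
  by rewrite expr2 mulrA ler_wpM2r ?ltW // mulrC -ltr_pdivlMr.
have [d e] := hd; apply: DeriveDef; first exact/derivable1_diffP.
by rewrite deriveE // e.
Qed.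

Lemma flat_ge0 x : 0 <= flat 1 x.
Proof. by rewrite /flat; case: ifP => // _; rewrite hornerC mul1r expR_ge0. Qed.

Variable d : R.

(* In the variable [t = ln rho], a bump on the interval [|d t + 2| < 1] whose second
   derivative is bounded below by [- 16 d^2] times itself, despite the compact support. *)
Definition cutoff_arg (rho : R) : R := (1 - (d * ln rho + 2) ^+ 2) / 2.
Definition cutoff (rho : R) : R := flat 1 (cutoff_arg rho).
Definition cutoff1 (rho : R) : R :=
  flat (flat_deriv 1) (cutoff_arg rho) * (- (d * ln rho + 2) * d / rho).
Definition cutoff2 (rho : R) : R :=
  flat (flat_deriv (flat_deriv 1)) (cutoff_arg rho) * (- (d * ln rho + 2) * d / rho) ^+ 2
  + flat (flat_deriv 1) (cutoff_arg rho) * ((- d ^+ 2 + (d * ln rho + 2) * d) / rho ^+ 2).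

Lemma is_derive_cutoff_arg (rho : R) : 0 < rho ->
  is_derive rho 1 cutoff_arg (- (d * ln rho + 2) * d / rho).
Proof.
move=> r0; have dl := is_derive1_ln r0.
have ds : is_derive rho 1 (fun t : R => d * ln t + 2) (d * rho^-1 + 0).
  exact: (is_deriveD (is_deriveZ d dl)).
have dq : is_derive rho 1 (fun t : R => (d * ln t + 2) * (d * ln t + 2))
   ((d * ln rho + 2) * (d * rho^-1 + 0) + (d * ln rho + 2) * (d * rho^-1 + 0)).
  exact: (is_deriveM ds ds).
have h : is_derive rho 1 (fun t : R => 2^-1 * (1 - (d * ln t + 2) * (d * ln t + 2)))
   (2^-1 * (0 - ((d * ln rho + 2) * (d * rho^-1 + 0) + (d * ln rho + 2) * (d * rho^-1 + 0)))).
  exact: (is_deriveZ 2^-1 (is_deriveB (is_derive_cst (1 : R) rho 1) dq)).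
have -> : cutoff_arg = fun t : R => 2^-1 * (1 - (d * ln t + 2) * (d * ln t + 2)).
  by apply/funext => t; rewrite /cutoff_arg mulrC.
by apply: is_derive_eq; field; rewrite gt_eqF.
Qed.

Lemma is_derive_cutoff (rho : R) : 0 < rho -> is_derive rho 1 cutoff (cutoff1 rho).
Proof.
move=> r0; apply: is_derive1_comp; [exact: is_derive_flat|exact: is_derive_cutoff_arg].
Qed.

Lemma is_derive_cutoff1 (rho : R) : 0 < rho -> is_derive rho 1 cutoff1 (cutoff2 rho).
Proof.
move=> r0; have dl := is_derive1_ln r0; have r1 : rho != 0 by rewrite gt_eqF.
have da := is_derive_cutoff_arg r0.
have df : is_derive rho 1 (fun t => flat (flat_deriv 1) (cutoff_arg t))
   (flat (flat_deriv (flat_deriv 1)) (cutoff_arg rho) * (- (d * ln rho + 2) * d / rho)).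
  by apply: is_derive1_comp; exact: is_derive_flat.
have ds : is_derive rho 1 (fun t : R => d * ln t + 2) (d * rho^-1 + 0).
  exact: (is_deriveD (is_deriveZ d dl)).
have dV : is_derive rho 1 (fun t : R => t^-1) (- rho ^- 2 *: 1).
  by apply: (@is_deriveV _ id).
have dg : is_derive rho 1 (fun t : R => (- d) * ((d * ln t + 2) * t^-1))
   (- d * ((d * ln rho + 2) * (- rho ^- 2 *: 1) + rho^-1 * (d * rho^-1 + 0))).
  exact: (is_deriveZ (- d) (is_deriveM ds dV)).
have -> : cutoff1 = fun t => flat (flat_deriv 1) (cutoff_arg t) *
    ((- d) * ((d * ln t + 2) * t^-1)).
  by apply/funext => t; rewrite /cutoff1; congr (_ * _); ring.
apply: is_derive_eq (is_deriveM df dg) _.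
rewrite /cutoff2 /GRing.scale /=; field; exact: r1.
Qed.

(** The right side is the second derivative in [ln rho], divided by [rho]. With [y = 1/u], the half
    in [cutoff_arg] gives [y s^2 = y - 2], so this derivative is [d^2 (y^2 (y - 2)^2 - y^2)] times
    the bump, a perfect square minus [y^2]. *)
Lemma cutoff_subsolution (rho : R) : 0 < rho ->
  - (16 * d ^+ 2) * (cutoff rho / rho) <= cutoff2 rho * rho + cutoff1 rho.
Proof.
move=> r0; have r1 : rho != 0 by rewrite gt_eqF.
rewrite /cutoff2 /cutoff1 /cutoff.
set s := d * ln rho + 2; set u := cutoff_arg rho.
have us : 2 * u = 1 - s ^+ 2 by rewrite /u /cutoff_arg -/s; field.
have -> : (flat (flat_deriv (flat_deriv 1)) u * (- s * d / rho) ^+ 2 +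
    flat (flat_deriv 1) u * ((- d ^+ 2 + s * d) / rho ^+ 2)) * rho +
    flat (flat_deriv 1) u * (- s * d / rho) =
   (d ^+ 2 / rho) * (flat (flat_deriv (flat_deriv 1)) u * s ^+ 2 - flat (flat_deriv 1) u).
  by field.
have -> : - (16 * d ^+ 2) * (flat 1 u / rho) = (d ^+ 2 / rho) * (- 16 * flat 1 u) by ring.
rewrite ler_wpM2l //; first by rewrite divr_ge0 ?sqr_ge0 // ltW.
rewrite /flat; case: ifP => u0; last by rewrite !mulr0 mul0r subr0.
set e := expR _; set y := u^-1.
have e0 : 0 <= e by exact: expR_ge0.
have -> : flat_deriv 1 = 'X^2 :> {poly R}.
  by rewrite /flat_deriv derivC subr0 mulr1.
have -> : (flat_deriv 'X^2).[y] = y ^+ 4 - 2 * y ^+ 3.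
  by rewrite /flat_deriv derivXn !hornerE /=; ring.
rewrite hornerXn hornerC mul1r.
have uy : u * y = 1 by rewrite /y mulfV // gt_eqF.
have sy : s ^+ 2 = 1 - 2 * u by rewrite us; ring.
have y2 : 2 <= y.
  have : 0 <= s ^+ 2 by exact: sqr_ge0.
  rewrite sy; have y0 : 0 < y by rewrite /y invr_gt0.
  move=> h; nra.
have key : - 16 <= (y ^+ 4 - 2 * y ^+ 3) * s ^+ 2 - y ^+ 2.
  have -> : (y ^+ 4 - 2 * y ^+ 3) * s ^+ 2 = y ^+ 2 * (y - 2) ^+ 2.
    have -> : (y ^+ 4 - 2 * y ^+ 3) * s ^+ 2 =
        (y - 2) * y ^+ 2 * (y * (1 - 2 * u)) by rewrite sy; ring.
    have -> : y * (1 - 2 * u) = y - 2 by rewrite mulrBr mulr1 mulrCA mulrC [y * u]mulrC uy mul1r.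
    ring.
  (* For [y <= 4] the square is dropped and [y^2 <= 16]; beyond, [(y - 2)^2 >= 1] makes the
     expression nonnegative. *)
  have [y4|y4] := leP y 4.
    have h1 : 0 <= y ^+ 2 * (y - 2) ^+ 2 by rewrite mulr_ge0 ?sqr_ge0.
    by have h2 : y ^+ 2 <= 16; nra.
  have h1 : 0 <= y ^+ 2 * ((y - 2) ^+ 2 - 1) by rewrite mulr_ge0 ?sqr_ge0 //; nra.
  by rewrite mulrBr mulr1 in h1; lra.
have : - 16 * e <= ((y ^+ 4 - 2 * y ^+ 3) * s ^+ 2 - y ^+ 2) * e by rewrite ler_wpM2r.
by rewrite mulrBl -mulrA [s ^+ 2 * e]mulrC mulrA.
Qed.

End Bump.

(** * Comparison of integrals and strict stability *)

Section IntegralComparison.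
Import HBNNSimple.
Local Open Scope ereal_scope.

(* No measurability is needed: the integral of a nonnegative function is the supremum
   of the integrals of the simple functions below it. *)
Lemma Rintegral_quotient_le d (T : measurableType d) (R : realType)
    (mu : {measure set T -> \bar R}) (S : set T) (g h : T -> R) (c : R) :
  (0 < c)%R -> (forall x, S x -> 0 <= g x)%R ->
  (forall x, S x -> - c * g x <= h x)%R ->
  (- (Rintegral mu S h / Rintegral mu S g) <= c)%R.
Proof.
move=> c0 g0 gh; rewrite /Rintegral.
set G := \int[mu]_(x in S) (g x)%:E.
have G0 : 0 <= G by apply: integral_ge0 => x Sx; rewrite lee_fin g0.
(* A zero or infinite denominator has [fine] value [0], and the quotient is then [0]. *)
have [GE|Gfin] := eqVneq (fine G) 0%R; first by rewrite GE invr0 mulr0 oppr0 ltW.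
have Gf : G \is a fin_num by case: (G) Gfin G0 => //=; rewrite eqxx.
have Gpos : (0 < fine G)%R by rewrite lt_def Gfin fine_ge0.
rewrite -mulNr ler_pdivrMr //.
rewrite [in leLHS]integralE.
set Hp := \int[mu]_(x in S) ((fun x => (h x)%:E) ^\+ x).
set Hn := \int[mu]_(x in S) ((fun x => (h x)%:E) ^\- x).
have Hp0 : 0 <= Hp by apply: integral_ge0.
have Hn0 : 0 <= Hn by apply: integral_ge0.
(* Only the negative part of [h] can raise the quotient. A simple function below it, scaled by
   [1/c], lies below [g]. *)
have HnG : Hn <= c%:E * G.
  rewrite {1}/Hn ge0_integralE //; apply: ge_ereal_sup => _ [s sh <-].
  have ci0 : (0 <= c^-1)%R by rewrite invr_ge0 ltW.
  have -> : sintegral mu s = c%:E * sintegral mu (scale_nnsfun s ci0).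
    rewrite -[X in _ * X]/(sintegral mu (cst c^-1 \* s)%R) sintegralrM muleA -EFinM.
    by rewrite mulfV ?gt_eqF // mul1e.
  rewrite lee_pmul2l // /G ge0_integralE => [|x Sx]; last by rewrite lee_fin g0.
  apply: ereal_sup_ubound; exists (scale_nnsfun s ci0) => //= x.
  have := sh x; rewrite /patch; case: ifPn => [/set_mem Sx|_].
    rewrite funenegE lee_fin => sx0.
    have {sx0}sx : (s x <= Num.max (- h x) 0)%R by rewrite -lee_fin EFin_max.
    rewrite mulrC ler_pdivrMr //; apply: le_trans sx _.
    rewrite ge_max [(g x * c)%R]mulrC lerNl -mulNr gh //=.
    by apply: mulr_ge0; [exact: ltW|exact: g0].
  (* Off [S] the restricted function takes the default point of [\bar R], which is [0]. *)
  rewrite -[point]/(0%R%:E) !lee_fin => sx.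
  by rewrite mulr_ge0_le0.
have Hnf : Hn \is a fin_num.
  rewrite ge0_fin_numE //; apply: le_lt_trans HnG _.
  by rewrite -(fineK Gf) -EFinM ltry.
have HnG' : (fine Hn <= c * fine G)%R by rewrite -lee_fin EFinM !fineK.
(* If the positive part has infinite integral, [fine] turns the difference into [0]. *)
have [->|Hpf] := eqVneq Hp +oo.
  have -> : fine (+oo - Hn) = 0%R by case: (Hn) Hnf.
  by rewrite oppr0; apply: mulr_ge0; exact: ltW.
have {}Hpf : Hp \is a fin_num by rewrite ge0_fin_numE // ltey.
rewrite fineB // opprB.
by apply: le_trans HnG'; rewrite lerBlDr lerDl fine_ge0.
Qed.

End IntegralComparison.

(** * Regularity and support of the cutoff fields *)

Section Cutoff.
Variables (R : realType) (n : nat) (f : mpoly.mpoly n.+1 R[i]).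
Local Notation E := 'rV[R]_(n.+1 + n.+1).
Local Notation cp := Defs.cpoint.
Local Notation M := (cone f).
Hypothesis hf : homogeneous_poly n f.

Lemma Ckr_coord (W : set E) k i : Ckr k W (fun x : E => x 0 i).
Proof.
elim: k => [|k IH].
  by move=> x _; apply: differentiable_continuous; exact: differentiable_coord.
split=> [x _|v]; first exact: differentiable_coord.
have -> : (fun x => 'D_v (fun x : E => x 0 i) x) = fun=> v 0 i.
  by apply/funext => x; have [d e] := is_diff_coord 0 i x; rewrite deriveE // e.
exact: Ckr_cst.
Qed.

Lemma Ckr_dot (W : set E) k : open W -> Ckr k W (fun x : E => dot x x).
Proof.
move=> oW; have hP := Ckr_fun_alg k oW.
have [h _] : cplx_class (Ckr k W) (fun x : E => \sum_j cp x j * (cp x j)^*).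
  apply: (cplx_class_sum hP) => j.
  have hj : cplx_class (Ckr k W) (fun x : E => cp x j) by split; exact: Ckr_coord.
  by apply: (cplx_classM hP) => //; exact: (cplx_classJ hP).
by move: h; congr Ckr; apply/funext => x; rewrite dotE.
Qed.

Lemma radial_field_smooth (W : set E) (p : R -> R) :
  open W -> (forall x, W x -> gradsq f x != 0) ->
  (forall k, Ckr k W (fun x => p (dot x x))) -> smooth W (radial_field f p).
Proof.
move=> oW W0 hp k; apply: Ck_coord => // i.
have hP := Ckr_fun_alg k oW.
have hc j : cplx_class (Ckr k W) (fun x : E => cp x j) by split; exact: Ckr_coord.
have hg j : cplx_class (Ckr k W) (gradc f j).
  exact: (cplx_class_meval hP _ (F := fun j x => cp x j)).
apply: (cvec_class (P := Ckr k W)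
  (Z := fun j y => (p (dot y y))%:C * (gradc f j y)^* / gradsq f y)) => j.
apply: (cplx_classM hP).
  by apply: (cplx_classM hP); [exact: (cplx_classR hP)|exact: (cplx_classJ hP)].
apply: (cplx_classV hP) => //; apply: (cplx_class_sum hP) => l.
by apply: (cplx_classM hP) => //; exact: (cplx_classJ hP).
Qed.

Lemma cutoff_smooth (d : R) (W : set E) k : open W -> (forall x, W x -> x != 0) ->
  Ckr k W (fun x => cutoff d (dot x x)).
Proof.
move=> oW W0.
have hl j : Ckr j W (fun x => ln (dot x x)).
  have dl (x : E) : W x -> is_derive (dot x x) 1 (@ln R) (dot x x)^-1.
    by move=> /W0 /dot_gt0; exact: is_derive1_ln.
  have dx x : W x -> is_diff x (fun x => ln (dot x x)) (fun v => 2 * (dot x x)^-1 * dot x v).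
    by move=> Wx; apply: (is_diff_radial (p' := fun t => t^-1)); exact: dl.
  (* The derivative of [ln |x|^2] is a quotient of functions already known to be smooth, so a case
     distinction suffices. *)
  case: j => [x Wx|j].
    by apply: differentiable_continuous; have [] := dx x Wx.
  split=> [x Wx|v]; first by have [] := dx x Wx.
  have [_ hd] := Ckr_dot j.+1 oW.
  apply: (@Ckr_ext _ _ _ _ (fun x => (dot x x)^-1 * 'D_v (fun x : E => dot x x) x)) => //.
    move=> x Wx; have [d1 e1] := dx x Wx.
    have [d2 e2] := is_diff_dot (is_diff_id x) (is_diff_id x).
    rewrite !deriveE // e1 e2 [dot v _]dotC; ring.
  apply: CkrM => //; last exact: hd.
  apply: CkrV => //; first exact: Ckr_dot.
  by move=> x /W0 /dot_gt0; rewrite lt0r => /andP[].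
have hP := Ckr_fun_alg k oW.
have ha : Ckr k W (fun x => cutoff_arg d (dot x x)).
  have hs : Ckr k W (fun x => d * ln (dot x x) + 2).
    by apply: CkrD => //; [apply: CkrM => //; exact: Ckr_cst|exact: Ckr_cst].
  apply: CkrM => //; last exact: Ckr_cst.
  apply: CkrD => //; first exact: Ckr_cst.
  exact: (fun_algN hP (CkrM oW hs hs)).
(* The derivatives of [flat 1] are [flat] at the iterates of [flat_deriv]. *)
apply: (@Ckr_comp _ _ setT (fun j => flat (iter j (@flat_deriv R) 1)) k W _ oW _ _ ha 0%N) => //.
by move=> j y _ /=; exact: is_derive_flat.
Qed.

Lemma cone1E (x : E) : cone1 f x <-> M x /\ dot x x <= 1.
Proof.
split => [[s [r [[fs s1] /andP[r0 r1] ->]]]|[Mx x1]].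
  have ss : dot s s = 1.
    by have := sqr_sqrtr (dot_ge0 s); rewrite -/(enorm s) s1 expr1n.
  have s0 : s != 0.
    apply: contraTneq (ltr01 : (0 : R) < 1) => s0; rewrite -ss s0.
    by rewrite /dot big1 ?ltxx // => i _; rewrite mxE mul0r.
  split; first by apply: cone_scale => //; rewrite gt_eqF.
  by rewrite dotZl dotC dotZl ss mulr1 mulr_ile1 // ltW.
have [x0 fx] := Mx; have d0 := dot_gt0 x0.
have e0 : 0 < enorm x by rewrite sqrtr_gt0.
have e2 : enorm x * enorm x = dot x x by rewrite -expr2 sqr_sqrtr // ltW.
exists ((enorm x)^-1 *: x), (enorm x); split.
- have [_ fs] := cone_scale hf (invr_neq0 (lt0r_neq0 e0)) Mx; split => //.
  have -> : enorm ((enorm x)^-1 *: x) = Num.sqrt 1; last exact: sqrtr1.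
  congr Num.sqrt; rewrite dotZl dotC dotZl -e2 mulKf ?gt_eqF //.
  by rewrite mulVf // gt_eqF.
- rewrite e0 /=; have e1 : enorm x * enorm x <= 1 by rewrite e2.
  by rewrite leNgt; apply/negP => h; nra.
- by rewrite scalerA mulfV ?scale1r // gt_eqF.
Qed.

(** As [a > 0] excludes the origin, the shell is cut out by closed conditions alone. *)
Lemma shell_compact (a b : R) : 0 < a ->
  compact [set x : E | M x /\ a <= dot x x <= b].
Proof.
move=> a0.
have cf (x : E) : ccontinuous_at x (fun x : E => f.@[cp x]).
  apply: (cplx_class_meval (continuous_fun_alg R x) f (F := fun j (x : E) => cp x j)) => j.
  by apply: ccontinuous_cpoint; exact: cvg_id.
have cd (x : E) : {for x, continuous (fun x : E => dot x x)}.
  by apply: differentiable_continuous; have [] := is_diff_dot (is_diff_id x) (is_diff_id x).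
have -> : [set x : E | M x /\ a <= dot x x <= b] =
    (fun x : E => dot x x) @^-1` `[a, b]%classic `&`
    ((fun x : E => Re (f.@[cp x])) @^-1` [set 0] `&` (fun x : E => Im (f.@[cp x])) @^-1` [set 0]).
  apply/seteqP; split => x /=; rewrite in_itv /=.
    by move=> [[_ ->] ->].
  move=> [ab [h1 h2]]; split => //; split; last exact: complex_eqP.
  apply: contraTneq (a0 : 0 < a) => x0; case/andP: ab => + _; rewrite x0.
  by rewrite /dot big1 => [|i _]; rewrite ?mxE ?mul0r // leNgt.
apply: bounded_closed_compact.
  (* [B^2 >= b], so [B] bounds each coordinate and hence the sup norm. *)
  pose B : R := 1 + `|b|.
  have b1 : 0 <= B by apply: addr_ge0.
  have hb : b <= B ^+ 2 by rewrite /B; have := ler_norm b; have := normr_ge0 b; nra.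
  exists B; split; first exact: num_real.
  move=> r hr x [/= + _]; rewrite in_itv /= => /andP[_ xb].
  apply: le_trans (ltW hr).
  rewrite /Num.norm /= mx_normrE; apply: bigmax_le; first exact: b1.
  move=> [i j] _ /=; rewrite (ord1 i).
  have hx : x 0 j ^+ 2 <= b.
    apply: le_trans xb; rewrite /dot (bigD1 j) //= -expr2 lerDl.
    by apply: sumr_ge0 => l _; rewrite -expr2 sqr_ge0.
  apply: (@le_trans _ _ (Num.sqrt (x 0 j ^+ 2))); first by rewrite sqrtr_sqr.
  apply: (@le_trans _ _ (Num.sqrt (B ^+ 2))); first by apply: ler_wsqrtr; exact: le_trans hb.
  by rewrite sqrtr_sqr ger0_norm.
apply: closedI; first by apply: preimage_closed => [x _|]; [exact: cd|exact: itv_closed].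
apply: closedI; apply: preimage_closed => [x _|];
  by [have [] := cf x|exact: closed_eq|apply: accessible_closed_set1; apply: hausdorff_accessible; exact: norm_hausdorff].
Qed.

End Cutoff.

(** * The Jacobi field and the test fields against strict stability *)

Section NotStrictlyStable.
Variables (R : realType) (n : nat) (f : mpoly.mpoly n.+1 R[i]).
Local Notation E := 'rV[R]_(n.+1 + n.+1).
Local Notation cp := Defs.cpoint.
Local Notation M := (cone f).
Hypothesis n_gt0 : (0 < n)%N.
Hypothesis hf : homogeneous_poly n f.
Hypothesis reg : forall x : E, x != 0 -> gradsq f x != 0.

Let tan x v : M x -> dfc f x v = 0 -> tangent M x v.
Proof. by move=> Mx; have [U [psi [_ _]]] := hypersurface_chart Mx (reg Mx.1); apply. Qed.

Let open_neq0 : open [set x : E | x != 0].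
Proof.
have -> : [set x : E | x != 0] = ~` [set 0].
  by apply/seteqP; split => x /= => [/eqP|/eqP].
apply: closed_openC; apply: accessible_closed_set1; apply: hausdorff_accessible.
exact: norm_hausdorff.
Qed.

Lemma radial_normal_field (S : set E) (p : R -> R) : S `<=` M ->
  (forall k, Ckr k [set x : E | x != 0] (fun x => p (dot x x))) ->
  normal_field M S (radial_field f p).
Proof.
move=> SM hp; split=> [x Sx|x Sx]; last exact: normal_dfdual.
exists [set x : E | x != 0], (radial_field f p); split => //=.
  by case: (SM x Sx).
by apply: radial_field_smooth => // y; exact: reg.
Qed.

Lemma dfdual1_jacobi : jacobi_field M n.*2 (fun x => dfdual f x 1).
Proof.
have -> : (fun x => dfdual f x 1) = radial_field f (fun=> 1) by [].
split=> [|x Mx]; first by apply: radial_normal_field => // k; exact: Ckr_cst.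
have [|->] // := stability_op_radial (p0 := fun=> 1) (p1 := fun=> 0) (p2 := fun=> 0)
  reg tan (fun t _ => is_derive_cst (1 : R) t 1) (fun t _ => is_derive_cst (0 : R) t 1)
  Mx (cone_dfc hf Mx) (theta_radial n_gt0 hf (reg Mx.1)).
by rewrite mul0r add0r mulr0 scale0r.
Qed.

Lemma dfdual1_neq0 x : x != 0 -> dfdual f x 1 <> 0.
Proof.
move=> x0 h; have := dfc_dfdual 1 (reg x0); rewrite h.
by rewrite -(scale0r 0) dfcZ mul0r => /esym /eqP; rewrite oner_eq0.
Qed.

Lemma enorm_sqr (x : E) : enorm x ^+ 2 = dot x x.
Proof. by rewrite sqr_sqrtr // dot_ge0. Qed.

Lemma radial_fieldE (p : R -> R) x : radial_field f p x = p (dot x x) *: dfdual f x 1.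
Proof. by rewrite /radial_field -dfdualZ mulr1. Qed.

Lemma cutoff_out (d rho : R) : 1 <= (d * ln rho + 2) ^+ 2 -> cutoff d rho = 0.
Proof.
move=> h; rewrite /cutoff /flat; case: ifP => //.
by rewrite /cutoff_arg ltNge => /negP []; nra.
Qed.

Lemma cutoff_admissible (d : R) : 0 < d -> admissible f (radial_field f (cutoff d)).
Proof.
move=> d0; have dn : d != 0 by rewrite gt_eqF.
have c1M : cone1 f `<=` M by move=> x /(cone1E hf) [].
split.
- apply: radial_normal_field => // k; exact: cutoff_smooth.
(* The shell is [|d ln rho + 2| <= 1], that is, [ln rho] between [-3/d] and [-1/d]; the shift by [2]
   keeps it inside [rho < 1]. *)
- exists [set x : E | M x /\ expR (- (3 / d)) <= dot x x <= expR (- (1 / d))].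
    split; first by apply: shell_compact; exact: expR_gt0.
    move=> x [Mx /andP[_ h]]; apply/(cone1E hf); split => //.
    by apply: le_trans h _; rewrite -expR0 ler_expR oppr_le0 divr_ge0 // ltW.
  move=> x /c1M Mx nK; rewrite radial_fieldE cutoff_out ?scale0r //.
  have r0 := dot_gt0 Mx.1.
  rewrite leNgt; apply/negP => h; apply: nK; split => //.
  rewrite -[dot x x]lnK ?posrE // !ler_expR -!mulNr.
  by rewrite ler_pdivrMr // ler_pdivlMr // [ln _ * d]mulrC; apply/andP; split; nra.
- have [x Mx] := cone_nonempty n_gt0 hf; have r0 := dot_gt0 Mx.1.
  (* Rescale [x] to [ln rho = -2/d], the centre of the bump. *)
  pose t := Num.sqrt (expR (- (2 / d)) / dot x x).
  have t0 : 0 < t by rewrite sqrtr_gt0 divr_gt0 // expR_gt0.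
  have tt : dot (t *: x) (t *: x) = expR (- (2 / d)).
    rewrite dotZl dotC dotZl mulrA -expr2 sqr_sqrtr ?divfK ?gt_eqF //.
    by rewrite ltW // divr_gt0 // expR_gt0.
  have Mtx : M (t *: x) by apply: cone_scale => //; rewrite gt_eqF.
  exists (t *: x).
    apply/(cone1E hf); split => //; rewrite tt -expR0 ler_expR oppr_le0.
    by rewrite divr_ge0 // ltW.
  rewrite radial_fieldE tt => /eqP; rewrite scaler_eq0 => /orP[|/eqP]; last first.
    exact: dfdual1_neq0 Mtx.1.
  rewrite /cutoff /cutoff_arg expRK mulrN mulrCA mulfV // mulr1 addNr expr0n subr0 /flat mul1r invr_gt0.
  by rewrite ltr0n /= hornerC mul1r gt_eqF // expR_gt0.
(* On the link [ln rho = 0], and [|0 + 2| >= 1] lies outside the bump. *)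
move=> x [_ x1]; rewrite radial_fieldE cutoff_out ?scale0r //.
by rewrite -enorm_sqr x1 expr1n ln1 mulr0 add0r expr2; nra.
Qed.

Lemma cutoff_quotient (d : R) : 0 < d ->
  stability_quotient f (radial_field f (cutoff d)) <= 64 * d ^+ 2.
Proof.
move=> d0; rewrite /stability_quotient /vol_integral.
apply: Rintegral_quotient_le => [|x _|x /(cone1E hf) [Mx _]].
- by rewrite mulr_gt0 // exprn_gt0.
- by rewrite mulr_ge0 ?sqr_ge0 // invr_ge0 sqr_ge0.
have r0 := dot_gt0 Mx.1; rewrite !enorm_sqr radial_fieldE.
set a := cutoff d _; set w := dfdual f x 1.
have a0 : 0 <= a by exact: flat_ge0.
have wx : 0 <= dot w w by exact: dot_ge0.
have -> : dot (a *: w) (a *: w) = a * (a * dot w w) by rewrite dotZl dotC dotZl.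
have [->|->] := stability_op_radial reg tan (is_derive_cutoff d) (is_derive_cutoff1 d)
  Mx (cone_dfc hf Mx) (theta_radial n_gt0 hf (reg Mx.1)).
  (* When the operator has its default value, the right side is [0] and the left side is
     nonpositive. *)
  rewrite dotC -(scale0r 0) dotZl mul0r mulNr oppr_le0.
  by rewrite mulr_ge0 ?divr_ge0 ?mulr_ge0 ?sqr_ge0 // ltW.
rewrite -/w dotZl [dot w (_ *: _)]dotC dotZl.
have h := cutoff_subsolution d r0; rewrite -/a in h.
(* [64 = 4 * 16]: the [4] comes from the operator on radial fields, the [16] from the bump. *)
have -> : - (64 * d ^+ 2) * (a * (a * dot w w) / dot x x) =
  4 * (a * dot w w) * (- (16 * d ^+ 2) * (a / dot x x)) by ring.
have aw : 0 <= 4 * (a * dot w w) by rewrite !mulr_ge0.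
apply: le_trans (ler_wpM2l aw h) _.
by rewrite le_eqVlt; apply/orP; left; apply/eqP; ring.
Qed.

Lemma cone_not_strictly_stable : ~ strictly_stable f.
Proof.
rewrite /strictly_stable; apply/negP; rewrite -leNgt; apply/lee_addgt0Pr => e e0.
pose d := Num.sqrt (e / 64).
have d0 : 0 < d by rewrite sqrtr_gt0 divr_gt0.
rewrite add0e; apply: ge_ereal_inf.
exists (stability_quotient f (radial_field f (cutoff d)))%:E.
  by exists (radial_field f (cutoff d)) => //; exact: cutoff_admissible.
rewrite lee_fin; apply: le_trans (cutoff_quotient d0) _.
have e64 : 0 <= e / 64 by rewrite divr_ge0 // ltW.
by rewrite sqr_sqrtr // mulrC divfK.
Qed.

End NotStrictlyStable.

Theorem theorem4p2 (R : realType) (n : nat) (f : mpoly.mpoly n.+1 R[i])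
    (hn : (1 <= n)%N)
    (hf : homogeneous_poly n f)
    (hdf : forall z : 'I_n.+1 -> R[i],
        (forall j, mpoly.meval z (mpoly.mderiv j f) = 0) -> forall j, z j = 0) :
  [/\ submanifold (cone f) n.*2,
      exists V : 'rV[R]_(n.+1 + n.+1) -> 'rV[R]_(n.+1 + n.+1),
        [/\ jacobi_field (cone f) n.*2 V,
            exists2 x, cone f x & V x <> 0 &
            homogeneity f (1 - n%:R) V] &
      ~ strictly_stable f].
Proof.
have reg x : x != 0 -> gradsq f x != 0.
  move=> x0; apply: gradsq_neq0.
  have [[j gj]|h] := pselect (exists j, gradc f j x != 0); first by exists j.
  case/negP: x0; apply/eqP; apply: cpoint_inj => j; rewrite cpoint0; apply: hdf => k.
  by apply/eqP/negPn/negP => gk; apply: h; exists k.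
split.
- move=> x Mx; have [U [psi [h1 h2 _]]] := hypersurface_chart Mx (reg x Mx.1).
  by exists U, psi.
- exists (fun x => dfdual f x 1); split.
  + exact: dfdual1_jacobi.
  + by have [x Mx] := cone_nonempty hn hf; exists x => //; exact: dfdual1_neq0 Mx.1.
  + exact: homogeneity_dfdual.
- exact: cone_not_strictly_stable.
Qed.
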